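(* Let $k\ge2$ and let $H$ be a real-analytic Hamiltonian on $(\mathbb{R}^2,\omega)$, with $\omega$ a real-analytic symplectic structure, having an $A_{k-1}$ singularity at the origin $O$. Then the pair $(H,\omega)$ has the following local symplectic normal form near $O$ for the group of $H$-preserving real-analytic diffeomorphism germs: $$\Big(H=\xi^2\pm x^k,\ \ \omega=d(f\,d\xi)\Big),\qquad f=\sum_{i=1}^{k-1}x^i f_i(x^k),$$ for some real-analytic function germs $f_i$ of one variable at $0$ with $f_1(0)\neq0$, defined uniquely modulo the following relation: if $k=2\ell$ is even, then $f$ is uniquely defined up to changing the sign of $\sum_{i=1}^{\ell-1}x^{2i}f_{2i}(x^{2\ell})$. In other words, among normal forms inducing the same orientation (i.e. with the same sign of $f_1(0)$): - if $k$ is odd, then (the Taylor series at $0$ of) $f_i$, $i=1,\dots,k-1$, form a complete and minimal set of symplectic invariants; - if $k=2\ell$ is even, then (the Taylor series at $0$ of) $f_i$, $i=1,\dots,k-1$, form a complete set of symplectic invariants with the only relation given by changing the sign of $\sum_{i=1}^{\ell-1}x^{2i}f_{2i}(x^{2\ell})$ (i.e. simultaneously changing the sign of all $f_{2i}$, $1\le i\le \ell-1$).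
   Context: All objects are real-analytic germs at the origin of $\mathbb{R}^2$. $H$ has an $A_{k-1}$ singularity at the origin if in some real-analytic (generally non-canonical) local coordinates $(x,\xi)$ it has the form $\xi^2\pm x^k$ (additive constant normalized to $0$); the sign is fixed throughout. $\mathrm{Diff}(\mathbb{R}^2,0)$, the group of real-analytic diffeomorphism germs fixing the origin, acts on pairs by $(H,\omega)\mapsto(\psi^*H,\psi^*\omega)$; two pairs are equivalent ($H$-preserving equivalence) if they lie in the same orbit. ''$(H,\omega)$ has the normal form $(\xi^2\pm x^k,\,d(f\,d\xi))$'' means that $(H,\omega)$ is equivalent to this pair. ''Complete set of invariants, with uniqueness modulo a relation'' means: two normal forms (with the same $k$, the same sign in $H$, and inducing the same orientation) given by $(f_i)$ and $(\tilde f_i)$ are equivalent if and only if $(f_i)$ and $(\tilde f_i)$ coincide modulo the stated relation. When comparing two symplectic forms $\omega_0,\omega_1$ one assumes $\omega_1/\omega_0>0$ (same orientation). *)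

(* Defs.v *)
From Stdlib Require Import Reals Arith.
From Coquelicot Require Import Coquelicot.
Local Open Scope R_scope.

(** Germs at the origin are represented by total functions, considered only
    up to equality on a neighbourhood of the origin. *)

Definition germ_eq1 (f g : R -> R) : Prop :=
  locally 0 (fun t => f t = g t).

Definition germ_eq2 {T : Type} (F G : R * R -> T) : Prop :=
  locally ((0, 0) : R * R) (fun p => F p = G p).

Definition analytic1 (f : R -> R) : Prop :=
  exists a : nat -> R, locally 0 (fun t => is_pseries a t (f t)).

(** The double power series [sum a i j x^i y^j] is summed by homogeneous
    degree; absolute convergence makes the order of summation irrelevant. *)
Definition analytic2 (F : R * R -> R) : Prop :=
  exists a : nat -> nat -> R,
    locally ((0, 0) : R * R) (fun p =>
      let term n i := a i (n - i)%nat * fst p ^ i * snd p ^ (n - i) in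
      ex_series (fun n => sum_n (fun i => Rabs (term n i)) n) /\
      is_series (fun n => sum_n (term n) n) (F p)).

Definition analytic_map_germ (psi : R * R -> R * R) : Prop :=
  psi (0, 0) = (0, 0) /\
  analytic2 (fun p => fst (psi p)) /\ analytic2 (fun p => snd (psi p)).

Definition diffeo_germ (psi : R * R -> R * R) : Prop :=
  analytic_map_germ psi /\
  exists phi : R * R -> R * R,
    analytic_map_germ phi /\
    germ_eq2 (fun p => phi (psi p)) (fun p => p) /\
    germ_eq2 (fun p => psi (phi p)) (fun p => p).

Definition dx (F : R * R -> R) (p : R * R) : R :=
  Derive (fun x => F (x, snd p)) (fst p).

Definition dxi (F : R * R -> R) (p : R * R) : R :=
  Derive (fun xi => F (fst p, xi)) (snd p).

(** [(a, b)] stands for the 1-form [a dx + b dxi]. *)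
Definition one_form : Type := ((R * R -> R) * (R * R -> R))%type.

(** [w] stands for the 2-form [w dx /\ dxi]. *)
Definition two_form : Type := R * R -> R.

Definition ext_d (alpha : one_form) : two_form :=
  fun p => dx (snd alpha) p - dxi (fst alpha) p.

Definition jacobian (psi : R * R -> R * R) (p : R * R) : R :=
  let X q := fst (psi q) in
  let Xi q := snd (psi q) in
  dx X p * dxi Xi p - dxi X p * dx Xi p.

Definition pullback2 (psi : R * R -> R * R) (w : two_form) : two_form :=
  fun p => w (psi p) * jacobian psi p.

(** Closedness is automatic in dimension two, and nondegeneracy at the origin
    implies nondegeneracy nearby. *)
Definition symplectic_germ (w : two_form) : Prop :=
  analytic2 w /\ w (0, 0) <> 0.

(** [eps = 1] or [eps = -1] is the sign in [xi^2 +- x^k]. *)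
Definition A_model (k : nat) (eps : R) : R * R -> R :=
  fun p => snd p ^ 2 + eps * fst p ^ k.

(** [A_{k-1}] singularity at the origin, with critical value 0. *)
Definition has_A_singularity (k : nat) (eps : R) (H : R * R -> R) : Prop :=
  exists psi : R * R -> R * R,
    diffeo_germ psi /\ germ_eq2 (fun p => H (psi p)) (A_model k eps).

Definition equivalent_pairs (P Q : (R * R -> R) * two_form) : Prop :=
  exists psi : R * R -> R * R,
    diffeo_germ psi /\
    germ_eq2 (fun p => fst P (psi p)) (fst Q) /\
    germ_eq2 (pullback2 psi (snd P)) (snd Q).

(** A family [f_1, ..., f_{k-1}] is a function on [nat] of which only the
    values at indices between 1 and [k-1] are ever used. *)
Definition nf_params (k : nat) (f : nat -> R -> R) : Prop :=
  (forall i, (1 <= i <= k - 1)%nat -> analytic1 (f i)) /\ f 1%nat 0 <> 0.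

Definition nf_fun (k : nat) (f : nat -> R -> R) (x : R) : R :=
  sum_n_m (fun i => x ^ i * f i (x ^ k)) 1 (k - 1).

(** The pair [(xi^2 +- x^k, d (f dxi))]. *)
Definition normal_form (k : nat) (eps : R) (f : nat -> R -> R) :
    (R * R -> R) * two_form :=
  (A_model k eps, ext_d (fun _ => 0, fun p => nf_fun k f (fst p))).

Definition same_orientation (f g : nat -> R -> R) : Prop :=
  0 < f 1%nat 0 * g 1%nat 0.

Definition coincide (k : nat) (f g : nat -> R -> R) : Prop :=
  forall i, (1 <= i <= k - 1)%nat -> germ_eq1 (f i) (g i).

(** For [k = 2 l], this changes the sign of
    [sum_(1 <= i <= l-1) x^(2i) f_(2i) (x^k)] inside [nf_fun k f]. *)
Definition flip_even (f : nat -> R -> R) : nat -> R -> R :=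
  fun i t => if Nat.even i then - f i t else f i t.

Definition taylor_coeff (f : R -> R) (m : nat) : R :=
  Derive_n f m 0 / INR (fact m).

(** The set [S] of pairs [(i, m)] is complete if the Taylor coefficients of
    order [m] of [f_i], for [(i, m)] in [S], suffice to separate normal forms
    inducing the same orientation. *)
Definition complete_coeffs (k : nat) (eps : R) (S : nat -> nat -> Prop) : Prop :=
  forall f g : nat -> R -> R,
    nf_params k f -> nf_params k g -> same_orientation f g ->
    (forall i m, (1 <= i <= k - 1)%nat -> S i m ->
       taylor_coeff (f i) m = taylor_coeff (g i) m) ->
    equivalent_pairs (normal_form k eps f) (normal_form k eps g).

(* Main.v *)
Require Import Defs.
From Stdlib Require Import Reals Arith.
From Coquelicot Require Import Coquelicot.
From Stdlib Require Import Lra Lia FunctionalExtensionality IndefiniteDescription Classical.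
Local Open Scope R_scope.

(** Write [H = xi^2 + eps x^k] and let [V] be its Hamiltonian field for the
    form [dx /\ dxi].  A form [w dx /\ dxi] is identified with its density [w],
    and [d (f dxi)] has the density [f'].  Everything rests on the quotient of
    the densities by the derivatives [V eta]: it is a module over functions of
    [H], freely generated by the classes of [1, x, ..., x^(k-2)], and so each of
    its elements has exactly one representative [f'] with [f] a combination of
    [x, ..., x^(k-1)] over functions of [x^k].

    Existence.  A coordinate change brings [H] into the form above.  Integration
    by parts along [V] trades [xi^2] for a multiple of [x^k], which reduces each
    monomial to a multiple of a power of [x]; the exponents congruent to [-1]
    modulo [k] disappear.  The product of the factors collected on the way is at
    most exponential in the degree ([reduction_bound_exp]), so that the reduction
    of a convergent series converges ([reduction]).  Hence [w + V eta = f'] for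
    some analytic [eta].  A Moser type argument realizes the change by [V eta]
    by a diffeomorphism preserving [H] ([moser]): follow the flow of [V] from
    [p] for a time [tau(p)], where [tau] makes the integral of [w] along the
    orbit equal to [eta(p)] up to a constant.  Such a [tau] exists by the
    implicit function theorem as [w(0) <> 0].

    Uniqueness.  Pulling back by a map [(X, Y)] that preserves [H] acts on the
    quotient.  The action commutes with multiplication by [H], and with the
    operation sending [d alpha] to [dH /\ alpha].  Both operations send the class
    of [x^n] to a multiple of that of [x^(n+k)], and the quotient of the two
    factors, [(n + 1) / k + 1 / 2], determines [n]; therefore the action is
    diagonal ([transition_offdiag]), and its entries are read off from the first
    jet of the map: [f_i] is multiplied by [A^(i-1) J], where [A] is the
    derivative of [X] along [x] and [J] the Jacobian, both at the origin
    ([transition_diag]).  When the orientation is kept, [H(X, Y) = H] forces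
    [J = 1], and [A = 1] or [A = -1], the latter for even [k] only; if [k = 2],
    [f_1] is the only invariant and [A] does not matter ([preserve_H_jets]).
    Conversely [- id] preserves [H] for even [k] and has [A = -1], [J = 1].
    Minimality holds because altering a single Taylor coefficient gives a normal
    form that is not equivalent to the original one.

    Analytic germs are handled through the weighted [l^1] norm of their
    coefficients on a polydisc ([anorm]).  This is a complete algebra norm, so
    that composites are obtained as convergent sums, and implicit functions and
    flows as fixed points of contractions ([An_implicit], [An_flow]). *)

(** * Absolutely convergent series *)

Lemma sum_n_O_R (u : nat -> R) : sum_n u 0 = u 0%nat.
Proof. exact (@sum_O R_AbelianMonoid u). Qed.

Lemma sum_n_S_R (u : nat -> R) n : sum_n u (S n) = sum_n u n + u (S n).
Proof. exact (@sum_Sn R_AbelianMonoid u n). Qed.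

Lemma sum_n_le_R (u v : nat -> R) N :
  (forall n, (n <= N)%nat -> u n <= v n) -> sum_n u N <= sum_n v N.
Proof.
  induction N as [|N IH]; intros H.
  - rewrite !sum_n_O_R. auto.
  - rewrite !sum_n_S_R. apply Rplus_le_compat; auto.
Qed.

Lemma sum_n_plus_R (u v : nat -> R) N :
  sum_n (fun n => u n + v n) N = sum_n u N + sum_n v N.
Proof. apply (sum_n_plus u v N). Qed.

Lemma sum_n_scal_R (c : R) (u : nat -> R) N :
  sum_n (fun n => c * u n) N = c * sum_n u N.
Proof. apply (sum_n_mult_l c u N). Qed.

Lemma sum_n_Rabs (u : nat -> R) N :
  Rabs (sum_n u N) <= sum_n (fun n => Rabs (u n)) N.
Proof.
  induction N as [|N IH].
  - rewrite !sum_n_O_R. lra.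
  - rewrite !sum_n_S_R. eapply Rle_trans; [apply Rabs_triang|]. lra.
Qed.

Lemma sum_n_nonneg (u : nat -> R) N :
  (forall n, (n <= N)%nat -> 0 <= u n) -> 0 <= sum_n u N.
Proof.
  induction N as [|N IH]; intros H.
  - rewrite sum_n_O_R. auto.
  - rewrite sum_n_S_R. specialize (H (S N) (le_n _)) as H1.
    assert (0 <= sum_n u N) by (apply IH; intros; apply H; lia). lra.
Qed.

Lemma sum_n_nonneg_incr (u : nat -> R) N K :
  (forall n, 0 <= u n) -> (N <= K)%nat -> sum_n u N <= sum_n u K.
Proof.
  intros H L. induction L as [|K L IH]; [lra|].
  rewrite sum_n_S_R. specialize (H (S K)). lra.
Qed.

Lemma le_sum_n_nonneg (u : nat -> R) N K :
  (forall n, 0 <= u n) -> (N <= K)%nat -> u N <= sum_n u K.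
Proof.
  intros H L. apply Rle_trans with (sum_n u N).
  - destruct N as [|N]; [rewrite sum_n_O_R; lra|].
    rewrite sum_n_S_R. assert (0 <= sum_n u N) by (apply sum_n_nonneg; auto). lra.
  - now apply sum_n_nonneg_incr.
Qed.

Lemma sum_n_ext_R (u v : nat -> R) N :
  (forall n, (n <= N)%nat -> u n = v n) -> sum_n u N = sum_n v N.
Proof. intros H. now apply sum_n_ext_loc. Qed.

Lemma is_series_ext_R (u v : nat -> R) (l : R) :
  (forall n, u n = v n) -> is_series u l -> is_series v l.
Proof. intros H. apply is_series_ext. exact H. Qed.

Lemma is_series_plus_R (u v : nat -> R) (k l : R) :
  is_series u k -> is_series v l -> is_series (fun n => u n + v n) (k + l).
Proof. exact (is_series_plus u v k l). Qed.

Lemma is_series_minus_R (u v : nat -> R) (k l : R) :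
  is_series u k -> is_series v l -> is_series (fun n => u n - v n) (k - l).
Proof. exact (is_series_minus u v k l). Qed.

Lemma is_series_scal_R (c : R) (u : nat -> R) (l : R) :
  is_series u l -> is_series (fun n => c * u n) (c * l).
Proof. exact (is_series_scal c u l). Qed.

Lemma is_series_is_lim_seq (u : nat -> R) (l : R) :
  is_series u l <-> is_lim_seq (sum_n u) l.
Proof. split; intros H; exact H. Qed.

Lemma ex_series_bounded (v : nat -> R) (M : R) :
  (forall n, 0 <= v n) -> (forall N, sum_n v N <= M) -> ex_series v.
Proof.
  intros H0 H.
  destruct (ex_finite_lim_seq_incr (sum_n v) M) as [l Hl]; auto.
  - intros n. rewrite sum_n_S_R. specialize (H0 (S n)). lra.
  - exists l. exact Hl.
Qed.

Lemma Series_le_bound (v : nat -> R) (M : R) :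
  ex_series v -> (forall N, sum_n v N <= M) -> Series v <= M.
Proof.
  intros Hv H. apply Series_correct in Hv.
  assert (Hl : Rbar_le (Series v) M).
  { eapply is_lim_seq_le; [|exact Hv|apply is_lim_seq_const]. exact H. }
  exact Hl.
Qed.

Lemma sum_n_le_Series (v : nat -> R) N :
  (forall n, 0 <= v n) -> ex_series v -> sum_n v N <= Series v.
Proof.
  intros H0 Hv. apply Series_correct in Hv.
  apply (is_lim_seq_incr_compare (sum_n v) (Series v)); [exact Hv|].
  intros n. rewrite sum_n_S_R. specialize (H0 (S n)). lra.
Qed.

Section Dominated.
Context (u v : nat -> R) (M : R).
Hypothesis Huv : forall n, Rabs (u n) <= v n.
Hypothesis Hv : forall N, sum_n v N <= M.

Lemma dominated_nonneg n : 0 <= v n.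
Proof. eapply Rle_trans; [apply Rabs_pos|apply Huv]. Qed.

Lemma dominated_ex_abs : ex_series (fun n => Rabs (u n)).
Proof.
  apply ex_series_bounded with M; [intros; apply Rabs_pos|].
  intros N. eapply Rle_trans; [|apply (Hv N)]. apply sum_n_le_R; auto.
Qed.

Lemma dominated_ex : ex_series u.
Proof. apply ex_series_Rabs, dominated_ex_abs. Qed.

Lemma dominated_bound l : is_series u l -> Rabs l <= M.
Proof.
  intros Hl. rewrite <- (is_series_unique _ _ Hl).
  eapply Rle_trans; [apply Series_Rabs, dominated_ex_abs|].
  apply Series_le_bound; [apply dominated_ex_abs|].
  intros N. eapply Rle_trans; [|apply (Hv N)]. apply sum_n_le_R; auto.
Qed.
End Dominated.

Lemma is_series_delta (u : nat -> R) k l :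
  (forall n, n <> k -> u n = 0) -> u k = l -> is_series u l.
Proof.
  intros H <-.
  assert (Hs : forall N, (k <= N)%nat -> sum_n u N = u k :> R).
  { assert (Hlt : forall N, (N < k)%nat -> sum_n u N = 0 :> R).
    { induction N; intros L; [rewrite sum_n_O_R; apply H; lia|].
      rewrite sum_n_S_R, IHN, H by lia. ring. }
    intros N L. induction L as [|N L IH].
    - destruct k; [apply sum_n_O_R|]. rewrite sum_n_S_R, Hlt by lia. ring.
    - rewrite sum_n_S_R, IH, (H (S N)) by lia. ring. }
  apply is_series_is_lim_seq. apply is_lim_seq_ext_loc with (fun _ => u k).
  - exists k. intros n L. now rewrite Hs.
  - apply is_lim_seq_const.
Qed.

(** Tannery's theorem, i.e. dominated convergence for series: a tail of the
    dominating series is small, and finitely many terms tend to [0]. *)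
Lemma Tannery (v : nat -> nat -> R) (B : nat -> R) (M : R) :
  (forall N k, Rabs (v N k) <= B k) -> (forall K, sum_n B K <= M) ->
  (forall k, is_lim_seq (fun N => v N k) 0) ->
  is_lim_seq (fun N => Series (v N)) 0.
Proof.
  intros Hv HB Hl.
  assert (HB0 : forall k, 0 <= B k)
    by (intros k; eapply Rle_trans; [apply Rabs_pos|apply (Hv 0%nat k)]).
  assert (HexB : ex_series B) by (eapply ex_series_bounded; eauto).
  assert (Hfin : forall K, is_lim_seq (fun N => sum_n (fun k => Rabs (v N k)) K) 0).
  { induction K as [|K IH].
    - apply is_lim_seq_ext with (fun N => Rabs (v N 0%nat)).
      + intros; now rewrite sum_n_O_R.
      + replace (Finite 0) with (Rbar_abs 0) by (simpl; now rewrite Rabs_R0).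
        now apply is_lim_seq_abs.
    - apply is_lim_seq_ext with
        (fun N => sum_n (fun k => Rabs (v N k)) K + Rabs (v N (S K))).
      + intros; now rewrite sum_n_S_R.
      + replace 0 with (0 + 0) by ring. apply is_lim_seq_plus'; auto.
        replace (Finite 0) with (Rbar_abs 0) by (simpl; now rewrite Rabs_R0).
        now apply is_lim_seq_abs. }
  apply is_lim_seq_spec. intros e.
  pose proof (Series_correct _ HexB) as HS.
  apply is_series_is_lim_seq, is_lim_seq_spec in HS.
  assert (he : 0 < e / 2) by (pose proof (cond_pos e); lra).
  destruct (HS (mkposreal _ he)) as [K HK]. simpl in HK.
  pose proof (Hfin K) as HfK. apply is_lim_seq_spec in HfK.
  destruct (HfK (mkposreal _ he)) as [N0 HN0]. simpl in HN0.
  exists N0. intros N HN. rewrite Rminus_0_r.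
  assert (Hexa : ex_series (fun k => Rabs (v N k)))
    by (eapply dominated_ex_abs; eauto).
  eapply Rle_lt_trans; [apply Series_Rabs, Hexa|].
  apply Rle_lt_trans with
    (sum_n (fun k => Rabs (v N k)) K + (Series B - sum_n B K)).
  - apply Series_le_bound; auto. intros L.
    destruct (le_lt_dec L K) as [HL|HL].
    + pose proof (sum_n_nonneg_incr (fun k => Rabs (v N k)) L K
        (fun _ => Rabs_pos _) HL).
      pose proof (sum_n_le_Series B K HB0 HexB). simpl in *. lra.
    + assert (sum_n (fun k => Rabs (v N k)) L - sum_n (fun k => Rabs (v N k)) K
              <= sum_n B L - sum_n B K).
      { clear - Hv HL. induction HL as [|L HL IH].
        - rewrite !sum_n_S_R. pose proof (Hv N (S K)). lra.
        - rewrite !sum_n_S_R. pose proof (Hv N (S L)). lra. }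
      pose proof (sum_n_le_Series B L HB0 HexB). lra.
  - specialize (HN0 N HN). specialize (HK K (le_n _)).
    rewrite Rminus_0_r in HN0. apply Rabs_lt_between in HN0, HK. lra.
Qed.

Lemma ex_series_sum_n (u : nat -> nat -> R) N :
  (forall n, ex_series (fun k => u k n)) ->
  is_series (fun k => sum_n (u k) N) (sum_n (fun n => Series (fun k => u k n)) N).
Proof.
  intros H. induction N as [|N IH].
  - rewrite sum_n_O_R. eapply is_series_ext_R; [|apply Series_correct, H].
    intros; simpl. now rewrite sum_n_O_R.
  - rewrite sum_n_S_R. eapply is_series_ext_R.
    2:{ apply is_series_plus_R; [exact IH|apply Series_correct, (H (S N))]. }
    intros; simpl. now rewrite sum_n_S_R.
Qed.

(** The remainders of the inner series tend to [0] and are dominated, so that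
    Tannery's theorem permits to exchange the sums. *)
Lemma Fubini_series (u b : nat -> nat -> R) (B s : nat -> R) (B' S : R) :
  (forall k n, Rabs (u k n) <= b k n) ->
  (forall k N, sum_n (b k) N <= B k) -> (forall K, sum_n B K <= B') ->
  (forall k, is_series (u k) (s k)) -> is_series s S ->
  is_series (fun n => Series (fun k => u k n)) S.
Proof.
  intros Hub Hb HB Hs HS.
  assert (Hb0 : forall k n, 0 <= b k n) by (intros; eapply dominated_nonneg; eauto).
  assert (HbB : forall k n, b k n <= B k).
  { intros k n. eapply Rle_trans; [|apply (Hb k n)]. apply le_sum_n_nonneg; auto. }
  assert (HexB : forall n, ex_series (fun k => u k n)).
  { intros n. eapply dominated_ex with (v := B); [|exact HB].
    intros k. eapply Rle_trans; eauto. }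
  assert (Hlim : is_lim_seq
    (fun N => Series (fun k => s k - sum_n (u k) N)) 0).
  { apply Tannery with (B := fun k => 2 * B k) (M := 2 * B').
    - intros N k.
      assert (Rabs (s k) <= B k) by (eapply dominated_bound; eauto).
      assert (Rabs (sum_n (u k) N) <= B k).
      { eapply Rle_trans; [apply sum_n_Rabs|].
        eapply Rle_trans; [|apply (Hb k N)]. apply sum_n_le_R; auto. }
      unfold Rminus. eapply Rle_trans; [apply Rabs_triang|]. rewrite Rabs_Ropp. lra.
    - intros K. rewrite sum_n_scal_R. specialize (HB K). lra.
    - intros k. replace 0 with (s k - s k) by ring.
      apply is_lim_seq_minus'; [apply is_lim_seq_const|]. apply Hs. }
  apply is_series_is_lim_seq.
  apply is_lim_seq_ext with
    (fun N => S - Series (fun k => s k - sum_n (u k) N)).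
  - intros N.
    assert (E : is_series (fun k => s k - sum_n (u k) N)
      (S - sum_n (fun n => Series (fun k => u k n)) N)).
    { apply (is_series_minus_R s (fun k => sum_n (u k) N)); auto.
      now apply ex_series_sum_n. }
    rewrite (is_series_unique _ _ E). simpl. ring.
  - pose proof (is_lim_seq_minus' _ _ S 0 (is_lim_seq_const S) Hlim) as E.
    rewrite Rminus_0_r in E. exact E.
Qed.

(** * Power series with finite weighted sum of coefficients *)

Definition pt := nat -> R.

Definition dom (d : nat) (r : R) (p : pt) : Prop :=
  forall i, (i < d)%nat -> Rabs (p i) < r.

(** The [l^1] norm, weighted by the radius [r], of the coefficients of a power
    series in [p 0, ..., p (d-1)] with sum [F] is at most [M].  The series is
    summed one variable at a time, so that closure properties follow by
    induction on the number of variables from facts on series of one variable. *)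
Fixpoint anorm (d : nat) (r : R) (F : pt -> R) (M : R) : Prop :=
  match d with
  | O => exists c, Rabs c <= M /\ forall p, F p = c
  | S d => exists (Fn : nat -> pt -> R) (Mn : nat -> R),
      (forall n, anorm d r (Fn n) (Mn n)) /\
      (forall N, sum_n (fun n => Mn n * r ^ n) N <= M) /\
      (forall p, dom (S d) r p -> is_series (fun n => Fn n p * p d ^ n) (F p))
  end.

Lemma dom_S d r p : dom (S d) r p -> dom d r p.
Proof. intros H i Hi. apply H. lia. Qed.

Lemma dom_le d r s p : s <= r -> dom d s p -> dom d r p.
Proof. intros H Hp i Hi. specialize (Hp i Hi). lra. Qed.

Lemma dom_last d r p : dom (S d) r p -> Rabs (p d) < r.
Proof. intros H. apply H. lia. Qed.

Lemma dom_zero d r : 0 < r -> dom d r (fun _ => 0).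
Proof. intros H i _. now rewrite Rabs_R0. Qed.

Lemma anorm_nonneg d r F M : anorm d r F M -> 0 <= M.
Proof.
  revert F M. induction d as [|d IH]; intros F M.
  - intros (c & H & _). eapply Rle_trans; [apply Rabs_pos|eassumption].
  - intros (Fn & Mn & H1 & H2 & _). specialize (H2 0%nat).
    rewrite sum_n_O_R in H2. specialize (IH _ _ (H1 0%nat)). simpl in H2. lra.
Qed.

Lemma anorm_ext d r F G M :
  anorm (S d) r F M -> (forall p, dom (S d) r p -> F p = G p) ->
  anorm (S d) r G M.
Proof.
  intros (Fn & Mn & H1 & H2 & H3) E. exists Fn, Mn. repeat split; auto.
  intros p Hp. rewrite <- E; auto.
Qed.

Lemma anorm_feq d r F G M : anorm d r F M -> (forall p, F p = G p) -> anorm d r G M.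
Proof. intros H E. replace G with F; auto. apply functional_extensionality, E. Qed.

Lemma anorm_mono d r F M M' : anorm d r F M -> M <= M' -> anorm d r F M'.
Proof.
  destruct d; simpl.
  - intros (c & H & E) L. exists c. split; auto. lra.
  - intros (Fn & Mn & H1 & H2 & H3) L. exists Fn, Mn. repeat split; auto.
    intros N. specialize (H2 N). lra.
Qed.

Lemma pow_le_Rabs x r n : Rabs x <= r -> Rabs (x ^ n) <= r ^ n.
Proof. intros H. rewrite <- RPow_abs. apply pow_incr. split; auto. apply Rabs_pos. Qed.

Lemma anorm_bound d r F M p : anorm d r F M -> dom d r p -> Rabs (F p) <= M.
Proof.
  revert F M. induction d as [|d IH]; intros F M.
  - intros (c & H & E) _. now rewrite E.
  - intros (Fn & Mn & H1 & H2 & H3) Hp.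
    eapply dominated_bound with (v := fun n => Mn n * r ^ n);
      [|exact H2|exact (H3 p Hp)].
    intros n. cbv beta. rewrite Rabs_mult.
    apply Rmult_le_compat; try apply Rabs_pos.
    + apply IH; auto. now apply dom_S.
    + apply pow_le_Rabs. apply Rlt_le, dom_last, Hp.
Qed.

Lemma anorm_terms d r Fn Mn M p :
  (forall n, anorm d r (Fn n) (Mn n)) ->
  (forall N, sum_n (fun n => Mn n * r ^ n) N <= M) -> dom (S d) r p ->
  forall n, Rabs (Fn n p * p d ^ n) <= Mn n * r ^ n.
Proof.
  intros H1 H2 Hp n. rewrite Rabs_mult.
  apply Rmult_le_compat; try apply Rabs_pos.
  - eapply anorm_bound; eauto. now apply dom_S.
  - apply pow_le_Rabs. apply Rlt_le, dom_last, Hp.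
Qed.

(** Points have infinitely many coordinates, of which only the first [d] matter
    for the function. *)
Lemma anorm_local d r F M p q :
  anorm d r F M -> dom d r p -> (forall i, (i < d)%nat -> p i = q i) -> F p = F q.
Proof.
  revert F M. induction d as [|d IH]; intros F M.
  - intros (c & H & E) _ _. now rewrite !E.
  - intros (Fn & Mn & H1 & H2 & H3) Hp E.
    assert (Hq : dom (S d) r q) by (intros i Hi; rewrite <- E; auto).
    pose proof (H3 p Hp) as Sp. pose proof (H3 q Hq) as Sq.
    rewrite <- (is_series_unique _ _ Sp), <- (is_series_unique _ _ Sq).
    apply Series_ext. intros n. rewrite (E d) by lia. f_equal.
    apply (IH _ _ (H1 n)); [now apply dom_S|]. auto.
Qed.

Lemma anorm_const d r c : 0 <= r -> anorm d r (fun _ => c) (Rabs c).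
Proof.
  intros Hr. induction d as [|d IH].
  - exists c. split; [lra|auto].
  - exists (fun n => match n with O => fun _ => c | _ => fun _ => 0 end),
      (fun n => match n with O => Rabs c | _ => 0 end).
    repeat split.
    + intros [|n]; auto. clear IH.
      induction d as [|d IH].
      * exists 0. rewrite Rabs_R0. split; [lra|auto].
      * exists (fun _ _ => 0), (fun _ => 0). repeat split; auto.
        -- intros N. right. induction N; [rewrite sum_n_O_R|rewrite sum_n_S_R, IHN]; ring.
        -- intros p _.
           apply is_series_delta with 0%nat; intros; simpl; ring.
    + intros N. right. induction N; [rewrite sum_n_O_R|rewrite sum_n_S_R, IHN]; simpl; ring.
    + intros p _.
      apply is_series_delta with 0%nat; [intros [|n] H; [lia|simpl; ring]|simpl; ring].
Qed.

Lemma anorm_const0 d r M : 0 <= r -> 0 <= M -> anorm d r (fun _ => 0) M.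
Proof.
  intros Hr HM. eapply anorm_mono; [apply anorm_const; auto|]. now rewrite Rabs_R0.
Qed.

Lemma anorm_weaken d r F M : 0 <= r -> anorm d r F M -> anorm (S d) r F M.
Proof.
  intros Hr H.
  exists (fun n => match n with O => F | _ => fun _ => 0 end),
      (fun n => match n with O => M | _ => 0 end).
  repeat split.
  - intros [|n]; auto. apply anorm_const0; lra.
  - intros N. right. induction N; [rewrite sum_n_O_R|rewrite sum_n_S_R, IHN]; simpl; ring.
  - intros p _.
    apply is_series_delta with 0%nat; [intros [|n] Hn; [lia|simpl; ring]|simpl; ring].
Qed.

Lemma anorm_var d r i : 0 <= r -> (i < d)%nat -> anorm d r (fun p => p i) r.
Proof.
  intros Hr. induction d as [|d IH]; intros Hi; [lia|].
  destruct (Nat.eq_dec i d) as [->|Hne].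
  2:{ apply anorm_weaken; auto. apply IH. lia. }
  exists (fun n => match n with 1%nat => fun _ => 1 | _ => fun _ => 0 end),
      (fun n => match n with 1%nat => 1 | _ => 0 end).
  repeat split.
  - intros [|[|n]]; try (apply anorm_const0; lra).
    eapply anorm_mono; [now apply anorm_const|]. rewrite Rabs_R1; lra.
  - intros [|N]; [rewrite sum_n_O_R; lra|].
    right. induction N; rewrite sum_n_S_R; [rewrite sum_n_O_R|rewrite IHN]; simpl; ring.
  - intros p _.
    apply is_series_delta with 1%nat; [intros [|[|n]] Hn; try lia; simpl; ring|simpl; ring].
Qed.

Lemma anorm_add d r F G M N :
  anorm d r F M -> anorm d r G N -> anorm d r (fun p => F p + G p) (M + N).
Proof.
  revert F G M N. induction d as [|d IH]; intros F G M N.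
  - intros (c & H & E) (c' & H' & E'). exists (c + c'). split.
    + eapply Rle_trans; [apply Rabs_triang|lra].
    + intros p. now rewrite E, E'.
  - intros (Fn & Mn & H1 & H2 & H3) (Gn & Nn & H1' & H2' & H3').
    exists (fun n p => Fn n p + Gn n p), (fun n => Mn n + Nn n). repeat split; auto.
    + intros K. specialize (H2 K). specialize (H2' K).
      erewrite sum_n_ext_R; [rewrite sum_n_plus_R; apply Rplus_le_compat; eassumption|].
      intros; simpl; ring.
    + intros p Hp. eapply is_series_ext_R; [|apply is_series_plus_R; [apply H3|apply H3']; auto].
      intros; simpl; ring.
Qed.

Lemma anorm_scal d r c F M :
  anorm d r F M -> anorm d r (fun p => c * F p) (Rabs c * M).
Proof.
  revert F M. induction d as [|d IH]; intros F M.
  - intros (c' & H & E). exists (c * c'). split.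
    + rewrite Rabs_mult. apply Rmult_le_compat_l; auto. apply Rabs_pos.
    + intros p. now rewrite E.
  - intros (Fn & Mn & H1 & H2 & H3).
    exists (fun n p => c * Fn n p), (fun n => Rabs c * Mn n). repeat split; auto.
    + intros K. specialize (H2 K).
      erewrite sum_n_ext_R; [rewrite sum_n_scal_R; apply Rmult_le_compat_l; [apply Rabs_pos|eassumption]|].
      intros; simpl; ring.
    + intros p Hp. eapply is_series_ext_R; [|apply (is_series_scal_R c); apply H3; auto].
      intros; simpl; ring.
Qed.

Lemma anorm_sub d r F G M N :
  anorm d r F M -> anorm d r G N -> anorm d r (fun p => F p - G p) (M + N).
Proof.
  intros H H'. eapply anorm_mono.
  - eapply anorm_feq; [apply (anorm_add _ _ _ _ _ _ H (anorm_scal _ _ (-1) _ _ H'))|].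
    intros; simpl; ring.
  - rewrite (Rabs_left (-1)) by lra. lra.
Qed.

Lemma anorm_sum_n d r (F : nat -> pt -> R) (M : nat -> R) N :
  (forall n, anorm d r (F n) (M n)) ->
  anorm d r (fun p => sum_n (fun n => F n p) N) (sum_n M N).
Proof.
  intros H. induction N as [|N IH].
  - rewrite sum_n_O_R. eapply anorm_feq; [apply (H 0%nat)|].
    intros; simpl; now rewrite sum_n_O_R.
  - rewrite sum_n_S_R. eapply anorm_feq; [apply anorm_add; [exact IH|apply (H (S N))]|].
    intros; simpl; now rewrite sum_n_S_R.
Qed.

(** Completeness of the norm: a normally convergent series of functions is
    again a power series of finite norm. *)
Lemma anorm_series d r (F : nat -> pt -> R) (M : nat -> R) G M' :
  0 < r -> (forall k, anorm d r (F k) (M k)) -> (forall K, sum_n M K <= M') ->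
  (forall p, dom d r p -> is_series (fun k => F k p) (G p)) ->
  (d = 0%nat -> forall p, G p = G (fun _ => 0)) ->
  anorm d r G M'.
Proof.
  intros Hr. revert F M G M'. induction d as [|d IH]; intros F M G M' HF HM HG H0.
  - exists (G (fun _ => 0)). split; [|auto].
    eapply dominated_bound with (u := fun k => F k (fun _ => 0)); [|exact HM|].
    + intros n. apply (anorm_bound 0 r). apply HF. intros i Hi. lia.
    + apply HG. intros i Hi. lia.
  - clear H0. simpl in HF.
    apply functional_choice in HF. destruct HF as [Fn HF].
    apply functional_choice in HF. destruct HF as [Mn HF].
    assert (HMn0 : forall k n, 0 <= Mn k n).
    { intros k n. eapply anorm_nonneg. apply (HF k). }
    assert (Hrn : forall n, 0 < r ^ n) by (intros; now apply pow_lt).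
    assert (Hterm0 : forall k n, 0 <= Mn k n * r ^ n).
    { intros k n. apply Rmult_le_pos; auto. apply Rlt_le, Hrn. }
    assert (Hterm : forall k n, Mn k n * r ^ n <= M k).
    { intros k n. destruct (HF k) as (_ & H2 & _).
      eapply Rle_trans; [|apply (H2 n)].
      apply (le_sum_n_nonneg (fun n => Mn k n * r ^ n)); auto. }
    assert (HexMr : forall n, ex_series (fun k => Mn k n * r ^ n)).
    { intros n. eapply dominated_ex with (v := M); [|exact HM].
      intros k. rewrite Rabs_pos_eq; auto. }
    assert (HsumM : forall n K, sum_n (fun k => Mn k n) K <= M' / r ^ n).
    { intros n K. apply Rmult_le_reg_l with (r ^ n); auto.
      rewrite <- sum_n_scal_R. replace (r ^ n * (M' / r ^ n)) with M'.
      2:{ field. specialize (Hrn n). lra. }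
      eapply Rle_trans; [|apply (HM K)]. apply sum_n_le_R.
      intros k _. specialize (Hterm k n). lra. }
    assert (HexM : forall n, ex_series (fun k => Mn k n)).
    { intros n. eapply ex_series_bounded; auto. }
    assert (HexF : forall n p, dom d r p -> ex_series (fun k => Fn k n p)).
    { intros n p Hp. eapply dominated_ex; [|apply (HsumM n)].
      intros k. eapply anorm_bound; eauto. apply (HF k). }
    exists (fun n p => Series (fun k => Fn k n p)), (fun n => Series (fun k => Mn k n)).
    repeat split.
    + intros n. apply IH with (F := fun k => Fn k n) (M := fun k => Mn k n).
      * intros k. apply (HF k).
      * intros K. apply sum_n_le_Series; auto.
      * intros p Hp. apply Series_correct. auto.
      * intros -> p. apply Series_ext. intros k.
        destruct (HF k) as (H1 & _). destruct (H1 n) as (c & _ & E). now rewrite !E.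
    + intros N.
      pose proof (ex_series_sum_n (fun k n => Mn k n * r ^ n) N HexMr) as E.
      replace (sum_n (fun n => Series (fun k => Mn k n) * r ^ n) N)
        with (sum_n (fun n => Series (fun k => Mn k n * r ^ n)) N).
      2:{ apply sum_n_ext_R. intros n _. apply Series_scal_r. }
      rewrite <- (is_series_unique _ _ E). apply Series_le_bound; [eexists; exact E|].
      intros K. eapply Rle_trans; [|apply (HM K)]. apply sum_n_le_R.
      intros k _. apply (HF k).
    + intros p Hp.
      eapply is_series_ext_R.
      2:{ apply Fubini_series with (u := fun k n => Fn k n p * p d ^ n)
            (b := fun k n => Mn k n * r ^ n) (B := M) (B' := M') (s := fun k => F k p).
          - intros k n. destruct (HF k) as (H1 & H2 & _). eapply anorm_terms; eauto.
          - intros k. apply (HF k).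
          - exact HM.
          - intros k. apply (HF k). exact Hp.
          - now apply HG. }
      intros n. simpl. apply Series_scal_r.
Qed.

Lemma sum_n_sum_f_R0 (u : nat -> R) N : sum_n u N = sum_f_R0 u N.
Proof. apply sum_n_Reals. Qed.

(** The norm is submultiplicative by Mertens' theorem on Cauchy products,
    applied in the last variable. *)
Lemma anorm_mul d r F G M N :
  0 <= r -> anorm d r F M -> anorm d r G N -> anorm d r (fun p => F p * G p) (M * N).
Proof.
  intros Hr. revert F G M N. induction d as [|d IH]; intros F G M N.
  - intros (c & H & E) (c' & H' & E'). exists (c * c'). split.
    + rewrite Rabs_mult. apply Rmult_le_compat; auto using Rabs_pos.
    + intros p. now rewrite E, E'.
  - intros (Fn & Mn & H1 & H2 & H3) (Gn & Nn & H1' & H2' & H3').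
    assert (HM0 : forall n, 0 <= Mn n) by (intros n; eapply anorm_nonneg; apply H1).
    assert (HN0 : forall n, 0 <= Nn n) by (intros n; eapply anorm_nonneg; apply H1').
    assert (Hrn : forall n, 0 <= r ^ n) by (intros; now apply pow_le).
    assert (HMr : forall n, 0 <= Mn n * r ^ n) by (intros; apply Rmult_le_pos; auto).
    assert (HNr : forall n, 0 <= Nn n * r ^ n) by (intros; apply Rmult_le_pos; auto).
    exists (fun n p => sum_n (fun i => Fn i p * Gn (n - i)%nat p) n),
      (fun n => sum_n (fun i => Mn i * Nn (n - i)%nat) n).
    assert (Hpow : forall x i n, (i <= n)%nat -> x ^ n = x ^ i * x ^ (n - i)).
    { intros x i n L. rewrite <- pow_add. f_equal. lia. }
    assert (Hconv : forall (a b : nat -> R) x n,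
      sum_n (fun i => a i * b (n - i)%nat) n * x ^ n
      = sum_f_R0 (fun i => (a i * x ^ i) * (b (n - i)%nat * x ^ (n - i))) n).
    { intros a b x n. rewrite <- sum_n_sum_f_R0, Rmult_comm, <- sum_n_scal_R.
      apply sum_n_ext_R. intros i L. rewrite (Hpow x i n L). ring. }
    repeat split.
    + intros n. apply (anorm_sum_n d r (fun i p => Fn i p * Gn (n - i)%nat p)).
      intros i. apply IH; auto.
    + intros K.
      assert (EM : ex_series (fun n => Mn n * r ^ n)) by (eapply ex_series_bounded; eauto).
      assert (EN : ex_series (fun n => Nn n * r ^ n)) by (eapply ex_series_bounded; eauto).
      assert (Habs : forall u : nat -> R, (forall n, 0 <= u n) -> ex_series u -> ex_series (fun n => Rabs (u n))).
      { intros u Hu Hx. eapply ex_series_ext; [|exact Hx]. intros; simpl.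
        rewrite Rabs_pos_eq; auto. }
      pose proof (is_series_mult _ _ _ _ (Series_correct _ EM) (Series_correct _ EN)
        (Habs _ HMr EM) (Habs _ HNr EN)) as E.
      apply Rle_trans with (Series (fun n => Mn n * r ^ n) * Series (fun n => Nn n * r ^ n)).
      * rewrite <- (is_series_unique _ _ E).
        erewrite sum_n_ext_R; [apply sum_n_le_Series|].
        -- intros n. rewrite <- sum_n_sum_f_R0. apply sum_n_nonneg. intros.
           apply Rmult_le_pos; auto.
        -- eexists; exact E.
        -- intros n _. apply Hconv.
      * apply Rmult_le_compat.
        -- eapply Rle_trans; [|apply (sum_n_le_Series _ 0 HMr EM)]. rewrite sum_n_O_R. auto.
        -- eapply Rle_trans; [|apply (sum_n_le_Series _ 0 HNr EN)]. rewrite sum_n_O_R. auto.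
        -- now apply Series_le_bound.
        -- now apply Series_le_bound.
    + intros p Hp.
      pose proof (anorm_terms _ _ _ _ _ _ H1 H2 Hp) as T.
      pose proof (anorm_terms _ _ _ _ _ _ H1' H2' Hp) as T'.
      pose proof (is_series_mult _ _ _ _ (H3 p Hp) (H3' p Hp)
        (dominated_ex_abs _ _ _ T H2) (dominated_ex_abs _ _ _ T' H2')) as E.
      eapply is_series_ext_R; [|exact E]. intros n. symmetry.
      apply (Hconv (fun i => Fn i p) (fun i => Gn i p)).
Qed.

Lemma anorm_pow d r F M n :
  0 <= r -> anorm d r F M -> anorm d r (fun p => F p ^ n) (M ^ n).
Proof.
  intros Hr H. induction n as [|n IH]; simpl.
  - eapply anorm_mono; [now apply anorm_const|]. rewrite Rabs_R1; lra.
  - now apply anorm_mul.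
Qed.

(** The composite is the normally convergent sum of the [F_n(G) G_d^n], where
    [F_n] depends on one variable less. *)
Lemma anorm_comp d r F M e s (G : nat -> pt -> R) rho :
  0 < s -> rho < r -> anorm d r F M ->
  (forall i, (i < d)%nat -> anorm e s (G i) rho) ->
  anorm e s (fun p => F (fun i => G i p)) M.
Proof.
  intros Hs Hrho. revert F M. induction d as [|d IH]; intros F M.
  - intros (c & H & E) _. eapply anorm_mono; [|exact H].
    eapply anorm_feq; [apply anorm_const; lra|]. intros; simpl; now rewrite E.
  - intros (Fn & Mn & H1 & H2 & H3) HG.
    assert (Hrho0 : 0 <= rho) by (eapply anorm_nonneg; apply (HG d); lia).
    assert (Hdom : forall p, dom e s p -> dom (S d) r (fun i => G i p)).
    { intros p Hp i Hi. eapply Rle_lt_trans; [eapply anorm_bound; eauto|lra]. }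
    eapply anorm_series with (F := fun n p => Fn n (fun i => G i p) * G d p ^ n)
      (M := fun n => Mn n * r ^ n); auto.
    + intros n. eapply anorm_mono.
      * apply anorm_mul; [lra|apply IH; auto|apply anorm_pow; [lra|apply HG; lia]].
      * apply Rmult_le_compat_l; [eapply anorm_nonneg; apply H1|].
        apply pow_incr. lra.
    + intros -> p.
      assert (Hd : forall q, dom 0 s q) by (intros q i Hi; lia).
      apply (anorm_local (S d) r F M); auto.
      * exists Fn, Mn; auto.
      * intros i Hi. destruct (HG i Hi) as (c & _ & E). now rewrite !E.
Qed.

Lemma anorm_le d r s F M : 0 < s <= r -> anorm d r F M -> anorm d s F M.
Proof.
  intros Hs. revert F M. induction d as [|d IH]; intros F M; simpl; auto.
  intros (Fn & Mn & H1 & H2 & H3). exists Fn, Mn. repeat split; auto.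
  - intros K. eapply Rle_trans; [|apply (H2 K)]. apply sum_n_le_R. intros n _.
    apply Rmult_le_compat_l; [eapply anorm_nonneg; apply H1|]. apply pow_incr; lra.
  - intros p Hp. apply H3. apply dom_le with s; auto; lra.
Qed.

(** All terms but the constant one lose at least a factor [s / r]. *)
Lemma anorm_shrink d r s F M :
  0 < s <= r -> anorm d r F M -> anorm d s F (Rabs (F (fun _ => 0)) + s / r * M).
Proof.
  intros Hs. assert (Hq : 0 <= s / r <= 1).
  { split; [apply Rlt_le, Rdiv_lt_0_compat; lra|].
    apply Rmult_le_reg_r with r; [lra|]. field_simplify; lra. }
  revert F M. induction d as [|d IH]; intros F M.
  - intros (c & H & E). exists c. split; auto. rewrite E.
    assert (0 <= M) by (eapply Rle_trans; [apply Rabs_pos|eassumption]).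
    assert (0 <= s / r * M) by (apply Rmult_le_pos; lra). lra.
  - intros (Fn & Mn & H1 & H2 & H3).
    assert (HM0 : forall n, 0 <= Mn n) by (intros n; eapply anorm_nonneg; apply H1).
    assert (Hz : dom (S d) r (fun _ => 0)) by (apply dom_zero; lra).
    assert (E0 : F (fun _ => 0) = Fn 0%nat (fun _ => 0)).
    { pose proof (H3 _ Hz) as E. simpl in E.
      assert (E' : is_series (fun n => Fn n (fun _ => 0) * 0 ^ n)
                     (Fn 0%nat (fun _ => 0))).
      { apply is_series_delta with 0%nat; [|simpl; ring].
        intros [|n] Hn; [lia|]. simpl; ring. }
      now rewrite <- (is_series_unique _ _ E), (is_series_unique _ _ E'). }
    exists Fn, (fun n => match n with
                 | O => Rabs (Fn 0%nat (fun _ => 0)) + s / r * Mn 0%nat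
                 | _ => Mn n end).
    repeat split.
    + intros [|n]; [apply IH; auto|]. apply anorm_le with r; auto.
    + intros N. rewrite E0.
      apply Rle_trans with (Rabs (Fn 0%nat (fun _ => 0)) + s / r * sum_n (fun n => Mn n * r ^ n) N).
      2:{ apply Rplus_le_compat_l, Rmult_le_compat_l; [lra|]. auto. }
      induction N as [|N IHN].
      * rewrite !sum_n_O_R. simpl. lra.
      * rewrite !sum_n_S_R, Rmult_plus_distr_l.
        assert (s ^ S N <= s / r * r ^ S N).
        { simpl. replace (s / r * (r * r ^ N)) with (s * r ^ N) by (field; lra).
          apply Rmult_le_compat_l; [lra|]. apply pow_incr. lra. }
        assert (Mn (S N) * s ^ S N <= Mn (S N) * (s / r * r ^ S N))
          by (apply Rmult_le_compat_l; auto).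
        lra.
    + intros p Hp. apply H3. apply dom_le with s; auto; lra.
Qed.

(** * Partial derivatives *)

Definition upd (p : pt) (i : nat) (t : R) : pt := fun j => if Nat.eqb j i then t else p j.

Definition pd (i : nat) (F : pt -> R) : pt -> R :=
  fun p => Derive (fun t => F (upd p i t)) (p i).

Lemma upd_eq p i t : upd p i t i = t.
Proof. unfold upd. now rewrite Nat.eqb_refl. Qed.

Lemma upd_neq p i j t : j <> i -> upd p i t j = p j.
Proof. intros H. unfold upd. destruct (Nat.eqb_spec j i); congruence. Qed.

Lemma upd_id p i : upd p i (p i) = p.
Proof.
  apply functional_extensionality. intros j. unfold upd.
  destruct (Nat.eqb_spec j i); congruence.
Qed.

Lemma upd_upd p i t t' : upd (upd p i t) i t' = upd p i t'.
Proof.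
  apply functional_extensionality. intros j. unfold upd.
  destruct (Nat.eqb_spec j i); congruence.
Qed.

Lemma upd_comm p i j t t' : i <> j -> upd (upd p i t) j t' = upd (upd p j t') i t.
Proof.
  intros H. apply functional_extensionality. intros l. unfold upd.
  destruct (Nat.eqb_spec l i), (Nat.eqb_spec l j); congruence.
Qed.

Lemma dom_upd d r p i t : dom d r p -> Rabs t < r -> dom d r (upd p i t).
Proof.
  intros Hp Ht j Hj. unfold upd. destruct (Nat.eqb_spec j i); auto.
Qed.

Lemma locally_Rabs (x e : R) : 0 < e -> locally x (fun t => Rabs (t - x) < e).
Proof. intros He. exists (mkposreal e He). intros y Hy. exact Hy. Qed.

Lemma locally_Rabs_iff (x : R) (P : R -> Prop) :
  locally x P <-> exists e, 0 < e /\ forall t, Rabs (t - x) < e -> P t.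
Proof.
  split.
  - intros [e H]. exists e. split; [apply cond_pos|]. intros t Ht. apply H. exact Ht.
  - intros (e & He & H). exists (mkposreal e He). intros t Ht. apply H. exact Ht.
Qed.

Lemma dom_upd_locally d r p i :
  dom d r p -> (i < d)%nat -> locally (p i) (fun t => dom d r (upd p i t)).
Proof.
  intros Hp Hi. apply locally_Rabs_iff. exists (r - Rabs (p i)). split.
  - specialize (Hp i Hi). lra.
  - intros t Ht. apply dom_upd; auto.
    replace t with (p i + (t - p i)) by ring.
    eapply Rle_lt_trans; [apply Rabs_triang|]. lra.
Qed.

Lemma CV_radius_pos_of_series (a : nat -> R) (s : R) :
  0 < s -> (forall h, Rabs h < s -> ex_series (fun n => a n * h ^ n)) ->
  Rbar_lt 0 (CV_radius a).
Proof.
  intros Hs H.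
  assert (Hh : Rabs (s / 2) < s) by (rewrite Rabs_pos_eq; lra).
  destruct (Rbar_lt_le_dec (CV_radius a) (Rabs (s / 2))) as [C|C].
  - exfalso. apply (CV_disk_outside _ _ C). apply ex_series_lim_0. auto.
  - eapply Rbar_lt_le_trans; [|exact C]. simpl. rewrite Rabs_pos_eq; lra.
Qed.

Lemma is_series_PSeries (a : nat -> R) (h l : R) :
  is_series (fun n => a n * h ^ n) l -> PSeries a h = l.
Proof. intros H. unfold PSeries. apply is_series_unique, H. Qed.

Lemma is_derive_series_term1 (a : nat -> R) (s : R) (f : R -> R) (x : R) :
  0 < s ->
  (forall h, Rabs h < s -> is_series (fun n => a n * h ^ n) (f (x + h))) ->
  is_derive f x (a 1%nat).
Proof.
  intros Hs H.
  assert (HCV : Rbar_lt 0 (CV_radius a)).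
  { apply CV_radius_pos_of_series with s; auto. intros h Hh. eexists; eauto. }
  apply is_derive_ext_loc with (fun t => PSeries a (t - x)).
  - apply locally_Rabs_iff. exists s. split; auto. intros t Ht.
    rewrite (is_series_PSeries _ _ _ (H _ Ht)). f_equal. ring.
  - assert (E : is_derive (PSeries a) (x - x) (PSeries (PS_derive a) (x - x))).
    { apply is_derive_PSeries. now replace (x - x) with 0 by ring; rewrite Rabs_R0. }
    assert (E1 : is_derive (fun t : R => t - x) x 1) by (auto_derive; auto).
    pose proof (is_derive_comp (PSeries a) (fun t : R => t - x) x _ _ E E1) as E2.
    replace (a 1%nat) with (scal 1 (PSeries (PS_derive a) (x - x))); [exact E2|].
    replace (x - x) with 0 by ring. rewrite PSeries_0. unfold PS_derive, scal; simpl.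
    unfold mult; simpl. ring.
Qed.

(** Expanding [F (p + h e_i)] in powers of an additional variable [h] shows
    that [F] is differentiable and that its derivative, the coefficient of [h],
    is a power series of controlled norm. *)
Lemma anorm_pd d r F M i :
  0 < r -> (i < d)%nat -> anorm d r F M ->
  anorm d (r / 4) (pd i F) (4 / r * M) /\
  (forall p, dom d (r / 4) p -> is_derive (fun t => F (upd p i t)) (p i) (pd i F p)).
Proof.
  intros Hr Hi HF.
  assert (Hs : 0 < r / 4) by lra.
  pose proof (anorm_comp d r F M (S d) (r / 4)
    (fun j q => if Nat.eqb j i then q j + q d else q j) (r / 2) Hs) as HK.
  destruct HK as (Fn & Mn & H1 & H2 & H3); auto; [lra| |].
  { intros j Hj. destruct (Nat.eqb_spec j i).
    - replace (r / 2) with (r / 4 + r / 4) by field.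
      apply anorm_add; apply anorm_var; lra || lia.
    - apply anorm_mono with (r / 4); [apply anorm_var; lra || lia|lra]. }
  change (forall n, anorm d (r / 4) (Fn n) (Mn n)) in H1.
  assert (HD : forall p, dom d (r / 4) p ->
    is_derive (fun t => F (upd p i t)) (p i) (Fn 1%nat p)).
  { intros p Hp.
    apply is_derive_series_term1 with (a := fun n => Fn n p) (s := r / 4); auto.
    intros h Hh.
    assert (Hq : dom (S d) (r / 4) (upd p d h)).
    { intros j Hj. destruct (Nat.eq_dec j d) as [->|Hne].
      - now rewrite upd_eq.
      - rewrite upd_neq by auto. apply Hp. lia. }
    pose proof (H3 _ Hq) as E. rewrite upd_eq in E.
    assert (E2 : forall n, Fn n (upd p d h) = Fn n p).
    { intros n. symmetry. apply (anorm_local d (r / 4) _ _ _ _ (H1 n)); auto.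
      intros j Hj. rewrite upd_neq by lia. reflexivity. }
    apply is_series_ext_R with (u := fun n => Fn n (upd p d h) * h ^ n);
      [intros n; now rewrite E2|].
    match goal with |- is_series _ ?l => match type of E with is_series _ ?l' =>
      replace l with l'; [exact E|] end end.
    apply (anorm_local d r F M); auto.
    - intros j Hj. destruct (Nat.eqb_spec j i).
      + rewrite upd_neq by lia. subst. eapply Rle_lt_trans; [apply Rabs_triang|].
        specialize (Hp i Hi). lra.
      + rewrite upd_neq by lia. specialize (Hp j Hj). lra.
    - intros j Hj. destruct (Nat.eqb_spec j i).
      + subst. rewrite upd_neq by lia. now rewrite upd_eq.
      + rewrite !upd_neq by lia. reflexivity. }
  split.
  - destruct d as [|d]; [lia|].
    apply anorm_ext with (Fn 1%nat).
    + eapply anorm_mono; [apply H1|]. specialize (H2 1%nat).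
      rewrite sum_n_S_R, sum_n_O_R in H2.
      pose proof (anorm_nonneg _ _ _ _ (H1 0%nat)).
      simpl in H2. apply Rmult_le_reg_r with (r / 4); auto. field_simplify; lra.
    + intros p Hp. symmetry. apply is_derive_unique. now apply HD.
  - intros p Hp. replace (pd i F p) with (Fn 1%nat p); auto.
    symmetry. apply is_derive_unique. now apply HD.
Qed.

Lemma pd_feq i F G p : (forall q, F q = G q) -> pd i F p = pd i G p.
Proof. intros H. unfold pd. apply Derive_ext. auto. Qed.

Lemma is_series_tail (u : nat -> R) (l : R) K :
  is_series u l -> is_series (fun k => u (S K + k)%nat) (l - sum_n u K).
Proof.
  intros H. apply (is_series_incr_n u (S K) (l - sum_n u K)); [lia|].
  change (is_series u ((l - sum_n u K) + sum_n u K)).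
  now replace ((l - sum_n u K) + sum_n u K) with l by ring.
Qed.

(** A continuous linear operation commutes with normally convergent sums. *)
Lemma pd_series d r (F : nat -> pt -> R) (M : nat -> R) (G : pt -> R) M' i :
  0 < r -> (i < d)%nat -> (forall k, anorm d r (F k) (M k)) ->
  (forall K, sum_n M K <= M') ->
  (forall p, dom d r p -> is_series (fun k => F k p) (G p)) ->
  forall p, dom d (r / 4) p -> is_series (fun k => pd i (F k) p) (pd i G p).
Proof.
  intros Hr Hi HF HM HG p Hp.
  assert (HM0 : forall k, 0 <= M k) by (intros k; eapply anorm_nonneg; eauto).
  assert (HexM : ex_series M) by (eapply ex_series_bounded; eauto).
  assert (HGn : anorm d r G M') by (apply anorm_series with F M; auto; lia).
  assert (HR : forall K, anorm d r (fun q => G q - sum_n (fun k => F k q) K)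
    (Series M - sum_n M K)).
  { intros K. apply anorm_series with (F := fun k => F (S K + k)%nat)
      (M := fun k => M (S K + k)%nat); auto; [| |lia].
    - intros L.
      assert (E : is_series (fun k => M (S K + k)%nat) (Series M - sum_n M K)).
      { now apply is_series_tail, Series_correct. }
      rewrite <- (is_series_unique _ _ E). apply sum_n_le_Series; auto.
      eexists; exact E.
    - intros q Hq. apply (is_series_tail (fun k => F k q)). auto. }
  assert (HD : forall K, is_derive (fun t => sum_n (fun k => F k (upd p i t)) K) (p i)
    (sum_n (fun k => pd i (F k) p) K)).
  { induction K as [|K IH].
    - apply is_derive_ext with (fun t => F 0%nat (upd p i t));
        [intros t; symmetry; apply (sum_n_O_R (fun k => F k (upd p i t)))|].
      rewrite sum_n_O_R. apply (anorm_pd d r _ (M 0%nat)); auto.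
    - apply is_derive_ext with
        (fun t => sum_n (fun k => F k (upd p i t)) K + F (S K) (upd p i t));
        [intros t; symmetry; apply (sum_n_S_R (fun k => F k (upd p i t)))|].
      rewrite sum_n_S_R. apply (is_derive_plus _ _ _ _ _ IH).
      apply (anorm_pd d r _ (M (S K))); auto. }
  assert (HB : forall K, Rabs (pd i G p - sum_n (fun k => pd i (F k) p) K)
    <= 4 / r * (Series M - sum_n M K)).
  { intros K. destruct (anorm_pd d r _ _ i Hr Hi (HR K)) as [HRd _].
    pose proof (anorm_bound _ _ _ _ _ HRd Hp) as B.
    replace (pd i G p - sum_n (fun k => pd i (F k) p) K)
      with (pd i (fun q => G q - sum_n (fun k => F k q) K) p); auto.
    apply is_derive_unique. apply (is_derive_minus (fun t => G (upd p i t))).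
    - apply (anorm_pd d r G M'); auto.
    - apply HD. }
  apply is_series_is_lim_seq.
  apply is_lim_seq_ext with
    (fun K => pd i G p - (pd i G p - sum_n (fun k => pd i (F k) p) K));
    [intros; ring|].
  assert (L0 : is_lim_seq (fun K => 4 / r * (Series M - sum_n M K)) 0).
  { replace 0 with (4 / r * (Series M - Series M)) by ring.
    apply (is_lim_seq_scal_l _ (4 / r) (Series M - Series M)).
    apply is_lim_seq_minus'; [apply is_lim_seq_const|].
    apply is_series_is_lim_seq. now apply Series_correct. }
  assert (L1 : is_lim_seq (fun K => pd i G p - sum_n (fun k => pd i (F k) p) K) 0).
  { apply is_lim_seq_abs_0. apply is_lim_seq_le_le with
      (u := fun _ => 0) (w := fun K => 4 / r * (Series M - sum_n M K)); auto.
    - intros K. split; [apply Rabs_pos|auto].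
    - apply is_lim_seq_const. }
  pose proof (is_lim_seq_minus' _ _ (pd i G p) 0 (is_lim_seq_const _) L1) as E.
  rewrite Rminus_0_r in E. exact E.
Qed.

(** Without constant and linear terms, every term loses at least a factor
    [(s / r)^2].  This makes higher order perturbations contracting. *)
Lemma anorm_shrink2 d r s F M :
  0 < s <= r -> anorm d r F M -> F (fun _ => 0) = 0 ->
  (forall i, (i < d)%nat -> pd i F (fun _ => 0) = 0) ->
  anorm d s F ((s / r) ^ 2 * M).
Proof.
  intros Hs.
  assert (Hq : 0 <= s / r).
  { apply Rlt_le, Rdiv_lt_0_compat; lra. }
  revert F M. induction d as [|d IH]; intros F M HF F0 D0.
  - destruct HF as (c & H & E). exists 0. rewrite Rabs_R0. split.
    + apply Rmult_le_pos; [apply pow_le; auto|].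
      eapply Rle_trans; [apply Rabs_pos|eassumption].
    + intros p. rewrite E. now rewrite E in F0.
  - destruct HF as (Fn & Mn & H1 & H2 & H3).
    assert (HM0 : forall n, 0 <= Mn n) by (intros n; eapply anorm_nonneg; apply H1).
    assert (Hz : dom (S d) r (fun _ => 0)) by (apply dom_zero; lra).
    assert (E0 : forall p, dom (S d) r p -> p d = 0 -> F p = Fn 0%nat p).
    { intros p Hp Hpd. rewrite <- (is_series_unique _ _ (H3 p Hp)).
      apply is_series_unique. apply is_series_delta with 0%nat; [|simpl; ring].
      intros [|n] Hn; [lia|]. rewrite Hpd. simpl; ring. }
    assert (E1 : Fn 1%nat (fun _ => 0) = 0).
    { transitivity (pd d F (fun _ => 0)); [|apply D0; lia]. symmetry. apply is_derive_unique.
      apply is_derive_series_term1 with (a := fun n => Fn n (fun _ => 0)) (s := r); [lra|].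
      intros h Hh. rewrite Rplus_0_l.
      assert (Hp : dom (S d) r (upd (fun _ => 0) d h)) by (apply dom_upd; auto).
      eapply is_series_ext_R; [|apply (H3 _ Hp)].
      intros n. simpl. rewrite upd_eq. f_equal. symmetry.
      apply (anorm_local d r _ _ _ _ (H1 n)); [now apply dom_S|].
      intros j Hj. rewrite upd_neq by lia. reflexivity. }
    exists Fn, (fun n => match n with
                 | O => (s / r) ^ 2 * Mn 0%nat
                 | 1%nat => s / r * Mn 1%nat
                 | _ => Mn n end).
    repeat split.
    + intros [|[|n]].
      * apply IH; auto.
        -- rewrite <- E0; auto.
        -- intros i Hi. transitivity (pd i F (fun _ => 0)); [|apply D0; lia]. unfold pd. apply Derive_ext_loc.
           apply locally_Rabs_iff. exists r. split; [lra|]. intros t Ht.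
           rewrite Rminus_0_r in Ht. symmetry. apply E0.
           ++ now apply dom_upd.
           ++ rewrite upd_neq by lia. reflexivity.
      * pose proof (anorm_shrink d r s _ _ Hs (H1 1%nat)) as A.
        rewrite E1, Rabs_R0, Rplus_0_l in A. exact A.
      * apply anorm_le with r; auto.
    + assert (Hsr : s = s / r * r) by (field; lra).
      intros N. apply Rle_trans with ((s / r) ^ 2 * sum_n (fun n => Mn n * r ^ n) N).
      2:{ apply Rmult_le_compat_l; [apply pow_le|]; auto. }
      induction N as [|N IHN].
      * rewrite !sum_n_O_R. simpl. lra.
      * rewrite !sum_n_S_R, Rmult_plus_distr_l. apply Rplus_le_compat; auto.
        clear IHN. destruct N as [|N].
        -- right. replace (s ^ 1) with (s / r * r ^ 1) by (simpl; rewrite Hsr at 2; ring).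
           ring.
        -- replace ((s / r) ^ 2 * (Mn (S (S N)) * r ^ S (S N)))
             with (Mn (S (S N)) * (s ^ 2 * r ^ N)) by (simpl; field; lra).
           apply Rmult_le_compat_l; auto.
           replace (s ^ S (S N)) with (s ^ 2 * s ^ N) by (simpl; ring).
           apply Rmult_le_compat_l; [apply pow2_ge_0|]. apply pow_incr. lra.
    + intros p Hp. apply H3. apply dom_le with s; auto; lra.
Qed.

(** * The chain rule *)

Fixpoint psum (d : nat) (f : nat -> R) : R :=
  match d with O => 0 | S d => psum d f + f d end.

Lemma psum_ext d f g : (forall i, (i < d)%nat -> f i = g i) -> psum d f = psum d g.
Proof. induction d; simpl; intros H; auto. rewrite IHd, (H d) by auto. reflexivity. Qed.

Lemma psum_single d f i : (i < d)%nat -> (forall j, (j < d)%nat -> j <> i -> f j = 0) ->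
  psum d f = f i.
Proof.
  induction d as [|d IH]; intros Hi H; [lia|]. simpl.
  destruct (Nat.eq_dec i d) as [->|Hne].
  - assert (E : psum d f = psum d (fun _ => 0)).
    { apply psum_ext. intros j Hj. apply H; lia. }
    rewrite E. assert (E0 : psum d (fun _ => 0) = 0) by (clear; induction d; simpl; lra).
    rewrite E0. ring.
  - rewrite IH by (auto; lia). rewrite (H d) by lia. ring.
Qed.

Lemma is_derive_psum d (f : nat -> R -> R) x (l : nat -> R) :
  (forall i, (i < d)%nat -> is_derive (f i) x (l i)) ->
  is_derive (fun t => psum d (fun i => f i t)) x (psum d l).
Proof.
  induction d as [|d IH]; intros H; simpl.
  - apply @is_derive_const.
  - apply (is_derive_plus (fun t => psum d (fun i => f i t)) (f d)); auto.
Qed.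

Lemma is_derive_lipschitz (f : R -> R) x l :
  is_derive f x l ->
  locally x (fun t => Rabs (f t - f x) <= (Rabs l + 1) * Rabs (t - x)).
Proof.
  intros H. destruct H as [_ H]. specialize (H x (fun P HP => HP)).
  destruct (H (mkposreal 1 Rlt_0_1)) as [e He].
  exists e. intros t Ht. specialize (He t Ht).
  unfold norm, minus, plus, opp, scal in He; simpl in He. unfold abs, mult in He; simpl in He.
  replace (f t - f x) with ((f t + - f x + - ((t + - x) * l)) + (t - x) * l) by ring.
  eapply Rle_trans; [apply Rabs_triang|]. rewrite (Rabs_mult (t - x)).
  unfold Rminus. lra.
Qed.

Lemma is_derive_quadratic (g : R -> R) x C :
  g x = 0 -> locally x (fun t => Rabs (g t) <= C * Rabs (t - x) ^ 2) -> is_derive g x 0.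
Proof.
  intros g0 H. apply locally_Rabs_iff in H. destruct H as (e0 & He0 & H).
  assert (HC : 0 <= C).
  { specialize (H (x + e0 / 2)). replace (x + e0 / 2 - x) with (e0 / 2) in H by ring.
    rewrite (Rabs_pos_eq (e0 / 2)) in H by lra. specialize (H ltac:(lra)).
    pose proof (Rabs_pos (g (x + e0 / 2))).
    assert (0 < (e0 / 2) ^ 2) by (apply pow_lt; lra). nra. }
  split; [apply @is_linear_scal_l|].
  intros y Hy.
  apply (is_filter_lim_locally_unique (V := R_NormedModule)) in Hy. subst y.
  intros e. apply locally_Rabs_iff.
  exists (Rmin e0 (e / (C + 1))). split.
  - apply Rmin_pos; auto. apply Rdiv_lt_0_compat; [apply cond_pos|lra].
  - intros t Ht. unfold norm, minus, plus, opp, scal; simpl. unfold abs, mult; simpl.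
    rewrite g0. replace (g t + - 0 + - ((t + - x) * 0)) with (g t) by ring.
    apply Rle_trans with (C * Rabs (t - x) ^ 2).
    + apply H. eapply Rlt_le_trans; [exact Ht|apply Rmin_l].
    + assert (Rabs (t - x) <= e / (C + 1)).
      { apply Rlt_le. eapply Rlt_le_trans; [exact Ht|apply Rmin_r]. }
      unfold Rminus in *. pose proof (Rabs_pos (t + - x)). simpl. rewrite Rmult_1_r.
      rewrite <- Rmult_assoc. apply Rmult_le_compat_r; auto.
      assert (C * Rabs (t + - x) <= C * (e / (C + 1))) by (apply Rmult_le_compat_l; auto).
      assert (C * (e / (C + 1)) <= e).
      { pose proof (cond_pos e). apply Rmult_le_reg_r with (C + 1); [lra|].
        field_simplify; lra. }
      lra.
Qed.

Lemma anorm_psum d r n (F : nat -> pt -> R) M :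
  0 <= r -> (forall i, (i < n)%nat -> anorm d r (F i) M) ->
  anorm d r (fun p => psum n (fun i => F i p)) (INR n * M).
Proof.
  intros Hr. induction n as [|n IH]; intros H.
  - simpl. apply anorm_const0; lra.
  - eapply anorm_mono; [apply (anorm_add d r (fun p => psum n (fun i => F i p)) (F n)); auto|].
    rewrite S_INR. lra.
Qed.

(** The remainder of [F (q + h)] at order one in [h] is a power series in [h]
    with vanishing [1]-jet, hence is quadratic by [anorm_shrink2]. *)
Lemma anorm_taylor1 d r F M q :
  0 < r -> anorm d r F M -> dom d (r / 4) q ->
  forall s h, 0 < s <= r / 4 -> dom d s h ->
  Rabs (F (fun i => q i + h i) - F q - psum d (fun i => pd i F q * h i))
    <= (s / (r / 4)) ^ 2 * ((2 + INR d) * M).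
Proof.
  intros Hr HF Hq s h Hs Hh.
  pose proof (anorm_nonneg _ _ _ _ HF) as HM.
  set (N := fun h : pt => F (fun i => q i + h i) - F q - psum d (fun i => pd i F q * h i)).
  assert (Hq' : dom d r q) by (apply dom_le with (r / 4); auto; lra).
  assert (HN : anorm d (r / 4) N ((2 + INR d) * M)).
  { replace ((2 + INR d) * M) with ((M + M) + INR d * M) by ring.
    apply anorm_sub; [apply anorm_sub|].
    - apply anorm_comp with (r := r) (rho := r / 2) (G := fun i h => q i + h i) (d := d);
        auto; try lra.
      intros i Hi. apply anorm_mono with (Rabs (q i) + r / 4).
      + apply anorm_add; [apply anorm_const; lra|apply anorm_var; auto; lra].
      + specialize (Hq i Hi). lra.
    - eapply anorm_mono; [apply anorm_const; lra|]. eapply anorm_bound; eauto.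
    - apply anorm_psum; [lra|]. intros i Hi.
      destruct (anorm_pd d r F M i) as [HP _]; auto.
      pose proof (anorm_bound _ _ _ _ _ HP Hq) as B.
      eapply anorm_mono; [apply anorm_scal, anorm_var; auto; lra|].
      apply Rmult_le_reg_l with (4 / r); [apply Rdiv_lt_0_compat; lra|].
      replace (4 / r * (Rabs (pd i F q) * (r / 4))) with (Rabs (pd i F q)) by (field; lra).
      exact B. }
  assert (N0 : N (fun _ => 0) = 0).
  { unfold N. rewrite (psum_ext _ _ (fun _ => 0)) by (intros; ring).
    replace (psum d (fun _ => 0)) with 0 by (clear; induction d; simpl; lra).
    replace (fun i => q i + 0) with q by (apply functional_extensionality; intros; ring).
    ring. }
  assert (D0 : forall i, (i < d)%nat -> pd i N (fun _ => 0) = 0).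
  { intros i Hi. apply is_derive_unique. unfold N.
    assert (E1 : is_derive (fun t => F (fun j => q j + upd (fun _ => 0) i t j)) 0 (pd i F q)).
    { assert (E : is_derive (fun t => F (upd q i t)) (q i + 0) (pd i F q)).
      { rewrite Rplus_0_r. apply (anorm_pd d r F M); auto. }
      assert (E' : is_derive (fun t : R => q i + t) 0 1) by (auto_derive; auto).
      pose proof (is_derive_comp _ _ _ _ _ E E') as E2.
      eapply is_derive_ext; [|replace (pd i F q) with (scal 1 (pd i F q)) by
        (unfold scal; simpl; unfold mult; simpl; ring); exact E2].
      intros t. simpl. f_equal. apply functional_extensionality. intros j.
      unfold upd. destruct (Nat.eqb_spec j i); subst; simpl; ring. }
    assert (E2 : is_derive (fun t => psum d (fun j => pd j F q * upd (fun _ => 0) i t j)) 0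
                  (psum d (fun j => if Nat.eqb j i then pd i F q else 0))).
    { apply (is_derive_psum d (fun j t => pd j F q * upd (fun _ => 0) i t j)).
      intros j Hj. unfold upd. destruct (Nat.eqb_spec j i).
      - subst. auto_derive; auto. ring.
      - auto_derive; auto. }
    replace 0 with (pd i F q - 0 - psum d (fun j => if Nat.eqb j i then pd i F q else 0)) at 2.
    - apply (is_derive_minus (fun t => F (fun j => q j + upd (fun _ => 0) i t j) - F q)); auto.
      apply (is_derive_minus (fun t => F (fun j => q j + upd (fun _ => 0) i t j)) (fun _ => F q));
        auto. apply @is_derive_const.
    - rewrite (psum_single d _ i Hi).
      + rewrite Nat.eqb_refl. ring.
      + intros j _ Hne. destruct (Nat.eqb_spec j i); congruence. }
  pose proof (anorm_shrink2 d (r / 4) s N _ Hs HN N0 D0) as A.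
  exact (anorm_bound _ _ _ _ _ A Hh).
Qed.

(** Differentiability of an analytic function in all variables at once, which
    partial derivatives alone do not give, comes from [anorm_taylor1]. *)
Lemma anorm_chain d r F M (q : R -> pt) (q' : nat -> R) s0 :
  0 < r -> anorm d r F M ->
  (forall i, (i < d)%nat -> is_derive (fun s => q s i) s0 (q' i)) ->
  dom d (r / 4) (q s0) ->
  is_derive (fun s => F (q s)) s0 (psum d (fun i => pd i F (q s0) * q' i)).
Proof.
  intros Hr HF Hq Hd.
  set (D := fun s => psum d (fun i => pd i F (q s0) * (q s i - q s0 i))).
  set (N := fun s => F (q s) - F (q s0) - D s).
  assert (HD : is_derive D s0 (psum d (fun i => pd i F (q s0) * q' i))).
  { apply (is_derive_psum d (fun i s => pd i F (q s0) * (q s i - q s0 i))).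
    intros i Hi. specialize (Hq i Hi).
    assert (E : is_derive (fun s => q s i - q s0 i) s0 (q' i - 0)).
    { apply (is_derive_minus (fun s => q s i) (fun _ => q s0 i)); auto. apply @is_derive_const. }
    rewrite Rminus_0_r in E. apply (is_derive_scal _ _ (pd i F (q s0)) _ E). }
  assert (HL : exists L, 0 < L /\ locally s0 (fun s =>
    forall i, (i < d)%nat -> Rabs (q s i - q s0 i) <= L * Rabs (s - s0))).
  { clear - Hq. induction d as [|d IH].
    - exists 1. split; [lra|]. apply filter_forall. intros; lia.
    - destruct IH as (L & HL & H); auto.
      pose proof (is_derive_lipschitz _ _ _ (Hq d ltac:(lia))) as H'.
      exists (L + (Rabs (q' d) + 1)). pose proof (Rabs_pos (q' d)). split; [lra|].
      apply filter_imp with (2 := filter_and _ _ H H').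
      intros s [A B] i Hi. pose proof (Rabs_pos (s - s0)).
      destruct (Nat.eq_dec i d) as [->|Hne].
      + eapply Rle_trans; [exact B|]. apply Rmult_le_compat_r; auto. lra.
      + eapply Rle_trans; [apply A; lia|]. apply Rmult_le_compat_r; auto. lra. }
  destruct HL as (L & HL & HLq).
  set (K := (2 + INR d) * M).
  assert (HN : is_derive N s0 0).
  { apply is_derive_quadratic with (C := (2 * L / (r / 4)) ^ 2 * K).
    - unfold N, D. rewrite (psum_ext _ _ (fun _ => 0)) by (intros; ring).
      replace (psum d (fun _ => 0)) with 0 by (clear; induction d; simpl; lra). ring.
    - assert (He : 0 < r / 4 / (2 * L)) by (apply Rdiv_lt_0_compat; lra).
      pose proof (locally_Rabs s0 _ He) as Hloc.
      apply filter_imp with (2 := filter_and _ _ HLq Hloc).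
      intros s [A B]. destruct (Req_dec s s0) as [->|Hne].
      { unfold N, D. rewrite (psum_ext _ _ (fun _ => 0)) by (intros; ring).
        replace (psum d (fun _ => 0)) with 0 by (clear; induction d; simpl; lra).
        rewrite !Rminus_diag, Rabs_R0. simpl. lra. }
      assert (Hp : 0 < Rabs (s - s0)) by (apply Rabs_pos_lt; lra).
      assert (Hs : 0 < 2 * L * Rabs (s - s0) <= r / 4).
      { split; [apply Rmult_lt_0_compat; lra|].
        apply Rlt_le, Rmult_lt_reg_r with (/ (2 * L)); [apply Rinv_0_lt_compat; lra|].
        replace (2 * L * Rabs (s - s0) * / (2 * L)) with (Rabs (s - s0)) by (field; lra).
        exact B. }
      pose proof (anorm_taylor1 d r F M (q s0) Hr HF Hd _ (fun i => q s i - q s0 i) Hs) as T.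
      cbv beta in T.
      replace (fun i => q s0 i + (q s i - q s0 i)) with (q s) in T
        by (apply functional_extensionality; intros; ring).
      unfold N, D. eapply Rle_trans; [apply T|].
      + intros i Hi. specialize (A i Hi). nra.
      + right. unfold K. field. lra. }
  apply is_derive_ext with (fun s => N s + (F (q s0) + D s)); [intros t; unfold N; simpl; ring|].
  replace (psum d (fun i => pd i F (q s0) * q' i))
    with (0 + (0 + psum d (fun i => pd i F (q s0) * q' i))) by ring.
  apply (is_derive_plus N); auto.
  apply (is_derive_plus (fun _ => F (q s0)) D); auto. apply @is_derive_const.
Qed.

(** * Analytic germs *)

Definition near (d : nat) (P : pt -> Prop) : Prop :=
  exists r, 0 < r /\ forall p, dom d r p -> P p.

Definition An (d : nat) (F : pt -> R) : Prop :=
  exists r M, 0 < r /\ anorm d r F M.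

Notation "F ~=[ d ] G" := (near d (fun p => F p = G p)) (at level 70, no associativity).

Lemma near_imp d (P Q : pt -> Prop) : (forall p, P p -> Q p) -> near d P -> near d Q.
Proof. intros H (r & Hr & HP). exists r; auto. Qed.

Lemma near_and d P Q : near d P -> near d Q -> near d (fun p => P p /\ Q p).
Proof.
  intros (r & Hr & HP) (s & Hs & HQ). exists (Rmin r s). split; [now apply Rmin_pos|].
  intros p Hp. split; [apply HP|apply HQ]; eapply dom_le; eauto; [apply Rmin_l|apply Rmin_r].
Qed.

Lemma near_imp2 d (P Q T : pt -> Prop) :
  (forall p, P p -> Q p -> T p) -> near d P -> near d Q -> near d T.
Proof. intros H HP HQ. eapply near_imp; [|apply (near_and _ _ _ HP HQ)]. simpl. intuition. Qed.

Lemma near_all d (P : pt -> Prop) : (forall p, P p) -> near d P.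
Proof. intros H. exists 1. split; [lra|auto]. Qed.

Lemma near_forall d n (P : nat -> pt -> Prop) :
  (forall i, (i < n)%nat -> near d (P i)) -> near d (fun p => forall i, (i < n)%nat -> P i p).
Proof.
  induction n as [|n IH]; intros H.
  - apply near_all. intros; lia.
  - eapply near_imp2; [|apply IH; intros; apply H; lia|apply (H n); lia].
    simpl. intros p H1 H2 i Hi. destruct (Nat.eq_dec i n) as [->|]; auto. apply H1. lia.
Qed.

Lemma near_origin d P : near d P -> P (fun _ => 0).
Proof. intros (r & Hr & H). apply H. now apply dom_zero. Qed.

Lemma near_trans d (F G H : pt -> R) : F ~=[d] G -> G ~=[d] H -> F ~=[d] H.
Proof. apply near_imp2. intros p -> ->. reflexivity. Qed.

Lemma near_sym d (F G : pt -> R) : F ~=[d] G -> G ~=[d] F.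
Proof. apply near_imp. auto. Qed.

(** Makes derivatives available from identities that hold near the origin. *)
Lemma near_open d P : near d P ->
  near d (fun p => forall i, (i < d)%nat -> locally (p i) (fun t => P (upd p i t))).
Proof.
  intros (r & Hr & HP). exists r. split; auto. intros p Hp i Hi.
  eapply filter_imp; [|apply (dom_upd_locally d r p i Hp Hi)]. auto.
Qed.

Lemma An_ext d F G : An d F -> F ~=[d] G -> An d G.
Proof.
  intros (r & M & Hr & H) (s & Hs & E).
  assert (Hm : 0 < Rmin r s <= r) by (split; [now apply Rmin_pos|apply Rmin_l]).
  exists (Rmin r s), M. split; [lra|]. apply (anorm_le d r (Rmin r s)) in H; auto.
  destruct d as [|d].
  - destruct H as (c & Hc & E'). exists c. split; auto.
    intros p. rewrite <- (E' p). symmetry. apply E. intros i Hi; lia.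
  - apply anorm_ext with F; auto. intros p Hp. apply E. eapply dom_le; eauto. apply Rmin_r.
Qed.

Lemma An_const d c : An d (fun _ => c).
Proof. exists 1, (Rabs c). split; [lra|]. apply anorm_const; lra. Qed.

Lemma An_var d i : (i < d)%nat -> An d (fun p => p i).
Proof. exists 1, 1. split; [lra|]. apply anorm_var; auto; lra. Qed.

Lemma An_lift2 d F G (op : (pt -> R) -> (pt -> R) -> pt -> R) (bd : R -> R -> R) :
  (forall r M N, 0 < r -> anorm d r F M -> anorm d r G N -> anorm d r (op F G) (bd M N)) ->
  An d F -> An d G -> An d (op F G).
Proof.
  intros H (r & M & Hr & HF) (s & N & Hs & HG).
  assert (Hm : 0 < Rmin r s) by (now apply Rmin_pos).
  exists (Rmin r s), (bd M N). split; auto. apply H; auto.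
  - apply anorm_le with r; auto. split; auto. apply Rmin_l.
  - apply anorm_le with s; auto. split; auto. apply Rmin_r.
Qed.

Lemma An_plus d F G : An d F -> An d G -> An d (fun p => F p + G p).
Proof.
  apply (An_lift2 d F G (fun F G p => F p + G p) Rplus).
  intros; now apply anorm_add.
Qed.

Lemma An_minus d F G : An d F -> An d G -> An d (fun p => F p - G p).
Proof.
  apply (An_lift2 d F G (fun F G p => F p - G p) Rplus).
  intros; now apply anorm_sub.
Qed.

Lemma An_mul d F G : An d F -> An d G -> An d (fun p => F p * G p).
Proof.
  apply (An_lift2 d F G (fun F G p => F p * G p) Rmult).
  intros; apply anorm_mul; auto; lra.
Qed.

Lemma An_scal d c F : An d F -> An d (fun p => c * F p).
Proof. intros H. apply An_mul; auto. apply An_const. Qed.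

Lemma An_opp d F : An d F -> An d (fun p => - F p).
Proof.
  intros H. apply An_ext with (fun p => -1 * F p); [now apply An_scal|].
  apply near_all. intros; ring.
Qed.

Lemma An_pow d F n : An d F -> An d (fun p => F p ^ n).
Proof.
  intros H. induction n; simpl; [apply An_const|]. now apply An_mul.
Qed.

Lemma An_sum_n d n (F : nat -> pt -> R) :
  (forall i, (i <= n)%nat -> An d (F i)) -> An d (fun p => sum_n (fun i => F i p) n).
Proof.
  induction n; intros H.
  - eapply An_ext; [apply (H 0%nat); lia|]. apply near_all. intros. now rewrite sum_n_O_R.
  - eapply An_ext; [apply An_plus; [apply IHn; auto|apply (H (S n)); lia]|].
    apply near_all. intros. now rewrite sum_n_S_R.
Qed.

Lemma An_pd d i F : (i < d)%nat -> An d F -> An d (pd i F).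
Proof.
  intros Hi (r & M & Hr & H). exists (r / 4), (4 / r * M). split; [lra|].
  now apply anorm_pd.
Qed.

Lemma An_derive d i F : (i < d)%nat -> An d F ->
  near d (fun p => is_derive (fun t => F (upd p i t)) (p i) (pd i F p)).
Proof.
  intros Hi (r & M & Hr & H). exists (r / 4). split; [lra|].
  now apply (anorm_pd d r F M).
Qed.

Lemma An_local d F : An d F ->
  near d (fun p => forall q, (forall i, (i < d)%nat -> p i = q i) -> F p = F q).
Proof.
  intros (r & M & Hr & H). exists r. split; auto. intros p Hp q E.
  eapply anorm_local; eauto.
Qed.

Lemma pd_near d i F G : (i < d)%nat -> F ~=[d] G -> pd i F ~=[d] pd i G.
Proof.
  intros Hi H. eapply near_imp; [|apply (near_open _ _ H)].
  intros p Hp. apply Derive_ext_loc. now apply Hp.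
Qed.

Lemma An_family d n (F : nat -> pt -> R) :
  (forall i, (i < n)%nat -> An d (F i)) ->
  exists r M, 0 < r /\ forall i, (i < n)%nat -> anorm d r (F i) M.
Proof.
  induction n as [|n IH]; intros H.
  - exists 1, 0. split; [lra|]. intros; lia.
  - destruct IH as (r & M & Hr & IH); auto. destruct (H n) as (s & N & Hs & HN); auto.
    assert (Hm : 0 < Rmin r s) by now apply Rmin_pos.
    exists (Rmin r s), (Rmax M N). split; auto. intros i Hi.
    destruct (Nat.eq_dec i n) as [->|Hne].
    + apply anorm_mono with N; [|apply Rmax_r]. apply anorm_le with s; auto.
      split; auto. apply Rmin_r.
    + apply anorm_mono with M; [|apply Rmax_l]. apply anorm_le with r.
      * split; auto. apply Rmin_l.
      * apply IH. lia.
Qed.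

Lemma An_family_small d n (F : nat -> pt -> R) eps :
  0 < eps -> (forall i, (i < n)%nat -> An d (F i)) ->
  (forall i, (i < n)%nat -> F i (fun _ => 0) = 0) ->
  exists s, 0 < s /\ forall i, (i < n)%nat -> anorm d s (F i) eps.
Proof.
  intros He H H0. destruct (An_family d n F H) as (r & M & Hr & HM).
  set (M' := Rabs M + 1). assert (HM' : 0 < M') by (unfold M'; pose proof (Rabs_pos M); lra).
  exists (Rmin r (eps * r / M')).
  assert (Hs : 0 < Rmin r (eps * r / M')).
  { apply Rmin_pos; auto. apply Rdiv_lt_0_compat; auto. now apply Rmult_lt_0_compat. }
  split; auto. intros i Hi.
  assert (HMi : anorm d r (F i) M').
  { eapply anorm_mono; [apply HM; auto|]. unfold M'. pose proof (Rle_abs M). lra. }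
  eapply anorm_mono; [apply (anorm_shrink d r _ _ M'); [|exact HMi]|].
  - split; auto. apply Rmin_l.
  - rewrite H0, Rabs_R0 by auto.
    assert (Rmin r (eps * r / M') / r * M' <= eps * r / M' / r * M').
    { apply Rmult_le_compat_r; [lra|]. unfold Rdiv at 1 3.
      apply Rmult_le_compat_r; [apply Rlt_le, Rinv_0_lt_compat; auto|apply Rmin_r]. }
    replace (eps * r / M' / r * M') with eps in H1 by (field; lra). lra.
Qed.

Section Composition.
Context (d e : nat) (G : nat -> pt -> R).
Hypothesis HG : forall i, (i < d)%nat -> An e (G i).
Hypothesis G0 : forall i, (i < d)%nat -> G i (fun _ => 0) = 0.

Lemma An_comp F : An d F -> An e (fun p => F (fun i => G i p)).
Proof.
  intros (r & M & Hr & HF).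
  destruct (An_family_small e d G (r / 2)) as (s & Hs & Hsm); auto; [lra|].
  exists s, M. split; auto. apply anorm_comp with (d := d) (r := r) (rho := r / 2); auto. lra.
Qed.

Lemma near_comp P : near d P -> near e (fun p => P (fun i => G i p)).
Proof.
  intros (r & Hr & HP).
  destruct (An_family_small e d G (r / 2)) as (s & Hs & Hsm); auto; [lra|].
  exists s. split; auto. intros p Hp. apply HP. intros i Hi.
  eapply Rle_lt_trans; [eapply anorm_bound; eauto|lra].
Qed.

Lemma An_chain F j : An d F -> (j < e)%nat ->
  near e (fun p => pd j (fun p => F (fun i => G i p)) p
    = psum d (fun i => pd i F (fun i => G i p) * pd j (G i) p)).
Proof.
  intros (r & M & Hr & HF) Hj.
  assert (H1 : near e (fun p => forall i, (i < d)%nat ->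
    is_derive (fun t => G i (upd p j t)) (p j) (pd j (G i) p))).
  { apply near_forall. intros i Hi. apply An_derive; auto. }
  assert (H2 : near e (fun p => dom d (r / 4) (fun i => G i p))).
  { apply near_comp. exists (r / 4). split; [lra|auto]. }
  eapply near_imp2; [|exact H1|exact H2]. simpl. intros p A B.
  apply is_derive_unique.
  pose proof (anorm_chain d r F M (fun t i => G i (upd p j t)) (fun i => pd j (G i) p)
    (p j) Hr HF A) as C.
  cbv beta in C. rewrite upd_id in C. auto.
Qed.
End Composition.

Lemma near_pd_eq d i F (l : pt -> R) :
  near d (fun p => is_derive (fun t => F (upd p i t)) (p i) (l p)) -> pd i F ~=[d] l.
Proof. apply near_imp. intros p H. now apply is_derive_unique. Qed.

Lemma pd_const i c p : pd i (fun _ => c) p = 0.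
Proof. exact (Derive_const c (p i)). Qed.

Lemma pd_var_eq i p : pd i (fun p => p i) p = 1.
Proof.
  apply is_derive_unique. apply is_derive_ext with (fun t => t).
  - intros t. now rewrite upd_eq.
  - apply @is_derive_id.
Qed.

Lemma pd_var_neq i j p : j <> i -> pd i (fun p => p j) p = 0.
Proof.
  intros H. apply is_derive_unique. apply is_derive_ext with (fun t => p j).
  - intros t. now rewrite upd_neq.
  - apply @is_derive_const.
Qed.

Section Rules.
Context (d i : nat) (Hi : (i < d)%nat).

Lemma pd_plus F G : An d F -> An d G ->
  pd i (fun p => F p + G p) ~=[d] (fun p => pd i F p + pd i G p).
Proof.
  intros HF HG. apply near_pd_eq.
  eapply near_imp2; [|apply (An_derive d i F Hi HF)|apply (An_derive d i G Hi HG)].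
  intros p A B. apply (is_derive_plus (fun t => F (upd p i t))); auto.
Qed.

Lemma pd_minus F G : An d F -> An d G ->
  pd i (fun p => F p - G p) ~=[d] (fun p => pd i F p - pd i G p).
Proof.
  intros HF HG. apply near_pd_eq.
  eapply near_imp2; [|apply (An_derive d i F Hi HF)|apply (An_derive d i G Hi HG)].
  intros p A B. apply (is_derive_minus (fun t => F (upd p i t))); auto.
Qed.

Lemma pd_mul F G : An d F -> An d G ->
  pd i (fun p => F p * G p) ~=[d] (fun p => pd i F p * G p + F p * pd i G p).
Proof.
  intros HF HG. apply near_pd_eq.
  eapply near_imp2; [|apply (An_derive d i F Hi HF)|apply (An_derive d i G Hi HG)].
  intros p A B.
  pose proof (is_derive_mult (fun t => F (upd p i t)) (fun t => G (upd p i t)) (p i) _ _ A B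
    Rmult_comm) as C.
  simpl in C. rewrite upd_id in C. exact C.
Qed.

Lemma pd_scal c F : An d F -> pd i (fun p => c * F p) ~=[d] (fun p => c * pd i F p).
Proof.
  intros HF. eapply near_imp; [|apply (pd_mul (fun _ => c) F); auto; apply An_const].
  simpl. intros p ->. rewrite pd_const. ring.
Qed.

Lemma pd_pow n F : An d F ->
  pd i (fun p => F p ^ n) ~=[d] (fun p => INR n * F p ^ (pred n) * pd i F p).
Proof.
  intros HF. apply near_pd_eq. eapply near_imp; [|apply (An_derive d i F Hi HF)].
  intros p A. pose proof (is_derive_pow (fun t => F (upd p i t)) n (p i) _ A) as B.
  simpl in B. rewrite upd_id in B.
  replace (INR n * F p ^ pred n * pd i F p) with (INR n * pd i F p * F p ^ pred n) by ring.
  exact B.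
Qed.
End Rules.

Lemma pd_sum_n d i n (F : nat -> pt -> R) : (i < d)%nat ->
  (forall k, (k <= n)%nat -> An d (F k)) ->
  pd i (fun p => sum_n (fun k => F k p) n) ~=[d] (fun p => sum_n (fun k => pd i (F k) p) n).
Proof.
  intros Hi. induction n as [|n IH]; intros H.
  - apply near_all. intros p. rewrite sum_n_O_R. apply pd_feq. intros q. now rewrite sum_n_O_R.
  - apply near_trans with (pd i (fun p => sum_n (fun k => F k p) n + F (S n) p)).
    + apply near_all. intros p. apply pd_feq. intros q. now rewrite sum_n_S_R.
    + eapply near_imp2;
        [|apply (pd_plus d i Hi (fun p => sum_n (fun k => F k p) n) (F (S n)));
          [apply (An_sum_n d n F)|]; auto
        |apply IH; auto].
      simpl. intros p -> ->. now rewrite sum_n_S_R.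
Qed.

Lemma psum_bound n (f h : nat -> R) e : (forall l, (l < n)%nat -> Rabs (h l) <= e) ->
  Rabs (psum n (fun l => f l * h l)) <= psum n (fun l => Rabs (f l)) * e.
Proof.
  induction n as [|n IH]; intros H; cbn [psum]; [rewrite Rabs_R0; lra|].
  eapply Rle_trans; [apply Rabs_triang|]. rewrite Rmult_plus_distr_r, Rabs_mult.
  apply Rplus_le_compat; [apply IH; auto|].
  apply Rmult_le_compat_l; [apply Rabs_pos|auto].
Qed.

(** Joint continuity follows from the bound on the remainder at order one. *)
Lemma An_continuity_2d d i j K : (i < d)%nat -> (j < d)%nat -> i <> j -> An d K ->
  near d (fun p => continuity_2d_pt (fun u v => K (upd (upd p i u) j v)) (p i) (p j)).
Proof.
  intros Hi Hj Hij (s & M & Hs & HK). exists (s / 4). split; [lra|]. intros p Hp eps.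
  pose proof (anorm_nonneg _ _ _ _ HK) as HM.
  set (L := psum d (fun l => Rabs (pd l K p))).
  set (N := (2 + INR d) * M).
  set (C := L + N / (s / 4)).
  assert (HL : 0 <= L).
  { unfold L. clear. induction d as [|d IH]; simpl; [lra|].
    pose proof (Rabs_pos (pd d K p)). lra. }
  assert (HN : 0 <= N) by (apply Rmult_le_pos; auto; pose proof (pos_INR d); lra).
  assert (HC : 0 <= C).
  { apply Rplus_le_le_0_compat; auto. apply Rdiv_le_0_compat; lra. }
  assert (Hdel : 0 < Rmin (s / 4) (eps / (C + 1)) / 2).
  { apply Rdiv_lt_0_compat; [|lra]. apply Rmin_pos; [lra|].
    apply Rdiv_lt_0_compat; [apply cond_pos|lra]. }
  exists (mkposreal _ Hdel). simpl. intros u v Hu Hv.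
  set (del := Rmin (s / 4) (eps / (C + 1)) / 2) in *.
  assert (D1 : 2 * del <= s / 4) by (unfold del; pose proof (Rmin_l (s / 4) (eps / (C + 1))); lra).
  assert (D2 : 2 * del <= eps / (C + 1))
    by (unfold del; pose proof (Rmin_r (s / 4) (eps / (C + 1))); lra).
  set (h := fun l : nat => if Nat.eqb l i then u - p i else if Nat.eqb l j then v - p j else 0).
  assert (Hh : dom d (2 * del) h).
  { intros l Hl. unfold h. destruct (Nat.eqb l i); [lra|]. destruct (Nat.eqb l j); [lra|].
    rewrite Rabs_R0. lra. }
  pose proof (anorm_taylor1 d s K M p Hs HK Hp (2 * del) h ltac:(lra) Hh) as T. fold N in T.
  replace (fun l => p l + h l) with (upd (upd p i u) j v) in T.
  2:{ apply functional_extensionality. intros l. unfold h, upd.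
      destruct (Nat.eqb_spec l i), (Nat.eqb_spec l j); subst; try ring; lia. }
  rewrite upd_id. replace (upd p i (p i)) with p by (symmetry; apply upd_id).
  rewrite upd_id.
  assert (S1 : Rabs (psum d (fun l => pd l K p * h l)) <= L * (2 * del)).
  { apply psum_bound. intros l Hl. apply Rlt_le, Hh, Hl. }
  assert (S2 : (2 * del / (s / 4)) ^ 2 * N <= N / (s / 4) * (2 * del)).
  { replace ((2 * del / (s / 4)) ^ 2 * N)
      with (N / (s / 4) * (2 * del) * (2 * del / (s / 4))) by (field; lra).
    rewrite <- (Rmult_1_r (N / (s / 4) * (2 * del))) at 2.
    apply Rmult_le_compat_l.
    - apply Rmult_le_pos; [|lra]. apply Rdiv_le_0_compat; lra.
    - apply Rmult_le_reg_r with (s / 4); [lra|]. field_simplify; lra. }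
  apply Rle_lt_trans with (C * (2 * del)).
  - replace (K (upd (upd p i u) j v) - K p) with
      ((K (upd (upd p i u) j v) - K p - psum d (fun l => pd l K p * h l))
        + psum d (fun l => pd l K p * h l)) by ring.
    eapply Rle_trans; [apply Rabs_triang|]. unfold C. rewrite Rmult_plus_distr_r. lra.
  - apply Rle_lt_trans with (C * (eps / (C + 1))).
    + apply Rmult_le_compat_l; auto.
    + pose proof (cond_pos eps). apply Rmult_lt_reg_r with (C + 1); [lra|].
      replace (C * (eps / (C + 1)) * (C + 1)) with (C * eps) by (field; lra). nra.
Qed.

Lemma An_Schwarz d i j F : (i < d)%nat -> (j < d)%nat -> An d F ->
  pd i (pd j F) ~=[d] pd j (pd i F).
Proof.
  intros Hi Hj HF. destruct (Nat.eq_dec i j) as [->|Hij]; [now apply near_all|].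
  pose proof (An_pd d i F Hi HF) as HFi. pose proof (An_pd d j F Hj HF) as HFj.
  pose proof (An_pd d i _ Hi HFj) as HFij. pose proof (An_pd d j _ Hj HFi) as HFji.
  pose proof (near_and _ _ _ (near_and _ _ _ (An_derive d i F Hi HF) (An_derive d j F Hj HF))
    (near_and _ _ _ (An_derive d i _ Hi HFj) (An_derive d j _ Hj HFi))) as (r & Hr & HD).
  assert (HC : forall K, An d K -> near d (fun p =>
    continuity_2d_pt (fun u v => K (upd (upd p i u) j v)) (p i) (p j)))
    by (intros; now apply An_continuity_2d).
  pose proof (near_and _ _ _ (HC _ HFij) (HC _ HFji)) as (r' & Hr' & HC').
  exists (Rmin r r'). split; [now apply Rmin_pos|]. intros p Hp.
  assert (Hpr : dom d r p) by (eapply dom_le; eauto; apply Rmin_l).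
  assert (Hpr' : dom d r' p) by (apply (dom_le d r' (Rmin r r')); [apply Rmin_r|exact Hp]).
  set (f := fun u v => F (upd (upd p i u) j v)).
  assert (E1 : forall u v, Derive (fun z => f z v) u = pd i F (upd (upd p i u) j v)).
  { intros u v. unfold pd, f. rewrite upd_neq, upd_eq by auto. apply Derive_ext. intros t.
    f_equal. rewrite (upd_comm (upd p i u) j i) by auto. now rewrite upd_upd. }
  assert (E2 : forall u v, Derive (fun z => f u z) v = pd j F (upd (upd p i u) j v)).
  { intros u v. unfold pd, f. rewrite upd_eq. apply Derive_ext. intros t.
    now rewrite upd_upd. }
  assert (E12 : forall u v, Derive (fun z => pd j F (upd (upd p i z) j v)) u
    = pd i (pd j F) (upd (upd p i u) j v)).
  { intros u v. unfold pd at 2. rewrite upd_neq, upd_eq by auto. apply Derive_ext. intros t.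
    f_equal. rewrite (upd_comm (upd p i u) j i) by auto. now rewrite upd_upd. }
  assert (E21 : forall u v, Derive (fun z => pd i F (upd (upd p i u) j z)) v
    = pd j (pd i F) (upd (upd p i u) j v)).
  { intros u v. unfold pd at 2. rewrite upd_eq. apply Derive_ext. intros t.
    now rewrite upd_upd. }
  assert (Ep : upd (upd p i (p i)) j (p j) = p) by (rewrite upd_id; now apply upd_id).
  destruct (HC' p Hpr') as [C1 C2].
  assert (SW := Schwarz f (p i) (p j)).
  rewrite <- Ep, <- E12, <- E21.
  transitivity (Derive (fun z => Derive (fun t => f z t) (p j)) (p i)).
  { apply Derive_ext. intros t. now rewrite E2. }
  rewrite SW.
  - apply Derive_ext. intros t. now rewrite E1.
  - assert (Hdel : 0 < Rmin (r - Rabs (p i)) (r - Rabs (p j))).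
    { apply Rmin_pos; [specialize (Hpr i Hi)|specialize (Hpr j Hj)]; lra. }
    exists (mkposreal _ Hdel). simpl. intros u v Hu Hv.
    assert (Hq : dom d r (upd (upd p i u) j v)).
    { apply dom_upd; [apply dom_upd; auto|].
      - pose proof (Rmin_l (r - Rabs (p i)) (r - Rabs (p j))).
        replace u with (p i + (u - p i)) by ring.
        eapply Rle_lt_trans; [apply Rabs_triang|]. lra.
      - pose proof (Rmin_r (r - Rabs (p i)) (r - Rabs (p j))).
        replace v with (p j + (v - p j)) by ring.
        eapply Rle_lt_trans; [apply Rabs_triang|]. lra. }
    destruct (HD _ Hq) as [[D1 D2] [D3 D4]].
    rewrite upd_eq in D2, D4. rewrite upd_neq, upd_eq in D1, D3 by auto.
    repeat split.
    + eexists. eapply is_derive_ext; [|exact D1]. intros t. unfold f. simpl.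
      rewrite (upd_comm (upd p i u) j i) by auto. now rewrite upd_upd.
    + eexists. eapply is_derive_ext; [|exact D2]. intros t. unfold f. simpl.
      now rewrite upd_upd.
    + eexists. eapply is_derive_ext; [|exact D3]. intros t. simpl. rewrite E2.
      rewrite (upd_comm (upd p i u) j i) by auto. now rewrite upd_upd.
    + eexists. eapply is_derive_ext; [|exact D4]. intros t. simpl. rewrite E1.
      now rewrite upd_upd.
  - eapply continuity_2d_pt_ext; [|exact C1]. intros u v. simpl. rewrite <- E12.
    apply Derive_ext. intros t. now rewrite E2.
  - eapply continuity_2d_pt_ext; [|exact C2]. intros u v. simpl. rewrite <- E21.
    apply Derive_ext. intros t. now rewrite E1.
Qed.

(** * Contractions: implicit functions and flows *)

Lemma anorm_pow_diff d r G G' rho delta n :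
  0 <= r -> anorm d r G rho -> anorm d r G' rho ->
  anorm d r (fun p => G p - G' p) delta ->
  anorm d r (fun p => G p ^ n - G' p ^ n) (INR n * rho ^ (pred n) * delta).
Proof.
  intros Hr HG HG' HD.
  assert (Hrho : 0 <= rho) by (eapply anorm_nonneg; eauto).
  assert (Hdel : 0 <= delta) by (eapply anorm_nonneg; eauto).
  induction n as [|n IH].
  - eapply anorm_feq; [apply anorm_const0; simpl; lra|]. intros; simpl; ring.
  - eapply anorm_mono.
    + eapply anorm_feq.
      * apply anorm_add.
        -- apply anorm_mul; [exact Hr|exact HG|exact IH].
        -- apply anorm_mul; [exact Hr|exact HD|apply (anorm_pow d r G' rho n); auto].
      * intros p; simpl; ring.
    + right. rewrite S_INR. simpl pred. destruct n; simpl; ring.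
Qed.

Lemma INR_le_pow2 n : INR n <= 2 ^ pred n.
Proof.
  destruct n as [|n]; [simpl; lra|]. simpl pred.
  induction n as [|n IH]; [simpl; lra|].
  rewrite S_INR. simpl. simpl in IH.
  assert (1 <= 2 ^ n) by (apply pow_R1_Rle; lra). lra.
Qed.

(** The factor [n] lost when taking differences of [n]-th powers is at most
    [2^(n-1)]; halving the radius compensates for it. *)
Lemma anorm_comp_lipschitz d r F M e s G G' delta :
  0 < r -> 0 < s -> anorm d r F M ->
  (forall i, (i < d)%nat -> anorm e s (G i) (r / 2)) ->
  (forall i, (i < d)%nat -> anorm e s (G' i) (r / 2)) ->
  (forall i, (i < d)%nat -> anorm e s (fun p => G i p - G' i p) delta) -> 0 <= delta ->
  anorm e s (fun p => F (fun i => G i p) - F (fun i => G' i p)) (INR d / r * M * delta).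
Proof.
  intros Hr Hs. revert F M. induction d as [|d IH]; intros F M HF HG HG' HD Hdel.
  - destruct HF as (c & H & E). eapply anorm_feq.
    + apply anorm_const0; [lra|]. simpl. unfold Rdiv. rewrite !Rmult_0_l. lra.
    + intros p. simpl. rewrite !E. ring.
  - pose proof HF as HF'. destruct HF as (Fn & Mn & H1 & H2 & H3).
    change (forall n, anorm d r (Fn n) (Mn n)) in H1.
    assert (HM0 : forall n, 0 <= Mn n) by (intros n; eapply anorm_nonneg; apply H1).
    assert (Hdom : forall K : nat -> pt -> R,
      (forall i, (i < S d)%nat -> anorm e s (K i) (r / 2)) ->
      forall p, dom e s p -> dom (S d) r (fun i => K i p)).
    { intros K HK p Hp i Hi. eapply Rle_lt_trans; [eapply anorm_bound; eauto|lra]. }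
    apply anorm_series with
      (F := fun n p => (Fn n (fun i => G i p) - Fn n (fun i => G' i p)) * G d p ^ n
                       + Fn n (fun i => G' i p) * (G d p ^ n - G' d p ^ n))
      (M := fun n => INR (S d) / r * delta * (Mn n * r ^ n)); auto.
    + intros n. eapply anorm_mono.
      * apply anorm_add.
        -- apply anorm_mul; [lra|apply IH; auto|apply anorm_pow; [lra|apply HG; lia]].
        -- apply anorm_mul; [lra| |].
           ++ apply anorm_comp with (d := d) (r := r) (rho := r / 2); auto. lra.
           ++ apply anorm_pow_diff; [lra|apply HG; lia|apply HG'; lia|apply HD; lia].
      * rewrite S_INR.
        assert (Hr2 : (r / 2) ^ n <= r ^ n) by (apply pow_incr; lra).
        assert (Hn : INR n * (r / 2) ^ pred n <= / r * r ^ n).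
        { destruct n as [|n]; [simpl; rewrite Rmult_0_l, Rmult_1_r; apply Rlt_le, Rinv_0_lt_compat; lra|].
          pose proof (INR_le_pow2 (S n)) as B. simpl pred in *.
          replace (/ r * r ^ S n) with (2 ^ n * (r / 2) ^ n).
          - apply Rmult_le_compat_r; auto. apply pow_le; lra.
          - rewrite <- Rpow_mult_distr. simpl. replace (2 * (r / 2)) with r by field. field. lra. }
        assert (0 <= INR d / r) by (apply Rmult_le_pos; [apply pos_INR|apply Rlt_le, Rinv_0_lt_compat; lra]).
        assert (A1 : INR d / r * Mn n * delta * (r / 2) ^ n <= INR d / r * Mn n * delta * r ^ n).
        { apply Rmult_le_compat_l; [|exact Hr2]. apply Rmult_le_pos; auto. apply Rmult_le_pos; auto. }
        assert (A2 : Mn n * (INR n * (r / 2) ^ pred n * delta) <= Mn n * (/ r * r ^ n * delta)).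
        { apply Rmult_le_compat_l; auto. apply Rmult_le_compat_r; auto. }
        replace ((INR d + 1) / r * delta * (Mn n * r ^ n)) with
          (INR d / r * Mn n * delta * r ^ n + Mn n * (/ r * r ^ n * delta)) by (field; lra).
        lra.
    + intros K. rewrite sum_n_scal_R.
      replace (INR (S d) / r * M * delta) with (INR (S d) / r * delta * M) by ring.
      apply Rmult_le_compat_l; auto.
      apply Rmult_le_pos; auto. apply Rmult_le_pos; [apply pos_INR|apply Rlt_le, Rinv_0_lt_compat; lra].
    + intros p Hp.
      pose proof (H3 _ (Hdom G HG p Hp)) as A. pose proof (H3 _ (Hdom G' HG' p Hp)) as B.
      eapply is_series_ext_R; [|apply (is_series_minus_R _ _ _ _ A B)].
      intros n. simpl. ring.
    + intros -> p.
      assert (Hd : forall q, dom 0 s q) by (intros q i Hi; lia).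
      f_equal.
      * apply (anorm_local (S d) r F M); auto.
        intros i Hi. destruct (HG i Hi) as (c & _ & E). now rewrite !E.
      * apply (anorm_local (S d) r F M); auto.
        intros i Hi. destruct (HG' i Hi) as (c & _ & E). now rewrite !E.
Qed.

(** Banach's fixed point theorem for finite families of power series.  Halving
    the radius of the ball in the first hypothesis leaves room for the
    geometric series of the successive differences. *)
Lemma anorm_fixed_point m e s rho (T : (nat -> pt -> R) -> nat -> pt -> R) :
  0 < s ->
  (forall G, (forall i, (i < m)%nat -> anorm (S e) s (G i) rho) ->
     forall i, (i < m)%nat -> anorm (S e) s (T G i) (rho / 2)) ->
  (forall G G' delta, 0 <= delta ->
     (forall i, (i < m)%nat -> anorm (S e) s (G i) rho) ->
     (forall i, (i < m)%nat -> anorm (S e) s (G' i) rho) ->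
     (forall i, (i < m)%nat -> anorm (S e) s (fun p => G i p - G' i p) delta) ->
     forall i, (i < m)%nat -> anorm (S e) s (fun p => T G i p - T G' i p) (delta / 2)) ->
  (forall G, (forall i, (i < m)%nat -> G i (fun _ => 0) = 0) ->
     forall i, (i < m)%nat -> T G i (fun _ => 0) = 0) ->
  0 <= rho ->
  exists G, (forall i, (i < m)%nat -> anorm (S e) s (G i) rho) /\
    (forall i, (i < m)%nat -> G i (fun _ => 0) = 0) /\
    (forall i p, (i < m)%nat -> dom (S e) s p -> T G i p = G i p).
Proof.
  intros Hs HT HL H0 Hrho.
  set (g := fix g n := match n with O => fun _ _ => 0 | S n => T (g n) end).
  assert (Hball : forall n i, (i < m)%nat -> anorm (S e) s (g n i) rho).
  { induction n as [|n IH]; intros i Hi; simpl.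
    - apply (anorm_const0 (S e)); lra.
    - apply (anorm_mono (S e) s (T (g n) i) (rho / 2)); [|lra]. apply HT; auto. }
  assert (Hzero : forall n i, (i < m)%nat -> g n i (fun _ => 0) = 0).
  { induction n as [|n IH]; intros i Hi; simpl; auto. }
  assert (Hdiff : forall n i, (i < m)%nat ->
    anorm (S e) s (fun p => g (S n) i p - g n i p) (rho / 2 * (1 / 2) ^ n)).
  { induction n as [|n IH]; intros i Hi.
    - rewrite pow_O, Rmult_1_r.
      apply anorm_feq with (g 1%nat i); [|intros; simpl; ring].
      apply HT; auto. intros j Hj. apply (anorm_const0 (S e)); lra.
    - replace (rho / 2 * (1 / 2) ^ S n) with (rho / 2 * (1 / 2) ^ n / 2) by (simpl; field).
      apply (HL (g (S n)) (g n)); auto.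
      apply Rmult_le_pos; [lra|]. apply pow_le; lra. }
  assert (Hgeom : forall N, sum_n (fun n => rho / 2 * (1 / 2) ^ n) N = rho - rho * (1 / 2) ^ S N :> R).
  { induction N as [|N IH].
    - rewrite sum_n_O_R. simpl. field.
    - rewrite sum_n_S_R, IH. simpl. field. }
  assert (Htel : forall i p N, sum_n (fun n => g (S n) i p - g n i p) N = g (S N) i p :> R).
  { intros i p. induction N as [|N IH].
    - rewrite sum_n_O_R. simpl. ring.
    - rewrite sum_n_S_R, IH. ring. }
  set (G := fun i p => Series (fun n => g (S n) i p - g n i p)).
  assert (Hp2 : forall N, 0 <= (1 / 2) ^ N) by (intros; apply pow_le; lra).
  assert (Hex : forall i p, (i < m)%nat -> dom (S e) s p ->
    is_series (fun n => g (S n) i p - g n i p) (G i p)).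
  { intros i p Hi Hp. apply Series_correct.
    apply dominated_ex with (v := fun n => rho / 2 * (1 / 2) ^ n) (M := rho).
    - intros n. apply (anorm_bound (S e) s (fun p => g (S n) i p - g n i p)); auto.
    - intros N. rewrite Hgeom. specialize (Hp2 (S N)).
      assert (0 <= rho * (1 / 2) ^ S N) by now apply Rmult_le_pos. lra. }
  assert (HG : forall i, (i < m)%nat -> anorm (S e) s (G i) rho).
  { intros i Hi. apply anorm_series with (F := fun n p => g (S n) i p - g n i p)
      (M := fun n => rho / 2 * (1 / 2) ^ n); auto.
    - intros N. rewrite Hgeom. specialize (Hp2 (S N)).
      assert (0 <= rho * (1 / 2) ^ S N) by now apply Rmult_le_pos. lra.
    - intros; lia. }
  assert (HGn : forall N i, (i < m)%nat ->
    anorm (S e) s (fun p => G i p - g (S N) i p) (rho * (1 / 2) ^ S N)).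
  { intros N i Hi. apply anorm_series with
      (F := fun n p => g (S (S N + n)) i p - g (S N + n)%nat i p)
      (M := fun n => rho / 2 * (1 / 2) ^ (S N + n)); auto.
    - intros K.
      assert (E : sum_n (fun n => rho / 2 * (1 / 2) ^ (S N + n)) K
        = rho * (1 / 2) ^ S N - rho * (1 / 2) ^ S N * (1 / 2) ^ S K :> R).
      { induction K as [|K IH].
        - rewrite sum_n_O_R, Nat.add_0_r. simpl. field.
        - rewrite sum_n_S_R, IH, pow_add. simpl. field. }
      rewrite E. assert (0 <= rho * (1 / 2) ^ S N * (1 / 2) ^ S K)
        by (apply Rmult_le_pos; [apply Rmult_le_pos|]; auto). lra.
    - intros p Hp. rewrite <- (Htel i p N).
      apply (is_series_tail (fun n => g (S n) i p - g n i p)). auto.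
    - intros; lia. }
  exists G. split; [exact HG|]. split.
  - intros i Hi. unfold G. rewrite (Series_ext _ (fun _ => 0)).
    + apply is_series_unique. apply is_series_delta with 0%nat; auto.
    + intros n. rewrite !Hzero by auto. ring.
  - intros i p Hi Hp.
    assert (B : forall N, Rabs (T G i p - G i p) <= 2 * rho * (1 / 2) ^ S N).
    { intros N.
      assert (B1 := HL G (g (S N)) (rho * (1 / 2) ^ S N)
        ltac:(apply Rmult_le_pos; auto) HG (Hball (S N)) (HGn N) i Hi).
      assert (B2 := HGn (S N) i Hi).
      apply (fun H => anorm_bound _ _ _ _ _ H Hp) in B1, B2. cbn [pow] in B1, B2.
      change (T (g (S N)) i p) with (g (S (S N)) i p) in B1.
      replace (T G i p - G i p) with ((T G i p - g (S (S N)) i p) - (G i p - g (S (S N)) i p)) by ring.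
      unfold Rminus at 1. eapply Rle_trans; [apply Rabs_triang|]. rewrite Rabs_Ropp.
      cbn [pow]. specialize (Hp2 N).
      assert (0 <= rho * (1 / 2) ^ N) by now apply Rmult_le_pos. lra. }
    assert (L : is_lim_seq (fun N => 2 * rho * (1 / 2) ^ S N) 0).
    { replace (Finite 0) with (Rbar_mult (2 * rho) 0) by (simpl; f_equal; ring).
      apply is_lim_seq_scal_l. apply -> is_lim_seq_incr_1.
      apply is_lim_seq_geom. rewrite Rabs_pos_eq; lra. }
    assert (B0 : Rbar_le (Rabs (T G i p - G i p)) 0).
    { eapply is_lim_seq_le; [exact B|apply is_lim_seq_const|exact L]. }
    simpl in B0. pose proof (Rabs_pos (T G i p - G i p)).
    assert (Z : Rabs (T G i p - G i p) = 0) by lra.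
    destruct (Req_dec (T G i p - G i p) 0) as [Q|Q]; [lra|].
    now apply Rabs_no_R0 in Q.
Qed.

(** Analytic implicit function theorem in fixed point form: a perturbation [N]
    with vanishing [1]-jet is a contraction on a small ball. *)
Theorem An_implicit d e (N A : nat -> pt -> R) :
  (forall i, (i < d)%nat -> An d (N i)) ->
  (forall i, (i < d)%nat -> N i (fun _ => 0) = 0) ->
  (forall i j, (i < d)%nat -> (j < d)%nat -> pd j (N i) (fun _ => 0) = 0) ->
  (forall i, (i < d)%nat -> An (S e) (A i)) ->
  (forall i, (i < d)%nat -> A i (fun _ => 0) = 0) ->
  exists G, (forall i, (i < d)%nat -> An (S e) (G i)) /\
    (forall i, (i < d)%nat -> G i (fun _ => 0) = 0) /\
    near (S e) (fun p => forall i, (i < d)%nat -> G i p = A i p + N i (fun j => G j p)).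
Proof.
  intros HN N0 DN HA A0.
  destruct (An_family d d N HN) as (r & M0 & Hr & HM0).
  set (M := Rabs M0 + 1).
  assert (HMpos : 0 < M) by (unfold M; pose proof (Rabs_pos M0); lra).
  assert (HM : forall i, (i < d)%nat -> anorm d r (N i) M).
  { intros i Hi. eapply anorm_mono; [apply HM0; auto|]. unfold M.
    pose proof (Rle_abs M0). lra. }
  set (K := (INR d + 1) * M * 8 / r ^ 2).
  assert (HK : 0 < K).
  { unfold K. pose proof (pos_INR d). apply Rdiv_lt_0_compat; [|apply pow_lt; lra].
    repeat apply Rmult_lt_0_compat; lra. }
  set (s := Rmin r (/ K)).
  assert (Hs : 0 < s) by (apply Rmin_pos; auto; now apply Rinv_0_lt_compat).
  assert (Hsr : s <= r) by apply Rmin_l.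
  assert (HsK : s * K <= 1).
  { apply Rle_trans with (/ K * K); [|rewrite Rinv_l; lra].
    apply Rmult_le_compat_r; [lra|apply Rmin_r]. }
  assert (HsM : (s / r) ^ 2 * M * (INR d + 1) * 8 <= s).
  { replace ((s / r) ^ 2 * M * (INR d + 1) * 8) with (s * (s * K)) by (unfold K; field; lra).
    nra. }
  assert (Hpos : 0 <= (s / r) ^ 2 * M).
  { apply Rmult_le_pos; [apply pow2_ge_0|lra]. }
  assert (HNs : forall i, (i < d)%nat -> anorm d s (N i) ((s / r) ^ 2 * M)).
  { intros i Hi. apply anorm_shrink2; auto. }
  destruct (An_family_small (S e) d A (s / 8)) as (t & Ht & HAt); auto; [lra|].
  destruct (anorm_fixed_point d e t (s / 2) (fun G i p => A i p + N i (fun j => G j p)))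
    as (G & HG & G0 & EG); auto.
  - intros G HG i Hi. pose proof (pos_INR d).
    eapply anorm_mono.
    + apply anorm_add; [apply HAt; auto|].
      apply anorm_comp with (d := d) (r := s) (rho := s / 2); eauto. lra.
    + nra.
  - intros G G' delta Hdel HG HG' HD i Hi.
    eapply anorm_mono.
    + eapply anorm_feq.
      * apply (anorm_comp_lipschitz d s (N i) ((s / r) ^ 2 * M) (S e) t G G' delta); auto.
      * intros p. cbv beta. ring.
    + replace (delta / 2) with (/ 2 * delta) by field.
      apply Rmult_le_compat_r; auto.
      apply Rmult_le_reg_r with s; auto.
      replace (INR d / s * ((s / r) ^ 2 * M) * s) with (INR d * ((s / r) ^ 2 * M)) by (field; lra).
      nra.
  - intros G HG0 i Hi.
    assert (E : N i (fun j => G j (fun _ => 0)) = N i (fun _ => 0)).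
    { apply (anorm_local d r (N i) M); auto.
      intros j Hj. rewrite HG0, Rabs_R0; auto. }
    rewrite E, A0, N0; auto. ring.
  - lra.
  - exists G. repeat split; auto.
    + intros i Hi. exists t, (s / 2). auto.
    + exists t. split; auto. intros p Hp i Hi. symmetry. auto.
Qed.

(** * Integration in the last variable *)

Definition prim (d : nat) (F : pt -> R) : pt -> R :=
  fun p => RInt (fun t => F (upd p d t)) 0 (p d).

(** Integrating the series term by term multiplies the norm by at most the
    radius, so that integration over a short time is contracting. *)
Lemma anorm_prim d r F M : 0 < r -> anorm (S d) r F M ->
  anorm (S d) r (prim d F) (r * M) /\
  (forall p, dom (S d) r p ->
     is_derive (fun t => prim d F (upd p d t)) (p d) (F p) /\
     ex_RInt (fun t => F (upd p d t)) 0 (p d)).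
Proof.
  intros Hr HF. pose proof HF as HF'. destruct HF as (Fn & Mn & H1 & H2 & H3).
  change (forall n, anorm d r (Fn n) (Mn n)) in H1.
  assert (HM0 : forall n, 0 <= Mn n) by (intros n; eapply anorm_nonneg; apply H1).
  assert (HS : forall p t, dom (S d) r p -> Rabs t < r ->
    is_series (fun n => Fn n p * t ^ n) (F (upd p d t))).
  { intros p t Hp Ht. pose proof (H3 (upd p d t) (dom_upd _ _ _ _ _ Hp Ht)) as E.
    rewrite upd_eq in E. eapply is_series_ext_R; [|exact E].
    intros n. simpl. f_equal. symmetry.
    apply (anorm_local d r _ _ _ _ (H1 n)); [now apply dom_S|].
    intros j Hj. rewrite upd_neq by lia. reflexivity. }
  assert (HP : forall p t, dom (S d) r p -> Rabs t < r ->
    F (upd p d t) = PSeries (fun n => Fn n p) t).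
  { intros p t Hp Ht. symmetry. apply is_series_PSeries. auto. }
  assert (HCV : forall p t, dom (S d) r p -> Rabs t < r ->
    Rbar_lt (Rabs t) (CV_radius (fun n => Fn n p))).
  { intros p t Hp Ht. set (t' := (Rabs t + r) / 2).
    assert (Ht' : Rabs t < t' < r) by (unfold t'; lra).
    assert (Ht0 : Rabs t' = t') by (apply Rabs_pos_eq; pose proof (Rabs_pos t); lra).
    destruct (Rbar_lt_le_dec (CV_radius (fun n => Fn n p)) (Rabs t')) as [C|C].
    - exfalso. apply (CV_disk_outside _ _ C). apply ex_series_lim_0.
      eexists. apply HS; auto. lra.
    - eapply Rbar_lt_le_trans; [|exact C]. simpl. lra. }
  assert (Hle : forall t x, Rmin 0 t < x < Rmax 0 t -> Rabs x <= Rabs t).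
  { intros t x. unfold Rmin, Rmax. destruct (Rle_dec 0 t); intros [A B];
      unfold Rabs; destruct (Rcase_abs x), (Rcase_abs t); lra. }
  assert (HE : forall p t, dom (S d) r p -> Rabs t < r ->
    is_RInt (fun t => F (upd p d t)) 0 t (PSeries (PS_Int (fun n => Fn n p)) t)).
  { intros p t Hp Ht. eapply is_RInt_ext; [|apply is_RInt_PSeries; auto].
    intros x Hx. symmetry. apply HP; auto. apply Hle in Hx. lra. }
  assert (HV : forall p, dom (S d) r p ->
    prim d F p = PSeries (PS_Int (fun n => Fn n p)) (p d)).
  { intros p Hp. apply is_RInt_unique. apply HE; [exact Hp|now apply dom_last]. }
  split.
  - exists (fun n => match n with O => fun _ => 0 | S n => fun p => Fn n p / INR (S n) end),
      (fun n => match n with O => 0 | S n => Mn n end).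
    repeat split.
    + intros [|n]; [apply (anorm_const0 d); lra|].
      apply (anorm_mono d) with (Rabs (/ INR (S n)) * Mn n).
      * apply anorm_feq with (fun p => / INR (S n) * Fn n p); [now apply (anorm_scal d)|].
        intros p. unfold Rdiv. ring.
      * assert (1 <= INR (S n)) by (rewrite S_INR; pose proof (pos_INR n); lra).
        rewrite Rabs_pos_eq by (apply Rlt_le, Rinv_0_lt_compat; lra).
        rewrite <- (Rmult_1_l (Mn n)) at 2. apply Rmult_le_compat_r; auto.
        rewrite <- Rinv_1. apply Rinv_le_contravar; lra.
    + intros [|N].
      * rewrite sum_n_O_R. rewrite Rmult_0_l. apply Rmult_le_pos; [lra|].
        eapply anorm_nonneg; eauto.
      * apply Rle_trans with (r * sum_n (fun n => Mn n * r ^ n) N).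
        -- right. induction N as [|N IH].
           ++ rewrite sum_n_S_R, !sum_n_O_R. simpl. ring.
           ++ rewrite sum_n_S_R, IH, (sum_n_S_R (fun n => Mn n * r ^ n)). simpl. ring.
        -- apply Rmult_le_compat_l; [lra|auto].
    + intros p Hp. rewrite HV by auto.
      assert (E : ex_pseries (PS_Int (fun n => Fn n p)) (p d)).
      { apply CV_radius_inside. rewrite CV_radius_Int. apply HCV; [exact Hp|now apply dom_last]. }
      apply PSeries_correct, is_pseries_R in E.
      eapply is_series_ext_R; [|exact E]. intros [|n]; simpl; reflexivity.
  - intros p Hp. pose proof (dom_last _ _ _ Hp) as Hpd. split.
    + apply is_derive_ext_loc with (PSeries (PS_Int (fun n => Fn n p))).
      * eapply filter_imp; [|apply (dom_upd_locally (S d) r p d Hp); lia].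
        intros t Ht. assert (Htr : Rabs t < r).
        { specialize (Ht d ltac:(lia)). now rewrite upd_eq in Ht. }
        rewrite HV, upd_eq by auto. apply PSeries_ext. intros [|n]; simpl; auto. f_equal.
        apply (anorm_local d r _ _ _ _ (H1 n)); [now apply dom_S|].
        intros j Hj. rewrite upd_neq by lia. reflexivity.
      * replace (F p) with (PSeries (PS_derive (PS_Int (fun n => Fn n p))) (p d)).
        -- apply is_derive_PSeries. rewrite CV_radius_Int. now apply HCV.
        -- transitivity (F (upd p d (p d))); [|now rewrite upd_id].
           rewrite HP by auto. apply PSeries_ext.
           intros n. unfold PS_derive, PS_Int. field. apply not_0_INR. lia.
    + eexists. apply HE; auto.
Qed.

Lemma prim_zero d F p : p d = 0 -> prim d F p = 0.
Proof. intros H. unfold prim. rewrite H.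
  exact (RInt_point 0 (fun t => F (upd p d t))).
Qed.

Lemma An_prim d F : An (S d) F ->
  An (S d) (prim d F) /\ pd d (prim d F) ~=[S d] F.
Proof.
  intros (r & M & Hr & H). destruct (anorm_prim d r F M Hr H) as [A B]. split.
  - exists r, (r * M). auto.
  - exists r. split; auto. intros p Hp. apply is_derive_unique. now apply B.
Qed.

(** * Analytic flows *)

(** Picard iteration: the operator [G |-> p + int_0^t V(G)] is a contraction
    because integration over a short time is. *)
Theorem An_flow d (V : nat -> pt -> R) :
  (forall i, (i < d)%nat -> An d (V i)) ->
  exists Phi, (forall i, (i < d)%nat -> An (S d) (Phi i)) /\
    (forall i, (i < d)%nat -> Phi i (fun _ => 0) = 0) /\
    near (S d) (fun p => forall i, (i < d)%nat ->
      (p d = 0 -> Phi i p = p i) /\ pd d (Phi i) p = V i (fun j => Phi j p)).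
Proof.
  intros HV.
  destruct (An_family d d V HV) as (r & M0 & Hr & HM0).
  set (M := Rabs M0 + 1).
  assert (HMpos : 0 < M) by (unfold M; pose proof (Rabs_pos M0); lra).
  assert (HM : forall i, (i < d)%nat -> anorm d r (V i) M).
  { intros i Hi. eapply anorm_mono; [apply HM0; auto|]. unfold M.
    pose proof (Rle_abs M0). lra. }
  pose proof (pos_INR d) as Hd0.
  set (K := 4 * (1 + (1 + INR d) * M) / r).
  assert (HK : 0 < K).
  { unfold K. apply Rdiv_lt_0_compat; auto. apply Rmult_lt_0_compat; [lra|].
    assert (0 <= (1 + INR d) * M) by (apply Rmult_le_pos; lra). lra. }
  set (s := / K).
  assert (Hs : 0 < s) by (unfold s; now apply Rinv_0_lt_compat).
  assert (HsK : s * (4 * (1 + (1 + INR d) * M)) = r).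
  { replace (4 * (1 + (1 + INR d) * M)) with (K * r) by (unfold K; field; lra).
    unfold s. field. lra. }
  assert (HdM : 0 <= INR d * M) by (apply Rmult_le_pos; lra).
  assert (Hcomp : forall G : nat -> pt -> R,
    (forall i, (i < d)%nat -> anorm (S d) s (G i) (r / 2)) ->
    forall i, (i < d)%nat -> anorm (S d) s (fun p => V i (fun j => G j p)) M).
  { intros G HG i Hi. apply anorm_comp with (d := d) (r := r) (rho := r / 2); auto. lra. }
  destruct (anorm_fixed_point d d s (r / 2)
    (fun G i p => p i + prim d (fun p => V i (fun j => G j p)) p)) as (G & HG & G0 & EG); auto.
  - intros G HG i Hi. eapply anorm_mono.
    + apply anorm_add; [apply anorm_var; [lra|lia]|].
      apply (anorm_prim d s _ M); auto.
    + nra.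
  - intros G G' delta Hdel HG HG' HD i Hi.
    pose proof (Hcomp G HG i Hi) as HC. pose proof (Hcomp G' HG' i Hi) as HC'.
    pose proof (anorm_comp_lipschitz d r (V i) M (S d) s G G' delta Hr Hs (HM i Hi) HG HG' HD Hdel)
      as HL.
    destruct (anorm_prim d s _ _ Hs HL) as [HP _].
    apply anorm_mono with (s * (INR d / r * M * delta)).
    + apply anorm_ext with (1 := HP). intros p Hp.
      destruct (anorm_prim d s _ _ Hs HC) as [_ HI]. destruct (HI p Hp) as [_ I1].
      destruct (anorm_prim d s _ _ Hs HC') as [_ HI']. destruct (HI' p Hp) as [_ I2].
      unfold prim.
      pose proof (RInt_minus _ _ _ _ I1 I2) as E. unfold minus, plus, opp in E; simpl in E.
      unfold Rminus. rewrite E. ring.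
    + replace (s * (INR d / r * M * delta)) with (s * (INR d * M) / r * delta) by (field; lra).
      replace (delta / 2) with (/ 2 * delta) by field. apply Rmult_le_compat_r; auto.
      apply Rmult_le_reg_r with r; auto.
      replace (s * (INR d * M) / r * r) with (s * (INR d * M)) by (field; lra). nra.
  - intros G HG0 i Hi. rewrite prim_zero; auto. ring.
  - lra.
  - exists G. split; [intros i Hi; exists s, (r / 2); auto|]. split; auto.
    exists s. split; auto. intros p Hp i Hi.
    destruct (anorm_prim d s _ _ Hs (Hcomp G HG i Hi)) as [_ HI].
    split.
    + intros Hp0. rewrite <- EG, prim_zero by auto. ring.
    + apply is_derive_unique.
      apply is_derive_ext_loc with
        (fun t => p i + prim d (fun p => V i (fun j => G j p)) (upd p d t)).
      * eapply filter_imp; [|apply (dom_upd_locally (S d) s p d Hp); lia].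
        intros t Ht. rewrite <- EG by auto. rewrite upd_neq by lia. reflexivity.
      * destruct (HI p Hp) as [D _].
        pose proof (is_derive_plus (fun _ => p i) _ _ _ _ (@is_derive_const _ _ (p i) (p d)) D) as E.
        unfold plus, zero in E; simpl in E. rewrite Rplus_0_l in E. exact E.
Qed.

(** * Germs on the line and on the plane as germs in coordinates *)

Definition lift {T : Type} (F : R * R -> T) : pt -> T := fun p => F (p 0%nat, p 1%nat).

Definition pt2 (x y : R) : pt := fun i => match i with 0%nat => x | 1%nat => y | _ => 0 end.

Definition unlift (F : pt -> R) : R * R -> R := fun q => F (pt2 (fst q) (snd q)).

Lemma locally2_near (P : R * R -> Prop) :
  locally ((0, 0) : R * R) P <-> near 2 (lift P).
Proof.
  split.
  - intros [e He]. exists e. split; [apply cond_pos|]. intros p Hp. apply He.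
    split; [change (Rabs (p 0%nat - 0) < e)|change (Rabs (p 1%nat - 0) < e)];
      rewrite Rminus_0_r; apply Hp; lia.
  - intros (r & Hr & H). exists (mkposreal r Hr). intros [x y] [Hx Hy].
    change (Rabs (x - 0) < r) in Hx. change (Rabs (y - 0) < r) in Hy.
    rewrite Rminus_0_r in Hx, Hy. apply (H (pt2 x y)).
    intros [|[|i]] Hi; simpl; auto. lia.
Qed.

Lemma germ_eq2_near (F G : R * R -> R) : germ_eq2 F G <-> lift F ~=[2] lift G.
Proof. apply (locally2_near (fun p => F p = G p)). Qed.

Lemma locally1_near (P : R -> Prop) :
  locally 0 P <-> near 1 (fun p => P (p 0%nat)).
Proof.
  rewrite locally_Rabs_iff. split.
  - intros (e & He & H). exists e. split; auto. intros p Hp. apply H.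
    rewrite Rminus_0_r. apply Hp. lia.
  - intros (r & Hr & H). exists r. split; auto. intros t Ht. apply (H (fun _ => t)).
    intros i _. now rewrite Rminus_0_r in Ht.
Qed.

Lemma An_unlift F : An 2 F -> lift (unlift F) ~=[2] F.
Proof.
  intros H. eapply near_imp; [|apply (An_local 2 F H)].
  intros p Hp. symmetry. apply Hp. intros [|[|i]] Hi; simpl; auto. lia.
Qed.

Lemma sum_n_finite_series (u : nat -> R) n :
  (forall j, (n < j)%nat -> u j = 0) -> is_series u (sum_n u n).
Proof.
  intros H. apply is_series_is_lim_seq. apply is_lim_seq_ext_loc with (fun _ => sum_n u n).
  - exists n. intros N HN. induction HN as [|N HN IH]; auto.
    rewrite sum_n_S_R, <- IH, H by lia. now rewrite Rplus_0_r.
  - apply is_lim_seq_const.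
Qed.

Lemma is_series_delay (v : nat -> R) (l : R) i :
  is_series v l -> is_series (fun n => if Nat.leb i n then v (n - i)%nat else 0) l.
Proof.
  intros H. destruct i as [|i].
  - eapply is_series_ext_R; [|exact H]. intros n. simpl. now rewrite Nat.sub_0_r.
  - apply is_series_decr_n with (S i); [lia|].
    assert (E : sum_n (fun n => if Nat.leb (S i) n then v (n - S i)%nat else 0) (Init.Nat.pred (S i)) = 0 :> R).
    { simpl Init.Nat.pred. rewrite (sum_n_ext_R _ (fun _ => 0)).
      - induction i; [now rewrite sum_n_O_R|]. rewrite sum_n_S_R, IHi. apply Rplus_0_l.
      - intros n Hn. destruct (Nat.leb_spec (S i) n); [lia|auto]. }
    match goal with |- is_series _ ?l' => replace l' with l end.
    + eapply is_series_ext_R; [|exact H]. intros n. cbv beta.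
      destruct (Nat.leb_spec (S i) (S i + n)); [|lia]. f_equal. lia.
    + change (l = l - sum_n (fun n => if Nat.leb (S i) n then v (n - S i)%nat else 0)
        (Init.Nat.pred (S i))). rewrite E. ring.
Qed.

(** Summation by homogeneous degree agrees with summation one variable after
    the other, by Fubini. *)
Lemma analytic2_An (F : R * R -> R) : analytic2 F <-> An 2 (lift F).
Proof.
  split.
  - intros (a & Ha). apply locally2_near in Ha. destruct Ha as (e & He & Ha).
    set (r := e / 2).
    assert (Hr : 0 < r < e) by (unfold r; lra).
    assert (Hc : dom 2 e (fun _ => r)) by (intros i _; rewrite Rabs_pos_eq; lra).
    pose proof (Ha _ Hc) as [Hex _]. unfold lift in Hex. simpl fst in Hex. simpl snd in Hex.
    exists r. eexists. split; [lra|].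
    apply anorm_series with
      (F := fun n p => sum_n (fun i => a i (n - i)%nat * (p 0%nat ^ i * p 1%nat ^ (n - i))) n)
      (M := fun n => sum_n (fun i => Rabs (a i (n - i)%nat * r ^ i * r ^ (n - i))) n).
    + lra.
    + intros n.
      apply (anorm_sum_n 2 r (fun i p => a i (n - i)%nat * (p 0%nat ^ i * p 1%nat ^ (n - i)))
        (fun i => Rabs (a i (n - i)%nat * r ^ i * r ^ (n - i)))).
      intros i. rewrite Rmult_assoc, Rabs_mult.
      eapply anorm_mono.
      * apply anorm_scal, anorm_mul; [lra| |]; apply anorm_pow; try lra;
          apply anorm_var; lra || lia.
      * rewrite (Rabs_pos_eq (r ^ i * r ^ (n - i))); [lra|].
        apply Rmult_le_pos; apply pow_le; lra.
    + intros K. apply sum_n_le_Series; [|exact Hex].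
      intros n. apply sum_n_nonneg. intros. apply Rabs_pos.
    + intros p Hp. assert (Hp' : dom 2 e p) by (apply dom_le with r; auto; lra).
      destruct (Ha p Hp') as [_ E]. unfold lift in E |- *. simpl fst in E. simpl snd in E.
      eapply is_series_ext_R; [|exact E]. intros n. simpl. apply sum_n_ext_R.
      intros i _. ring.
    + lia.
  - intros HF.
    set (sw := fun i => match i with O => fun p : pt => p 1%nat | _ => fun p => p 0%nat end).
    assert (HG : An 2 (fun p => lift F (fun i => sw i p))).
    { apply An_comp with (d := 2%nat) (e := 2%nat); auto.
      - intros [|i] Hi; apply An_var; lia.
      - intros [|i] Hi; reflexivity. }
    destruct HG as (r & M & Hr & Fn & Mn & H1 & H2 & H3).
    change (forall n, anorm 1 r (Fn n) (Mn n)) in H1.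
    assert (H1' := H1).
    apply functional_choice in H1. destruct H1 as [Cn H1].
    apply functional_choice in H1. destruct H1 as [Nn H1].
    assert (Hc : exists c : nat -> nat -> R, forall i j, Rabs (c i j) <= Nn i j /\ forall p, Cn i j p = c i j).
    { apply (functional_choice (fun i ci => forall j, Rabs (ci j) <= Nn i j /\ forall p, Cn i j p = ci j)).
      intros i. apply (functional_choice (fun j cij => Rabs cij <= Nn i j /\ forall p, Cn i j p = cij)).
      intros j. destruct (H1 i) as (A & _). apply (A j). }
    destruct Hc as [a Ha].
    exists a. apply locally2_near. exists r. split; auto. intros p Hp. unfold lift. simpl fst. simpl snd.
    set (x := p 0%nat). set (y := p 1%nat).
    assert (Hx : Rabs x < r) by (apply Hp; lia). assert (Hy : Rabs y < r) by (apply Hp; lia).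
    assert (Hyx : dom 2 r (pt2 y x)) by (intros [|[|i]] Hi; simpl; auto; lia).
    assert (Hyx1 : dom 1 r (pt2 y x)) by now apply dom_S.
    set (u := fun i n => if Nat.leb i n then a i (n - i)%nat * x ^ i * y ^ (n - i) else 0).
    set (b := fun i n => if Nat.leb i n then Nn i (n - i)%nat * r ^ (n - i) * r ^ i else 0).
    assert (HNn0 : forall i j, 0 <= Nn i j).
    { intros i j. eapply Rle_trans; [apply Rabs_pos|apply Ha]. }
    assert (Hub : forall i n, Rabs (u i n) <= b i n).
    { intros i n. unfold u, b. destruct (Nat.leb i n); [|rewrite Rabs_R0; lra].
      rewrite !Rabs_mult.
      replace (Nn i (n - i)%nat * r ^ (n - i) * r ^ i) with (Nn i (n - i)%nat * r ^ i * r ^ (n - i)) by ring.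
      apply Rmult_le_compat; try apply Rmult_le_pos; try apply Rabs_pos.
      - apply Rmult_le_compat; try apply Rabs_pos; [apply Ha|]. apply pow_le_Rabs. lra.
      - apply pow_le_Rabs. lra. }
    assert (Hb : forall i N, sum_n (b i) N <= Mn i * r ^ i).
    { intros i N. destruct (H1 i) as (_ & A & _).
      assert (E : is_series (fun j => Nn i j * r ^ j * r ^ i)
        (Series (fun j => Nn i j * r ^ j) * r ^ i)).
      { rewrite Rmult_comm.
        apply is_series_ext_R with (fun j => r ^ i * (Nn i j * r ^ j)).
        - intros n. apply Rmult_comm.
        - apply is_series_scal_R, Series_correct. eapply ex_series_bounded; [|exact A].
          intros n. apply Rmult_le_pos; auto. apply pow_le; lra. }
      apply is_series_delay with (i := i) in E.
      apply Rle_trans with (Series (fun j => Nn i j * r ^ j) * r ^ i).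
      - rewrite <- (is_series_unique _ _ E). apply sum_n_le_Series.
        + intros n. destruct (Nat.leb i n); [|lra].
          repeat apply Rmult_le_pos; auto; apply pow_le; lra.
        + eexists; exact E.
      - apply Rmult_le_compat_r; [apply pow_le; lra|].
        apply Series_le_bound; auto. eapply ex_series_bounded; [|exact A].
        intros n. apply Rmult_le_pos; auto. apply pow_le; lra. }
    assert (Hrow : forall i, is_series (u i) (Fn i (pt2 y x) * x ^ i)).
    { intros i. destruct (H1 i) as (_ & _ & A). specialize (A (pt2 y x) Hyx1).
      assert (E : is_series (fun j => a i j * x ^ i * y ^ j) (Fn i (pt2 y x) * x ^ i)).
      { rewrite Rmult_comm. eapply is_series_ext_R; [|apply (is_series_scal_R (x ^ i) _ _ A)].
        intros j. destruct (Ha i j) as [_ Q]. cbv beta. rewrite Q. simpl. ring. }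
      apply is_series_delay with (i := i) in E.
      eapply is_series_ext_R; [|exact E]. intros n. reflexivity. }
    assert (Htot : is_series (fun i => Fn i (pt2 y x) * x ^ i) (F (x, y))) by apply (H3 _ Hyx).
    assert (Hfin : forall v : nat -> nat -> R, (forall i n, (n < i)%nat -> v i n = 0) ->
      forall n, Series (fun i => v i n) = sum_n (fun i => v i n) n).
    { intros v Hv n. apply is_series_unique. apply (sum_n_finite_series (fun i => v i n)).
      intros j Hj. now apply Hv. }
    split.
    + assert (Hrowa : forall i, is_series (fun n => Rabs (u i n)) (Series (fun n => Rabs (u i n)))).
      { intros i. apply Series_correct. eapply dominated_ex_abs; eauto. }
      assert (Htota : ex_series (fun i => Series (fun n => Rabs (u i n)))).
      { apply dominated_ex with (v := fun i => Mn i * r ^ i) (M := M); [|exact H2].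
        intros i. rewrite Rabs_pos_eq.
        - apply Series_le_bound; [eapply dominated_ex_abs; eauto|].
          intros N. eapply Rle_trans; [|apply (Hb i N)]. apply sum_n_le_R. auto.
        - eapply Rle_trans; [|apply (sum_n_le_Series _ 0)].
          + rewrite sum_n_O_R. apply Rabs_pos.
          + intros; apply Rabs_pos.
          + eapply dominated_ex_abs; eauto. }
      destruct Htota as [S HS].
      pose proof (Fubini_series (fun i n => Rabs (u i n)) b (fun i => Mn i * r ^ i) _ M S
        ltac:(intros; cbv beta; rewrite Rabs_Rabsolu; auto) Hb H2 Hrowa HS) as E.
      exists S. eapply is_series_ext_R; [|exact E]. intros n. cbv beta.
      rewrite (Hfin (fun i n => Rabs (u i n))).
      * apply sum_n_ext_R. intros i Hi. unfold u. destruct (Nat.leb_spec i n); [reflexivity|lia].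
      * intros i m Hm. unfold u. destruct (Nat.leb_spec i m); [lia|]. apply Rabs_R0.
    + pose proof (Fubini_series u b (fun i => Mn i * r ^ i) _ M _ Hub Hb H2 Hrow Htot) as E.
      eapply is_series_ext_R; [|exact E]. intros n. cbv beta. rewrite (Hfin u).
      * apply sum_n_ext_R. intros i Hi. unfold u. destruct (Nat.leb_spec i n); [reflexivity|lia].
      * intros i m Hm. unfold u. destruct (Nat.leb_spec i m); [lia|]. reflexivity.
Qed.

Lemma analytic1_An (f : R -> R) : analytic1 f <-> An 1 (fun p => f (p 0%nat)).
Proof.
  split.
  - intros (a & Ha). apply locally_Rabs_iff in Ha. destruct Ha as (e & He & Ha).
    set (r := e / 2). assert (Hr : 0 < r < e) by (unfold r; lra).
    assert (HCV : Rbar_le r (CV_radius a)).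
    { destruct (Rbar_lt_le_dec (CV_radius a) r) as [C|C]; auto. exfalso.
      rewrite <- (Rabs_pos_eq r) in C by lra. apply (CV_disk_outside _ _ C).
      apply ex_series_lim_0. eexists. apply is_pseries_R, Ha.
      rewrite Rminus_0_r, Rabs_pos_eq; lra. }
    assert (Hex : ex_series (fun n => Rabs (a n * (r / 2) ^ n))).
    { apply CV_disk_inside. eapply Rbar_lt_le_trans; [|exact HCV]. simpl.
      rewrite Rabs_pos_eq; lra. }
    exists (r / 2), (Series (fun n => Rabs (a n * (r / 2) ^ n))). split; [lra|].
    exists (fun n _ => a n), (fun n => Rabs (a n)). repeat split.
    + intros n. exists (a n). split; [lra|auto].
    + intros N. eapply Rle_trans; [|apply (sum_n_le_Series _ N)]; auto using Rabs_pos.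
      right. apply sum_n_ext_R. intros n _. rewrite Rabs_mult, (Rabs_pos_eq ((r / 2) ^ n)); auto.
      apply pow_le; lra.
    + intros p Hp. apply is_pseries_R, Ha. rewrite Rminus_0_r.
      apply Rlt_trans with (r / 2); [apply Hp; lia|lra].
  - intros (r & M & Hr & Fn & Mn & H1 & H2 & H3).
    apply functional_choice in H1. destruct H1 as [a Ha].
    exists a. apply locally_Rabs_iff. exists r. split; auto. intros t Ht.
    rewrite Rminus_0_r in Ht. apply is_pseries_R.
    eapply is_series_ext_R; [|apply (H3 (fun _ => t)); intros i _; exact Ht].
    intros n. destruct (Ha n) as [_ E]. cbv beta. rewrite E. reflexivity.
Qed.

(** * Reduction of a density modulo derivatives along the Hamiltonian field *)

(** The derivative along the field [(dH/dxi, - dH/dx)] for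
    [H = xi^2 + eps x^k]. *)
Definition Vop (k : nat) (eps : R) (eta : pt -> R) : pt -> R :=
  fun p => 2 * p 1%nat * pd 0 eta p - eps * INR k * p 0%nat ^ (k - 1) * pd 1 eta p.

(** Solution of the recursion met below when a monomial is reduced step by
    step, the coefficient of the [s]-th step being at most [X / (s + 1)]. *)
Fixpoint reduction_bound (X : R) (j s : nat) : R :=
  match j with O => 1 | S j => 1 + X / (INR s + 1) * reduction_bound X j (S s) end.

Lemma sum_n_first (u : nat -> R) N : sum_n u (S N) = u 0%nat + sum_n (fun n => u (S n)) N.
Proof.
  induction N as [|N IH].
  - now rewrite sum_n_S_R, !sum_n_O_R.
  - rewrite sum_n_S_R, IH, (sum_n_S_R (fun n => u (S n))). now rewrite Rplus_assoc.
Qed.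

Lemma reduction_bound_ge_1 X j s : 0 <= X -> 1 <= reduction_bound X j s.
Proof.
  intros HX. revert s. induction j as [|j IH]; intros s; simpl; [lra|].
  assert (0 <= X / (INR s + 1) * reduction_bound X j (S s)); [|lra].
  apply Rmult_le_pos.
  - apply Rmult_le_pos; auto. apply Rlt_le, Rinv_0_lt_compat. pose proof (pos_INR s). lra.
  - specialize (IH (S s)). lra.
Qed.

Lemma reduction_bound_exp X j : 0 <= X -> reduction_bound X j 0 <= exp X.
Proof.
  intros HX.
  assert (E : forall j s, reduction_bound X j s * (X ^ s / INR (fact s))
    = sum_n (fun i => X ^ (s + i) / INR (fact (s + i))) j).
  { induction j0 as [|j0 IH]; intros s.
    - rewrite sum_n_O_R, Nat.add_0_r. simpl. ring.
    - rewrite sum_n_first, Nat.add_0_r.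
      rewrite (sum_n_ext_R (fun n => X ^ (s + S n) / INR (fact (s + S n)))
        (fun n => X ^ (S s + n) / INR (fact (S s + n)))).
      2:{ intros n _. replace (s + S n)%nat with (S s + n)%nat by lia. reflexivity. }
      rewrite <- IH. cbn [reduction_bound]. rewrite fact_simpl, mult_INR, S_INR. cbn [pow].
      pose proof (pos_INR s). pose proof (INR_fact_neq_0 s). field. split; auto. lra. }
  specialize (E j 0%nat). simpl in E. unfold Rdiv in E at 1.
  rewrite Rinv_1, !Rmult_1_r in E. rewrite E.
  pose proof (is_exp_Reals X) as HE. apply is_pseries_R in HE.
  rewrite <- (is_series_unique _ _ HE).
  erewrite sum_n_ext_R; [apply sum_n_le_Series|].
  - intros n. apply Rmult_le_pos; [|apply pow_le; auto].
    apply Rlt_le, Rinv_0_lt_compat. apply INR_fact_lt_0.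
  - eexists; exact HE.
  - intros n _. simpl. unfold Rdiv. ring.
Qed.

Lemma is_derive_mono0 c i j p :
  is_derive (fun t => c * (upd p 0 t 0%nat ^ i * upd p 0 t 1%nat ^ j)) (p 0%nat)
    (c * (INR i * p 0%nat ^ pred i * p 1%nat ^ j)).
Proof. change (is_derive (fun t => c * (t ^ i * p 1%nat ^ j)) (p 0%nat)
    (c * (INR i * p 0%nat ^ pred i * p 1%nat ^ j))).
  auto_derive; auto. ring. Qed.

Lemma is_derive_mono1 c i j p :
  is_derive (fun t => c * (upd p 1 t 0%nat ^ i * upd p 1 t 1%nat ^ j)) (p 1%nat)
    (c * (p 0%nat ^ i * (INR j * p 1%nat ^ pred j))).
Proof. change (is_derive (fun t => c * (p 0%nat ^ i * t ^ j)) (p 1%nat)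
    (c * (p 0%nat ^ i * (INR j * p 1%nat ^ pred j)))).
  auto_derive; auto. ring. Qed.

Lemma Vop_mono_add k eps c i j th r eta M p :
  0 < r -> anorm 2 r eta M -> dom 2 (r / 4) p ->
  Vop k eps (fun p => c * (p 0%nat ^ i * p 1%nat ^ j) + th * eta p) p
  = c * (2 * INR i * p 0%nat ^ pred i * p 1%nat ^ S j
         - eps * INR k * INR j * p 0%nat ^ (k - 1 + i) * p 1%nat ^ pred j)
    + th * Vop k eps eta p.
Proof.
  intros Hr He Hp. unfold Vop.
  assert (D : forall l, (l < 2)%nat -> forall m,
    is_derive (fun t => c * (upd p l t 0%nat ^ i * upd p l t 1%nat ^ j)) (p l) m ->
    pd l (fun p => c * (p 0%nat ^ i * p 1%nat ^ j) + th * eta p) p = m + th * pd l eta p).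
  { intros l Hl m Hm. apply is_derive_unique.
    apply (is_derive_plus (fun t => c * (upd p l t 0%nat ^ i * upd p l t 1%nat ^ j))
      (fun t => th * eta (upd p l t))); auto.
    apply (is_derive_scal (fun t => eta (upd p l t))).
    apply (anorm_pd 2 r eta M l); auto. }
  rewrite (D 0%nat) with (m := c * (INR i * p 0%nat ^ pred i * p 1%nat ^ j));
    [|lia|apply is_derive_mono0].
  rewrite (D 1%nat) with (m := c * (p 0%nat ^ i * (INR j * p 1%nat ^ pred j)));
    [|lia|apply is_derive_mono1].
  rewrite pow_add. cbn [pow]. ring.
Qed.

Lemma anorm_mono_add c i j th r eta M N n :
  0 < r <= 1 -> anorm 2 r eta M -> (n <= i + j)%nat ->
  Rabs c * r ^ n + Rabs th * M <= N ->
  anorm 2 r (fun p => c * (p 0%nat ^ i * p 1%nat ^ j) + th * eta p) N.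
Proof.
  intros Hr He Hn HN. eapply anorm_mono; [|exact HN].
  apply anorm_add; [|now apply anorm_scal].
  eapply anorm_mono.
  - apply anorm_scal, anorm_mul; [lra| |]; apply anorm_pow; try lra; apply anorm_var; lra || lia.
  - apply Rmult_le_compat_l; [apply Rabs_pos|]. rewrite <- pow_add.
    replace (i + j)%nat with (n + (i + j - n))%nat by lia. rewrite pow_add.
    rewrite <- (Rmult_1_r (r ^ n)) at 2. apply Rmult_le_compat_l; [apply pow_le; lra|].
    rewrite <- (pow1 (i + j - n)). apply pow_incr. lra.
Qed.

Section Reduce.
Context (k : nat) (hk : (2 <= k)%nat) (eps : R) (heps : eps = 1 \/ eps = -1).

Lemma eps_sqr : eps * eps = 1.
Proof using heps. clear hk. destruct heps; subst; ring. Qed.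

Lemma eps_abs : Rabs eps = 1.
Proof using heps. clear hk. destruct heps; subst; [apply Rabs_R1|]. rewrite Rabs_left; lra. Qed.

(** Lowering the power of [xi]:
    [x^a xi^b = V (x^(a+1) xi^(b-1)) / (2 (a+1)) + theta x^(a+k) xi^(b-2)]
    with [theta = eps k (b-1) / (2 (a+1))]. *)
Lemma reduce_xi B r : 0 < r <= 1 -> forall j s a b,
  (s <= a)%nat -> (b <= j)%nat -> (b <= B)%nat ->
  exists c eta, Rabs c <= reduction_bound (INR k * INR B / 2) j s /\ (Nat.Odd b -> c = 0) /\
    anorm 2 r eta (reduction_bound (INR k * INR B / 2) j s * r ^ (a + b)) /\
    forall p, dom 2 (r / 4) p ->
      p 0%nat ^ a * p 1%nat ^ b = c * p 0%nat ^ (a + k * (b / 2)) + Vop k eps eta p.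
Proof using hk heps.
  intros Hr. set (X := INR k * INR B / 2).
  assert (HX : 0 <= X).
  { unfold X. pose proof (pos_INR k). pose proof (pos_INR B).
    assert (0 <= INR k * INR B) by now apply Rmult_le_pos. lra. }
  assert (Hz : anorm 2 r (fun _ => 0) 0) by (apply anorm_const0; lra).
  assert (V0 : forall p, Vop k eps (fun _ => 0) p = 0).
  { intros p. unfold Vop. rewrite !pd_const. ring. }
  assert (Hrn : forall n, 0 <= r ^ n) by (intros; apply pow_le; lra).
  induction j as [|j IH]; intros s a b Hs Hb HB.
  - assert (b = 0)%nat by lia. subst b. exists 1, (fun _ => 0). repeat split.
    + rewrite Rabs_R1. simpl. lra.
    + intros [x Hx]. lia.
    + apply anorm_const0; [lra|]. simpl. rewrite Rmult_1_l. auto.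
    + intros p _. rewrite V0, Nat.Div0.div_0_l, Nat.mul_0_r, Nat.add_0_r. simpl. ring.
  - pose proof (reduction_bound_ge_1 X (S j) s HX) as HQ1.
    assert (Ha1 : 1 <= INR (a + 1)) by (rewrite plus_INR; simpl; pose proof (pos_INR a); lra).
    assert (Hinv : Rabs (/ (2 * INR (a + 1))) <= 1).
    { rewrite Rabs_pos_eq by (apply Rlt_le, Rinv_0_lt_compat; lra).
      rewrite <- Rinv_1. apply Rinv_le_contravar; lra. }
    destruct b as [|[|b]].
    + exists 1, (fun _ => 0). repeat split.
      * rewrite Rabs_R1. auto.
      * intros [x Hx]. lia.
      * apply anorm_const0; [lra|]. apply Rmult_le_pos; auto. lra.
      * intros p _. rewrite V0, Nat.Div0.div_0_l, Nat.mul_0_r, Nat.add_0_r. simpl. ring.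
    + exists 0, (fun p => / (2 * INR (a + 1)) * (p 0%nat ^ (a + 1) * p 1%nat ^ 0) + 0 * 0).
      repeat split.
      * rewrite Rabs_R0. lra.
      * apply (anorm_mono_add _ _ _ 0 r (fun _ => 0) 0 _ (a + 1)); auto; [lia|].
        rewrite Rmult_0_r, Rplus_0_r. apply Rmult_le_compat_r; auto. lra.
      * intros p Hp. rewrite (Vop_mono_add k eps _ _ _ 0 r (fun _ => 0) 0 p) by (auto; lra).
        rewrite V0. replace (pred (a + 1)) with a by lia. simpl. field. lra.
    + destruct (IH (S s) (a + k)%nat b) as (c & eta & Hc & Hodd & He & HV); [lia|lia|lia|].
      set (th := eps * INR k * INR (b + 1) / (2 * INR (a + 1))).
      assert (Hth : Rabs th <= X / (INR s + 1)).
      { unfold th, Rdiv. rewrite !Rabs_mult, eps_abs, Rmult_1_l.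
        rewrite !(Rabs_pos_eq (INR _)) by apply pos_INR.
        rewrite Rabs_pos_eq by (apply Rlt_le, Rinv_0_lt_compat; lra).
        assert (INR (b + 1) <= INR B) by (apply le_INR; lia).
        assert (INR s + 1 <= INR (a + 1)) by (rewrite plus_INR; apply le_INR in Hs; simpl; lra).
        pose proof (pos_INR s). pose proof (pos_INR k). pose proof (pos_INR (b + 1)).
        unfold X, Rdiv. rewrite Rinv_mult, (Rmult_assoc (INR k * INR B)).
        apply Rmult_le_compat.
        - now apply Rmult_le_pos.
        - apply Rlt_le, Rmult_lt_0_compat; apply Rinv_0_lt_compat; lra.
        - apply Rmult_le_compat_l; auto.
        - apply Rmult_le_compat_l; [lra|]. apply Rinv_le_contravar; lra. }
      assert (HQ : 1 + Rabs th * reduction_bound X j (S s) <= reduction_bound X (S j) s).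
      { cbn [reduction_bound]. apply Rplus_le_compat_l, Rmult_le_compat_r; auto.
        pose proof (reduction_bound_ge_1 X j (S s) HX). lra. }
      pose proof (reduction_bound_ge_1 X j (S s) HX) as HQ0.
      exists (th * c),
        (fun p => / (2 * INR (a + 1)) * (p 0%nat ^ (a + 1) * p 1%nat ^ (b + 1)) + th * eta p).
      repeat split.
      * rewrite Rabs_mult.
        assert (Rabs th * Rabs c <= Rabs th * reduction_bound X j (S s))
          by (apply Rmult_le_compat_l; auto; apply Rabs_pos). lra.
      * intros [x Hx]. rewrite Hodd; [ring|]. exists (x - 1)%nat. lia.
      * eapply anorm_mono_add with (n := (a + S (S b))%nat); eauto; [lia|].
        apply Rle_trans with ((1 + Rabs th * reduction_bound X j (S s)) * r ^ (a + S (S b)));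
          [|apply Rmult_le_compat_r; auto].
        rewrite Rmult_plus_distr_r, (Rmult_assoc (Rabs th)).
        apply Rplus_le_compat; [apply Rmult_le_compat_r; auto|].
        apply Rmult_le_compat_l; [apply Rabs_pos|].
        apply Rmult_le_compat_l; [lra|].
        replace (a + k + b)%nat with (a + S (S b) + (k - 2))%nat by lia. rewrite (pow_add r (a + S (S b))).
        rewrite <- (Rmult_1_r (r ^ (a + S (S b)))) at 2. apply Rmult_le_compat_l; auto.
        rewrite <- (pow1 (k - 2)). apply pow_incr. lra.
      * intros p Hp. rewrite (Vop_mono_add k eps _ _ _ th r eta _ p ltac:(lra) He Hp).
        specialize (HV p Hp).
        replace (S (S b) / 2)%nat with (S (b / 2))
          by (replace (S (S b)) with (b + 1 * 2)%nat by lia; rewrite Nat.div_add by lia; lia).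
        replace (a + k * S (b / 2))%nat with (a + k + k * (b / 2))%nat by lia.
        replace (th * c * p 0%nat ^ (a + k + k * (b / 2))) with
          (th * (p 0%nat ^ (a + k) * p 1%nat ^ b) - th * Vop k eps eta p) by (rewrite HV; ring).
        replace (pred (a + 1)) with a by lia. replace (pred (b + 1)) with b by lia.
        replace (k - 1 + (a + 1))%nat with (a + k)%nat by lia.
        replace (S (b + 1)) with (S (S b)) by lia.
        unfold th. field. lra.
Qed.

(** Monomials with [a + 1] a multiple of [k] are derivatives along the field:
    [x^(k m + k - 1) xi^b = - eps V (x^(k m) xi^(b+1)) / (k (b+1))
       + 2 eps m / (b+1) x^(k (m-1) + k - 1) xi^(b+2)]. *)
Lemma reduce_multiple B r : 0 < r <= 1 -> forall m s b,
  (s <= b)%nat -> (m <= B)%nat ->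
  exists eta, anorm 2 r eta (reduction_bound (2 * INR B) m s * r ^ (2 * m + b + 1)) /\
    forall p, dom 2 (r / 4) p ->
      p 0%nat ^ (k * m + k - 1) * p 1%nat ^ b = Vop k eps eta p.
Proof using hk heps.
  intros Hr. set (X := 2 * INR B).
  assert (HX : 0 <= X) by (unfold X; pose proof (pos_INR B); lra).
  assert (Hz : anorm 2 r (fun _ => 0) 0) by (apply anorm_const0; lra).
  assert (V0 : forall p, Vop k eps (fun _ => 0) p = 0).
  { intros p. unfold Vop. rewrite !pd_const. ring. }
  assert (Hrn : forall n, 0 <= r ^ n) by (intros; apply pow_le; lra).
  assert (Hk1 : 1 <= INR k) by (change 1 with (INR 1); apply le_INR; lia).
  induction m as [|m IH]; intros s b Hs HB.
  - assert (Hb1 : 1 <= INR (b + 1)) by (rewrite plus_INR; simpl; pose proof (pos_INR b); lra).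
    exists (fun p => - eps / (INR k * INR (b + 1)) * (p 0%nat ^ 0 * p 1%nat ^ (b + 1)) + 0 * 0).
    split.
    + apply (anorm_mono_add _ _ _ 0 r (fun _ => 0) 0 _ (b + 1)); auto.
      rewrite Rmult_0_r, Rplus_0_r. simpl reduction_bound. replace (2 * 0 + b + 1)%nat with (b + 1)%nat by lia.
      apply Rmult_le_compat_r; auto.
      unfold Rdiv. rewrite Rabs_mult, Rabs_Ropp, eps_abs, Rmult_1_l.
      rewrite Rabs_pos_eq by (apply Rlt_le, Rinv_0_lt_compat; nra).
      rewrite <- Rinv_1. apply Rinv_le_contravar; nra.
    + intros p Hp. rewrite (Vop_mono_add k eps _ _ _ 0 r (fun _ => 0) 0 p) by (auto; lra).
      rewrite V0. replace (pred (b + 1)) with b by lia.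
      replace (k * 0 + k - 1)%nat with (k - 1)%nat by lia. replace (k - 1 + 0)%nat with (k - 1)%nat by lia.
      simpl (INR 0). pose proof eps_sqr as E.
      replace (p 0%nat ^ (k - 1) * p 1%nat ^ b) with (eps * eps * (p 0%nat ^ (k - 1) * p 1%nat ^ b))
        by (rewrite E; ring).
      field. lra.
  - destruct (IH (S s) (S (S b))) as (eta & He & HV); [lia|lia|].
    assert (Hb1 : 1 <= INR (b + 1)) by (rewrite plus_INR; simpl; pose proof (pos_INR b); lra).
    set (th := eps * (2 * INR (S m)) / INR (b + 1)).
    assert (Hth : Rabs th <= X / (INR s + 1)).
    { unfold th, Rdiv. rewrite !Rabs_mult, eps_abs, Rmult_1_l.
      rewrite (Rabs_pos_eq 2) by lra. rewrite (Rabs_pos_eq (INR (S m))) by apply pos_INR.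
      rewrite Rabs_pos_eq by (apply Rlt_le, Rinv_0_lt_compat; lra).
      assert (INR (S m) <= INR B) by (apply le_INR; lia).
      assert (INR s + 1 <= INR (b + 1)) by (rewrite plus_INR; apply le_INR in Hs; simpl; lra).
      pose proof (pos_INR s). pose proof (pos_INR (S m)).
      unfold X, Rdiv. apply Rmult_le_compat; [lra| |lra|].
      - apply Rlt_le, Rinv_0_lt_compat; lra.
      - apply Rinv_le_contravar; lra. }
    assert (HQ : 1 + Rabs th * reduction_bound X m (S s) <= reduction_bound X (S m) s).
    { cbn [reduction_bound]. apply Rplus_le_compat_l, Rmult_le_compat_r; auto.
      pose proof (reduction_bound_ge_1 X m (S s) HX). lra. }
    exists (fun p => - eps / (INR k * INR (b + 1)) * (p 0%nat ^ (k * S m) * p 1%nat ^ (b + 1)) + th * eta p).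
    split.
    + apply (anorm_mono_add _ _ _ th r eta _ _ (2 * S m + b + 1) Hr He); [nia|].
      apply Rle_trans with ((1 + Rabs th * reduction_bound X m (S s)) * r ^ (2 * S m + b + 1));
        [|apply Rmult_le_compat_r; auto].
      rewrite Rmult_plus_distr_r, (Rmult_assoc (Rabs th)).
      replace (2 * m + S (S b) + 1)%nat with (2 * S m + b + 1)%nat by lia.
      apply Rplus_le_compat_r. apply Rmult_le_compat_r; auto.
      unfold Rdiv. rewrite Rabs_mult, Rabs_Ropp, eps_abs, Rmult_1_l.
      rewrite Rabs_pos_eq by (apply Rlt_le, Rinv_0_lt_compat; nra).
      rewrite <- Rinv_1. apply Rinv_le_contravar; nra.
    + intros p Hp. rewrite (Vop_mono_add k eps _ _ _ th r eta _ p ltac:(lra) He Hp).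
      rewrite <- HV by auto. replace (pred (b + 1)) with b by lia.
      replace (S (b + 1)) with (S (S b)) by lia.
      replace (pred (k * S m)) with (k * m + k - 1)%nat by nia.
      replace (k - 1 + k * S m)%nat with (k * S m + k - 1)%nat by lia.
      rewrite mult_INR. unfold th. pose proof eps_sqr as E.
      replace (p 0%nat ^ (k * S m + k - 1) * p 1%nat ^ b)
        with (eps * eps * (p 0%nat ^ (k * S m + k - 1) * p 1%nat ^ b)) by (rewrite E; ring).
      field. lra.
Qed.

(** For the weights [1 / k] of [x] and [1 / 2] of [xi], the reductions keep the
    weight of a monomial, so that its degree shrinks at most by a factor [k].
    Therefore the bound at radius [rho^k] is geometric in the degree [a + b] of
    the original monomial. *)
Lemma reduce_monomial rho a b : 0 < rho <= 1 ->
  exists c eta, Rabs c <= exp (INR k) ^ (a + b) /\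
    (c <> 0 -> (S a mod k <> 0)%nat /\ Nat.Even b) /\
    anorm 2 (rho ^ k) eta ((exp (INR k) * rho) ^ (a + b)) /\
    forall p, dom 2 (rho ^ k / 4) p ->
      p 0%nat ^ a * p 1%nat ^ b = c * p 0%nat ^ (a + k * (b / 2)) + Vop k eps eta p.
Proof using hk heps.
  intros Hrho. set (C := exp (INR k)).
  assert (Hr : 0 < rho ^ k <= 1).
  { split; [apply pow_lt; lra|]. rewrite <- (pow1 k). apply pow_incr. lra. }
  assert (HCn : forall x, x <= INR k * INR (a + b) -> exp x <= C ^ (a + b)).
  { intros x Hx. unfold C.
    assert (E : forall n, exp (INR k) ^ n = exp (INR k * INR n)).
    { induction n as [|n IH]; [simpl; now rewrite Rmult_0_r, exp_0|].
      cbn [pow]. rewrite IH, <- exp_plus, S_INR. f_equal. ring. }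
    rewrite E. destruct Hx as [Hx| ->]; [left; now apply exp_increasing|lra]. }
  assert (Hpow : forall n m, (m <= n)%nat -> rho ^ n <= rho ^ m).
  { intros n m L. replace n with (m + (n - m))%nat by lia. rewrite pow_add.
    rewrite <- (Rmult_1_r (rho ^ m)) at 2. apply Rmult_le_compat_l; [apply pow_le; lra|].
    rewrite <- (pow1 (n - m)). apply pow_incr. lra. }
  assert (Hfin : forall Q n, 0 <= Q -> Q <= C ^ (a + b) -> (a + b <= k * n)%nat ->
    Q * (rho ^ k) ^ n <= (C * rho) ^ (a + b)).
  { intros Q n HQ0 HQ Hn. rewrite <- pow_mult, Rpow_mult_distr.
    apply Rmult_le_compat; auto. apply pow_le; lra. }
  destruct (Nat.eq_dec (S a mod k) 0) as [E|E].
  - assert (Ha : exists m, a = (k * m + k - 1)%nat).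
    { exists (S a / k - 1)%nat. pose proof (Nat.div_mod_eq (S a) k) as D.
      rewrite E in D.
      assert (1 <= S a / k)%nat by (destruct (S a / k)%nat; lia). nia. }
    destruct Ha as [m ->].
    destruct (reduce_multiple m (rho ^ k) Hr m 0 b) as (eta & He & HV); [lia|lia|].
    assert (Hm : 0 <= 2 * INR m) by (pose proof (pos_INR m); lra).
    exists 0, eta. repeat split.
    + rewrite Rabs_R0. apply pow_le. left. apply exp_pos.
    + lra.
    + lra.
    + eapply anorm_mono; [exact He|]. apply Hfin.
      * pose proof (reduction_bound_ge_1 _ m 0 Hm). lra.
      * eapply Rle_trans; [apply reduction_bound_exp; auto|]. apply HCn.
        rewrite <- mult_INR. change 2 with (INR 2). rewrite <- mult_INR. apply le_INR. nia.
      * nia.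
    + intros p Hp. rewrite HV by auto. ring.
  - destruct (reduce_xi b (rho ^ k) Hr b 0 a b) as (c & eta & Hc & Hodd & He & HV); [lia|lia|lia|].
    assert (Hx : 0 <= INR k * INR b / 2).
    { pose proof (pos_INR k). pose proof (pos_INR b).
      assert (0 <= INR k * INR b) by now apply Rmult_le_pos. lra. }
    assert (HQ : reduction_bound (INR k * INR b / 2) b 0 <= C ^ (a + b)).
    { eapply Rle_trans; [apply reduction_bound_exp; auto|]. apply HCn. rewrite plus_INR.
      pose proof (pos_INR k). pose proof (pos_INR a).
      assert (0 <= INR k * INR a) by now apply Rmult_le_pos. lra. }
    exists c, eta. repeat split.
    + lra.
    + exact E.
    + destruct (Nat.Even_or_Odd b) as [Hb|Hb]; [exact Hb|]. exfalso. auto.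
    + eapply anorm_mono; [exact He|]. apply Hfin; auto.
      * pose proof (reduction_bound_ge_1 _ b 0 Hx). lra.
      * nia.
    + exact HV.
Qed.
End Reduce.

Lemma is_series_finite_sum (u : nat -> nat -> R) (l : nat -> R) K :
  (forall j, (j <= K)%nat -> is_series (u j) (l j)) ->
  is_series (fun n => sum_n (fun j => u j n) K) (sum_n l K).
Proof.
  induction K as [|K IH]; intros H.
  - rewrite sum_n_O_R. eapply is_series_ext_R; [|apply (H 0%nat); lia].
    intros n. now rewrite sum_n_O_R.
  - rewrite sum_n_S_R.
    eapply is_series_ext_R; [|apply is_series_plus_R; [apply IH; auto|apply (H (S K)); lia]].
    intros n. now rewrite sum_n_S_R.
Qed.

Lemma sum_n_pick (v : nat -> R) m K : (m <= K)%nat ->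
  sum_n (fun j => if Nat.eqb m j then v j else 0) K = v m :> R.
Proof.
  intros Hm.
  assert (E : is_series (fun j => if Nat.eqb m j then v j else 0) (v m)).
  { apply is_series_delta with m.
    - intros n Hn. destruct (Nat.eqb_spec m n); [congruence|auto].
    - now rewrite Nat.eqb_refl. }
  assert (E' := sum_n_finite_series (fun j => if Nat.eqb m j then v j else 0) K).
  rewrite <- (is_series_unique _ _ E). symmetry. apply is_series_unique, E'.
  intros j Hj. destruct (Nat.eqb_spec m j); [lia|auto].
Qed.

Lemma nf_fun_sum_n k f x : (2 <= k)%nat ->
  nf_fun k f x = sum_n (fun j => x ^ (S j) * f (S j) (x ^ k)) (k - 2) :> R.
Proof.
  intros hk. unfold nf_fun, sum_n. replace (k - 1)%nat with (S (k - 2)) by lia.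
  symmetry. apply (@sum_n_m_S R_AbelianMonoid (fun i => x ^ i * f i (x ^ k))).
Qed.

Lemma pd_anorm_sum r (al : nat -> R) (E : nat -> pt -> R) (M : nat -> R) l n p :
  0 < r -> (l < 2)%nat -> (forall i, anorm 2 r (E i) (M i)) -> dom 2 (r / 4) p ->
  pd l (fun p => sum_n (fun i => al i * E i p) n) p = sum_n (fun i => al i * pd l (E i) p) n.
Proof.
  intros Hr Hl HE Hp. apply is_derive_unique. induction n as [|n IH].
  - rewrite sum_n_O_R. apply is_derive_ext with (fun t => al 0%nat * E 0%nat (upd p l t)).
    + intros t. symmetry. apply (sum_n_O_R (fun i => al i * E i (upd p l t))).
    + apply (is_derive_scal (fun t => E 0%nat (upd p l t))).
      apply (anorm_pd 2 r _ (M 0%nat)); auto.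
  - rewrite sum_n_S_R.
    apply is_derive_ext with (fun t => sum_n (fun i => al i * E i (upd p l t)) n
      + al (S n) * E (S n) (upd p l t)).
    + intros t. symmetry. apply (sum_n_S_R (fun i => al i * E i (upd p l t))).
    + apply (is_derive_plus _ (fun t => al (S n) * E (S n) (upd p l t)) _ _ _ IH).
      apply (is_derive_scal (fun t => E (S n) (upd p l t))).
      apply (anorm_pd 2 r _ (M (S n))); auto.
Qed.

(** All monomials of degree [n] are reduced together, and the bounds of
    [reduce_monomial] make the sums over [n] converge normally.  The reduced
    monomial [x^N] contributes its primitive to [f_i] with [i = N mod k + 1],
    which runs through [1, ..., k - 1] as exponents [N] congruent to [-1]
    modulo [k] are reduced to [0]. *)
Theorem reduction (k : nat) (eps : R) (w : R * R -> R) :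
  (2 <= k)%nat -> eps = 1 \/ eps = -1 -> analytic2 w ->
  exists (f : nat -> R -> R) (eta : pt -> R),
    (forall i, (1 <= i <= k - 1)%nat -> analytic1 (f i)) /\ An 2 eta /\
    near 2 (fun p => lift w p = Derive (nf_fun k f) (p 0%nat) + Vop k eps eta p).
Proof.
  intros hk heps (a & Ha). apply locally2_near in Ha. destruct Ha as (e & He & Ha).
  set (r0 := e / 2). assert (Hr0 : 0 < r0 < e) by (unfold r0; lra).
  set (A := fun n : nat => sum_n (fun i => Rabs (a i (n - i)%nat)) n).
  assert (HA0 : forall n, 0 <= A n) by (intros n; apply sum_n_nonneg; intros; apply Rabs_pos).
  assert (HM : exists M, forall N, sum_n (fun n => A n * r0 ^ n) N <= M).
  { assert (Hc : dom 2 e (fun _ => r0)) by (intros i _; rewrite Rabs_pos_eq; lra).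
    destruct (Ha _ Hc) as [Hex _]. unfold lift in Hex. simpl fst in Hex. simpl snd in Hex.
    exists (Series (fun n => sum_n (fun i => Rabs (a i (n - i)%nat * r0 ^ i * r0 ^ (n - i))) n)).
    intros N. apply Rle_trans with (sum_n (fun n =>
      (sum_n (fun i => Rabs (a i (n - i)%nat * r0 ^ i * r0 ^ (n - i))) n : R)) N);
      [|apply sum_n_le_Series; [|exact Hex]].
    - right. apply sum_n_ext_R. intros n _. unfold A. rewrite Rmult_comm, <- sum_n_scal_R.
      apply sum_n_ext_R. intros i Hi.
      rewrite Rmult_assoc, Rabs_mult, <- pow_add. replace (i + (n - i))%nat with n by lia.
      rewrite (Rabs_pos_eq (r0 ^ n)); [ring|]. apply pow_le; lra.
    - intros n. apply sum_n_nonneg. intros. apply Rabs_pos. }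
  destruct HM as [M HM].
  set (C := exp (INR k)).
  assert (HC : 0 < C) by apply exp_pos.
  set (rho := Rmin 1 (r0 / C)).
  assert (Hrho : 0 < rho <= 1).
  { split; [|apply Rmin_l]. apply Rmin_pos; [lra|]. apply Rdiv_lt_0_compat; lra. }
  assert (HCr : 0 <= C * rho <= r0).
  { split; [apply Rmult_le_pos; lra|].
    apply Rle_trans with (C * (r0 / C)); [apply Rmult_le_compat_l; [lra|apply Rmin_r]|].
    right. field. lra. }
  set (r := rho ^ k).
  assert (Hr : 0 < r <= 1).
  { split; [apply pow_lt; lra|]. unfold r. rewrite <- (pow1 k). apply pow_incr. lra. }
  assert (Hpow : forall n m, (m <= n)%nat -> rho ^ n <= rho ^ m).
  { intros n m L. replace n with (m + (n - m))%nat by lia. rewrite pow_add.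
    rewrite <- (Rmult_1_r (rho ^ m)) at 2. apply Rmult_le_compat_l; [apply pow_le; lra|].
    rewrite <- (pow1 (n - m)). apply pow_incr. lra. }
  assert (Hred : exists (cc : nat -> nat -> R) (ee : nat -> nat -> pt -> R), forall i j,
    Rabs (cc i j) <= C ^ (i + j) /\ (cc i j <> 0 -> (S i mod k <> 0)%nat /\ Nat.Even j) /\
    anorm 2 r (ee i j) ((C * rho) ^ (i + j)) /\
    forall p, dom 2 (r / 4) p ->
      p 0%nat ^ i * p 1%nat ^ j = cc i j * p 0%nat ^ (i + k * (j / 2)) + Vop k eps (ee i j) p).
  { assert (H : forall i, exists cci eei, forall j,
      Rabs (cci j) <= C ^ (i + j) /\ (cci j <> 0 -> (S i mod k <> 0)%nat /\ Nat.Even j) /\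
      anorm 2 r (eei j) ((C * rho) ^ (i + j)) /\
      forall p, dom 2 (r / 4) p ->
        p 0%nat ^ i * p 1%nat ^ j = cci j * p 0%nat ^ (i + k * (j / 2)) + Vop k eps (eei j) p).
    { intros i. pose proof (fun j => reduce_monomial k hk eps heps rho i j Hrho) as H.
      apply functional_choice in H. destruct H as [cci H].
      apply functional_choice in H. destruct H as [eei H]. exists cci, eei. exact H. }
    apply functional_choice in H. destruct H as [cc H].
    apply functional_choice in H. destruct H as [ee H]. exists cc, ee. exact H. }
  destruct Hred as (cc & ee & Hred).
  (* [x^i xi^(n-i)] reduces to a multiple of [x^(N n i)]. *)
  set (N := fun n i => (i + k * ((n - i) / 2))%nat).
  (* Its primitive [x^(N + 1) / (N + 1)] contributes to [f_(N mod k + 1)]. *)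
  set (b := fun n l => a l (n - l)%nat * (cc l (n - l)%nat / INR (S (N n l)))).
  set (fterm := fun i n t l =>
    if Nat.eqb (N n l mod k) (i - 1) then b n l * t ^ (N n l / k) else 0).
  assert (HAn : forall n, sum_n (fun i => Rabs (a i (n - i)%nat) * (C * rho) ^ (i + (n - i))) n
    <= A n * r0 ^ n).
  { intros n. unfold A. rewrite (Rmult_comm (sum_n _ n)), <- sum_n_scal_R. apply sum_n_le_R.
    intros i Hi. replace (i + (n - i))%nat with n by lia. rewrite Rmult_comm.
    apply Rmult_le_compat_r; [apply Rabs_pos|]. apply pow_incr. lra. }
  set (eta_n := fun n p => sum_n (fun i => a i (n - i)%nat * ee i (n - i)%nat p) n).
  assert (Heta_n : forall n, anorm 2 r (eta_n n) (A n * r0 ^ n)).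
  { intros n. eapply anorm_mono; [|apply HAn].
    apply (anorm_sum_n 2 r (fun i p => a i (n - i)%nat * ee i (n - i)%nat p)
      (fun i => Rabs (a i (n - i)%nat) * (C * rho) ^ (i + (n - i)))).
    intros i. apply anorm_scal. apply Hred. }
  set (g_n := fun n (x : R) => sum_n (fun i => b n i * x ^ S (N n i)) n).
  assert (Hinv : forall m, 0 <= / INR (S m) <= 1).
  { intros m. rewrite S_INR. pose proof (pos_INR m). split.
    - apply Rlt_le, Rinv_0_lt_compat. lra.
    - rewrite <- Rinv_1. apply Rinv_le_contravar; lra. }
  assert (HNn : forall n i, (i <= n)%nat -> (n <= S (N n i))%nat).
  { intros n i Hi. unfold N. pose proof (Nat.div_mod_eq (n - i) 2).
    pose proof (Nat.mod_upper_bound (n - i) 2 ltac:(lia)). nia. }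
  assert (Hg_n : forall n, anorm 2 r (fun p => g_n n (p 0%nat)) (A n * r0 ^ n)).
  { intros n. eapply anorm_mono; [|apply HAn].
    eapply anorm_mono.
    - apply (anorm_sum_n 2 r (fun i p => b n i * p 0%nat ^ S (N n i))
        (fun i => Rabs (b n i) * r ^ S (N n i))).
      intros i. apply anorm_scal. apply anorm_pow; [lra|]. apply anorm_var; lra || lia.
    - apply sum_n_le_R. intros i Hi. unfold b, Rdiv. rewrite !Rabs_mult, Rmult_assoc.
      apply Rmult_le_compat_l; [apply Rabs_pos|]. rewrite Rpow_mult_distr.
      rewrite (Rabs_pos_eq (/ _)) by apply Hinv.
      apply Rmult_le_compat.
      + apply Rmult_le_pos; [apply Rabs_pos|apply Hinv].
      + apply pow_le; lra.
      + apply Rle_trans with (C ^ (i + (n - i)) * 1); [|lra].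
        apply Rmult_le_compat; try apply Rabs_pos; apply Hinv || apply Hred.
      + unfold r. rewrite <- pow_mult. apply Hpow. specialize (HNn n i Hi). nia. }
  assert (HB0 : forall n, 0 <= A n * r0 ^ n).
  { intros n. apply Rmult_le_pos; auto. apply pow_le; lra. }
  set (eta := fun p => Series (fun n => eta_n n p)).
  set (g := fun x => Series (fun n => g_n n x)).
  assert (Seta : forall p, dom 2 r p -> is_series (fun n => eta_n n p) (eta p)).
  { intros p Hp. apply Series_correct. eapply dominated_ex; [|exact HM].
    intros n. apply (anorm_bound 2 r (eta_n n)); auto. }
  assert (Sg : forall p, dom 2 r p -> is_series (fun n => g_n n (p 0%nat)) (g (p 0%nat))).
  { intros p Hp. apply Series_correct. eapply dominated_ex; [|exact HM].
    intros n. apply (anorm_bound 2 r (fun p => g_n n (p 0%nat))); auto. }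
  set (f := fun i t => Series (fun n => sum_n (fterm i n t) n)).
  assert (Hf : forall i n, anorm 1 r (fun p => sum_n (fterm i n (p 0%nat)) n)
    (A n * r0 ^ n / r)).
  { intros i n. eapply anorm_mono.
    - apply (anorm_sum_n 1 r (fun l p => fterm i n (p 0%nat) l)
        (fun l => Rabs (b n l) * r ^ (N n l / k))).
      intros l. unfold fterm. destruct (Nat.eqb (N n l mod k) (i - 1)).
      + apply anorm_scal. apply anorm_pow; [lra|]. apply anorm_var; lra || lia.
      + apply anorm_const0; [lra|]. apply Rmult_le_pos; [apply Rabs_pos|apply pow_le; lra].
    - replace (A n * r0 ^ n / r) with (/ r * (A n * r0 ^ n)) by (field; lra).
      eapply Rle_trans; [|apply Rmult_le_compat_l; [apply Rlt_le, Rinv_0_lt_compat; lra|apply HAn]].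
      rewrite <- sum_n_scal_R. apply sum_n_le_R. intros l Hl. unfold b.
      apply Rmult_le_reg_l with r; [lra|].
      replace (r * (/ r * (Rabs (a l (n - l)%nat) * (C * rho) ^ (l + (n - l)))))
        with (Rabs (a l (n - l)%nat) * (C * rho) ^ (l + (n - l))) by (field; lra).
      destruct (Hred l (n - l)%nat) as (Hc1 & Hc2 & _).
      destruct (Req_dec (cc l (n - l)%nat) 0) as [E|E].
      + rewrite E. unfold Rdiv. rewrite Rmult_0_l, Rmult_0_r, Rabs_R0, Rmult_0_l, Rmult_0_r.
        apply Rmult_le_pos; [apply Rabs_pos|apply pow_le; lra].
      + destruct (Hc2 E) as [_ [h Hh]].
        assert (HN1 : (n <= N n l)%nat).
        { unfold N. rewrite Hh.
          replace (2 * h / 2)%nat with h by (rewrite Nat.mul_comm, Nat.div_mul; lia). nia. }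
        assert (HN2 : (n <= k + k * (N n l / k))%nat).
        { pose proof (Nat.div_mod_eq (N n l) k).
          pose proof (Nat.mod_upper_bound (N n l) k ltac:(lia)). lia. }
        rewrite Rpow_mult_distr. unfold Rdiv. rewrite !Rabs_mult.
        rewrite (Rabs_pos_eq (/ _)) by apply Hinv.
        assert (P : r * r ^ (N n l / k) <= rho ^ (l + (n - l))).
        { unfold r. rewrite <- pow_mult, <- pow_add. apply Hpow. lia. }
        assert (Q : Rabs (cc l (n - l)%nat) * / INR (S (N n l)) <= C ^ (l + (n - l))).
        { apply Rle_trans with (C ^ (l + (n - l)) * 1); [|lra].
          apply Rmult_le_compat; try apply Rabs_pos; apply Hinv || auto. }
        replace (r * (Rabs (a l (n - l)%nat) * (Rabs (cc l (n - l)%nat) * / INR (S (N n l))) * r ^ (N n l / k)))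
          with (Rabs (a l (n - l)%nat) * ((Rabs (cc l (n - l)%nat) * / INR (S (N n l))) * (r * r ^ (N n l / k)))) by ring.
        apply Rmult_le_compat_l; [apply Rabs_pos|]. apply Rmult_le_compat; auto.
        * apply Rmult_le_pos; [apply Rabs_pos|apply Hinv].
        * apply Rmult_le_pos; [lra|apply pow_le; lra]. }
  assert (HMr : forall K, sum_n (fun n => A n * r0 ^ n / r) K <= M / r).
  { intros K. unfold Rdiv. rewrite (Rmult_comm M).
    rewrite (sum_n_ext_R _ (fun n => / r * (A n * r0 ^ n))) by (intros n _; apply Rmult_comm).
    rewrite sum_n_scal_R. apply Rmult_le_compat_l; [apply Rlt_le, Rinv_0_lt_compat; lra|auto]. }
  assert (Sf : forall i t, Rabs t < r -> is_series (fun n => sum_n (fterm i n t) n) (f i t)).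
  { intros i t Ht. apply Series_correct. eapply dominated_ex; [|exact HMr].
    intros n. assert (Hd : dom 1 r (fun _ => t)) by (intros j _; exact Ht).
    pose proof (anorm_bound _ _ _ _ _ (Hf i n) Hd) as B. exact B. }
  assert (HNf : forall x, Rabs x < r -> nf_fun k f x = g x).
  { intros x Hx. rewrite nf_fun_sum_n by auto.
    assert (Hxk : Rabs (x ^ k) < r).
    { rewrite <- RPow_abs. destruct k as [|k']; [lia|]. cbn [pow].
      pose proof (Rabs_pos x). rewrite <- (Rmult_1_r r).
      assert (Rabs x ^ k' <= 1) by (rewrite <- (pow1 k'); apply pow_incr; lra).
      assert (0 <= Rabs x ^ k') by (now apply pow_le). nra. }
    assert (S1 : is_series (fun n => sum_n (fun j => x ^ S j * sum_n (fterm (S j) n (x ^ k)) n) (k - 2))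
      (sum_n (fun j => x ^ S j * f (S j) (x ^ k)) (k - 2))).
    { apply (is_series_finite_sum (fun j n => x ^ S j * sum_n (fterm (S j) n (x ^ k)) n)).
      intros j _. apply is_series_scal_R. apply Sf. exact Hxk. }
    rewrite <- (is_series_unique _ _ S1). unfold g. apply Series_ext. intros n. unfold g_n.
    rewrite (sum_n_ext_R _ (fun j => sum_n (fun l => if Nat.eqb (N n l mod k) j then
      (fun j => x ^ S j * (b n l * (x ^ k) ^ (N n l / k))) j
      else 0) n)).
    2:{ intros j _. rewrite <- sum_n_scal_R. apply sum_n_ext_R. intros l _.
        unfold fterm. replace (S j - 1)%nat with j by lia.
        destruct (Nat.eqb (N n l mod k) j); ring. }
    rewrite (sum_n_switch (G := R_AbelianMonoid) (fun j l => if Nat.eqb (N n l mod k) j then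
      (fun j => x ^ S j * (b n l * (x ^ k) ^ (N n l / k))) j
      else 0)).
    apply sum_n_ext_R. intros l Hl.
    destruct (Nat.eq_dec (N n l mod k) (k - 1)) as [E|E].
    - assert (Hcz : cc l (n - l)%nat = 0).
      { destruct (Req_dec (cc l (n - l)%nat) 0) as [Z|Z]; auto. exfalso.
        destruct (Hred l (n - l)%nat) as (_ & Q & _). destruct (Q Z) as [Q1 _]. apply Q1.
        assert (E' : (S (N n l) mod k = S l mod k)%nat).
        { unfold N. replace (S (l + k * ((n - l) / 2))) with (S l + ((n - l) / 2) * k)%nat by lia.
          apply Nat.Div0.mod_add. }
        rewrite <- E'. pose proof (Nat.div_mod_eq (N n l) k) as D.
        replace (S (N n l)) with ((S (N n l / k)) * k)%nat by nia. apply Nat.Div0.mod_mul. }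
      unfold b. rewrite Hcz. unfold Rdiv. rewrite !Rmult_0_l, Rmult_0_r, Rmult_0_l.
      rewrite (sum_n_ext_R _ (fun j => 0 * 0)).
      + rewrite sum_n_scal_R. ring.
      + intros j _. destruct (Nat.eqb (N n l mod k) j); ring.
    - rewrite (sum_n_pick (fun j => x ^ S j * (b n l * (x ^ k) ^ (N n l / k)))).
      + rewrite <- pow_mult.
        assert (Ex : x ^ S (N n l) = x ^ S (N n l mod k) * x ^ (k * (N n l / k))).
        { rewrite <- pow_add. f_equal. pose proof (Nat.div_mod_eq (N n l) k). lia. }
        rewrite Ex. unfold b. ring.
      + pose proof (Nat.mod_upper_bound (N n l) k ltac:(lia)). lia. }
  exists f, eta. split; [|split].
  - intros i _. apply analytic1_An. exists r, (M / r). split; [lra|].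
    apply anorm_series with (2 := Hf i); auto; [lra|discriminate].
  - exists r, M. split; [lra|]. apply anorm_series with (2 := Heta_n); auto; [lra|discriminate].
  - assert (Hs : 0 < Rmin (r / 4) r0) by (apply Rmin_pos; lra).
    exists (Rmin (r / 4) r0). split; auto. intros p Hp.
    assert (Hp4 : dom 2 (r / 4) p) by (apply (dom_le _ _ _ _ (Rmin_l (r / 4) r0)); auto).
    assert (Hpe : dom 2 e p).
    { apply dom_le with r0; [lra|]. apply (dom_le _ _ _ _ (Rmin_r (r / 4) r0)); auto. }
    assert (Hpr : dom 2 r p) by (apply dom_le with (r / 4); auto; lra).
    assert (Er : 0 < r) by lra.
    replace (Derive (nf_fun k f) (p 0%nat)) with (pd 0 (fun p => g (p 0%nat)) p).
    2:{ unfold pd. apply Derive_ext_loc.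
        eapply filter_imp; [|apply (dom_upd_locally 2 r p 0 Hpr); lia].
        intros t Ht. specialize (Ht 0%nat ltac:(lia)). rewrite upd_eq in Ht |- *.
        symmetry. now apply HNf. }
    pose proof (pd_series 2 r (fun n p => g_n n (p 0%nat)) _ (fun p => g (p 0%nat)) M 0
      Er ltac:(lia) Hg_n HM Sg p Hp4) as D0.
    pose proof (pd_series 2 r eta_n _ eta M 0 Er ltac:(lia) Heta_n HM Seta p Hp4) as E0.
    pose proof (pd_series 2 r eta_n _ eta M 1 Er ltac:(lia) Heta_n HM Seta p Hp4) as E1.
    pose proof (is_series_plus_R _ _ _ _ D0 (is_series_minus_R _ _ _ _
      (is_series_scal_R (2 * p 1%nat) _ _ E0)
      (is_series_scal_R (eps * INR k * p 0%nat ^ (k - 1)) _ _ E1))) as T.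
    fold (Vop k eps eta p) in T. rewrite <- (is_series_unique _ _ T).
    destruct (Ha p Hpe) as [_ W]. unfold lift in W |- *. simpl fst in W. simpl snd in W.
    rewrite <- (is_series_unique _ _ W). apply Series_ext. intros n.
    assert (Eeta : forall l, (l < 2)%nat ->
      pd l (eta_n n) p = sum_n (fun i => a i (n - i)%nat * pd l (ee i (n - i)%nat) p) n).
    { intros l Hl. apply (pd_anorm_sum r (fun i => a i (n - i)%nat) (fun i => ee i (n - i)%nat)
        (fun i => (C * rho) ^ (i + (n - i)))); auto. intros i. apply Hred. }
    rewrite !Eeta by lia.
    replace (pd 0 (fun p => g_n n (p 0%nat)) p) with
      (sum_n (fun i => a i (n - i)%nat * (cc i (n - i)%nat * p 0%nat ^ N n i)) n).
    2:{ symmetry.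
        etransitivity; [apply (pd_anorm_sum r
          (b n)
          (fun i p => p 0%nat ^ S (N n i)) (fun i => r ^ S (N n i))); auto|].
        2:{ apply sum_n_ext_R. intros i _.
          replace (pd 0 (fun p => p 0%nat ^ S (N n i)) p) with (INR (S (N n i)) * p 0%nat ^ N n i).
          + unfold b. field. apply not_0_INR. lia.
          + symmetry. apply is_derive_unique.
            change (is_derive (fun t => t ^ S (N n i)) (p 0%nat) (INR (S (N n i)) * p 0%nat ^ N n i)).
            pose proof (is_derive_pow (fun t => t) (S (N n i)) (p 0%nat) 1 (is_derive_id _)) as D.
            rewrite Rmult_1_r in D. exact D. }
        intros i. apply anorm_pow; [lra|]. apply anorm_var; lra || lia. }
    rewrite <- !sum_n_scal_R.
    replace (fun i => a i (n - i)%nat * p 0%nat ^ i * p 1%nat ^ (n - i)) with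
      (fun i => a i (n - i)%nat * (p 0%nat ^ i * p 1%nat ^ (n - i)))
      by (apply functional_extensionality; intros; ring).
    assert (Q : forall (u v t : nat -> R) m,
      sum_n u m + (sum_n v m - sum_n t m) = sum_n (fun i => u i + (v i - t i)) m).
    { intros u v t. induction m as [|m IH]; [now rewrite !sum_n_O_R|].
      rewrite !sum_n_S_R, <- IH. ring. }
    rewrite Q. apply sum_n_ext_R. intros i Hi.
    destruct (Hred i (n - i)%nat) as (_ & _ & _ & HV). rewrite (HV p Hp4). unfold Vop, N. ring.
Qed.

(** * Planar maps *)

Definition zero_at_origin (F : pt -> R) : Prop := F (fun _ => 0) = 0.

Definition family2 (X Y : pt -> R) : nat -> pt -> R :=
  fun i => match i with 0%nat => X | 1%nat => Y | _ => fun _ => 0 end.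

Lemma family2_pt2 X Y p : (fun i => family2 X Y i p) = pt2 (X p) (Y p).
Proof. apply functional_extensionality. intros [|[|i]]; reflexivity. Qed.

Lemma pt2_0 : pt2 0 0 = fun _ => 0.
Proof. apply functional_extensionality. intros [|[|i]]; reflexivity. Qed.

Section Comp2.
Context (e : nat) (X Y : pt -> R).
Hypotheses (HX : An e X) (HY : An e Y) (X0 : zero_at_origin X) (Y0 : zero_at_origin Y).

Lemma family2_An i : (i < 2)%nat -> An e (family2 X Y i).
Proof using HX HY. intros Hi. destruct i as [|[|i]]; simpl; auto. lia. Qed.

Lemma family2_0 i : (i < 2)%nat -> family2 X Y i (fun _ => 0) = 0.
Proof using X0 Y0. intros Hi. destruct i as [|[|i]]; simpl; auto. Qed.

Lemma An_comp2 F : An 2 F -> An e (fun p => F (pt2 (X p) (Y p))).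
Proof using HX HY X0 Y0.
  intros HF. apply An_ext with (fun p => F (fun i => family2 X Y i p)).
  - apply An_comp with (d := 2%nat); auto using family2_An, family2_0.
  - apply near_all. intros p. now rewrite family2_pt2.
Qed.

Lemma near_comp2 P : near 2 P -> near e (fun p => P (pt2 (X p) (Y p))).
Proof using HX HY X0 Y0.
  intros HP. eapply near_imp; [|apply (near_comp 2 e (family2 X Y)
    family2_An family2_0 P HP)].
  intros p. cbv beta. now rewrite family2_pt2.
Qed.

Lemma chain2 F j : An 2 F -> (j < e)%nat ->
  near e (fun p => pd j (fun p => F (pt2 (X p) (Y p))) p
    = pd 0 F (pt2 (X p) (Y p)) * pd j X p + pd 1 F (pt2 (X p) (Y p)) * pd j Y p).
Proof using HX HY X0 Y0.
  intros HF Hj. eapply near_imp; [|apply (An_chain 2 e (family2 X Y)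
    family2_An family2_0 F j HF Hj)].
  intros p Hp. simpl in Hp. rewrite family2_pt2 in Hp. rewrite Rplus_0_l in Hp. rewrite <- Hp.
  apply pd_feq. intros q. now rewrite family2_pt2.
Qed.
End Comp2.

Lemma An_var2 : An 2 (fun p => p 0%nat) /\ An 2 (fun p => p 1%nat).
Proof. split; apply An_var; lia. Qed.

(** A planar germ tangent to the identity has a right inverse, by the fixed
    point theorem applied to [G = id + (id - psi) o G]. *)
Lemma right_inverse2 X Y : An 2 X -> An 2 Y -> zero_at_origin X -> zero_at_origin Y ->
  pd 0 X (fun _ => 0) = 1 -> pd 1 X (fun _ => 0) = 0 ->
  pd 0 Y (fun _ => 0) = 0 -> pd 1 Y (fun _ => 0) = 1 ->
  exists A B, An 2 A /\ An 2 B /\ zero_at_origin A /\ zero_at_origin B /\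
    near 2 (fun p => X (pt2 (A p) (B p)) = p 0%nat) /\
    near 2 (fun p => Y (pt2 (A p) (B p)) = p 1%nat).
Proof.
  intros HX HY X0 Y0 X1 X2 Y1 Y2. destruct An_var2 as [V0 V1].
  destruct (An_implicit 2 1 (family2 (fun p => p 0%nat - X p) (fun p => p 1%nat - Y p))
    (family2 (fun p => p 0%nat) (fun p => p 1%nat))) as (G & HG & G0 & EG).
  - intros [|[|i]] Hi; simpl; try lia; apply An_minus; auto.
  - unfold zero_at_origin in *. intros [|[|i]] Hi; simpl; try lia; rewrite ?X0, ?Y0; ring.
  - assert (E0 := near_origin _ _ (pd_minus 2 0 ltac:(lia) _ _ V0 HX)).
    assert (E1 := near_origin _ _ (pd_minus 2 1 ltac:(lia) _ _ V0 HX)).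
    assert (E2 := near_origin _ _ (pd_minus 2 0 ltac:(lia) _ _ V1 HY)).
    assert (E3 := near_origin _ _ (pd_minus 2 1 ltac:(lia) _ _ V1 HY)).
    cbv beta in E0, E1, E2, E3.
    rewrite pd_var_eq in E0, E3. rewrite pd_var_neq in E1, E2 by lia.
    intros [|[|i]] [|[|j]] Hi Hj; simpl; try lia; lra.
  - intros [|[|i]] Hi; simpl; try lia; auto.
  - intros [|[|i]] Hi; simpl; try lia; auto.
  - exists (G 0%nat), (G 1%nat).
    split; [apply HG; lia|]. split; [apply HG; lia|].
    split; [apply G0; lia|]. split; [apply G0; lia|].
    assert (HL : forall F, An 2 F -> near 2 (fun p => F (fun j => G j p) = F (pt2 (G 0%nat p) (G 1%nat p)))).
    { intros F HF. eapply near_imp; [|apply (near_comp 2 2 G HG G0 _ (An_local 2 F HF))].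
      intros p Hp. apply Hp. intros [|[|i]] Hi; simpl; auto. lia. }
    split.
    + eapply near_imp2; [|exact EG|apply (HL X HX)].
      intros p A B. specialize (A 0%nat ltac:(lia)). simpl in A. rewrite <- B. lra.
    + eapply near_imp2; [|exact EG|apply (HL Y HY)].
      intros p A B. specialize (A 1%nat ltac:(lia)). simpl in A. rewrite <- B. lra.
Qed.

Lemma An_near_pt2 X : An 2 X -> near 2 (fun p => X p = X (pt2 (p 0%nat) (p 1%nat))).
Proof. intros H. apply near_sym, (An_unlift X H). Qed.

(** The right inverse is again tangent to the identity, so it has a right
    inverse as well, which must be the original map. *)
Lemma inverse2 X Y : An 2 X -> An 2 Y -> zero_at_origin X -> zero_at_origin Y ->
  pd 0 X (fun _ => 0) = 1 -> pd 1 X (fun _ => 0) = 0 ->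
  pd 0 Y (fun _ => 0) = 0 -> pd 1 Y (fun _ => 0) = 1 ->
  exists A B, (An 2 A /\ An 2 B /\ zero_at_origin A /\ zero_at_origin B) /\
    (near 2 (fun p => X (pt2 (A p) (B p)) = p 0%nat) /\
     near 2 (fun p => Y (pt2 (A p) (B p)) = p 1%nat)) /\
    near 2 (fun p => A (pt2 (X p) (Y p)) = p 0%nat) /\
    near 2 (fun p => B (pt2 (X p) (Y p)) = p 1%nat).
Proof.
  intros HX HY X0 Y0 X1 X2 Y1 Y2.
  destruct (right_inverse2 X Y HX HY X0 Y0 X1 X2 Y1 Y2) as (A & B & HA & HB & A0 & B0 & EX & EY).
  assert (HD : forall j, (j < 2)%nat ->
    pd j A (fun _ => 0) = pd j (fun p => p 0%nat) (fun _ => 0) /\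
    pd j B (fun _ => 0) = pd j (fun p => p 1%nat) (fun _ => 0)).
  { intros j Hj.
    pose proof (near_origin _ _ (chain2 2 A B HA HB A0 B0 X j HX Hj)) as CX.
    pose proof (near_origin _ _ (chain2 2 A B HA HB A0 B0 Y j HY Hj)) as CY.
    pose proof (near_origin _ _ (pd_near 2 j _ _ Hj EX)) as DX.
    pose proof (near_origin _ _ (pd_near 2 j _ _ Hj EY)) as DY.
    cbv beta in CX, CY. rewrite A0, B0, pt2_0 in CX, CY. rewrite DX in CX. rewrite DY in CY.
    rewrite X1, X2 in CX. rewrite Y1, Y2 in CY. lra. }
  destruct (HD 0%nat ltac:(lia)) as [A1 B1]. destruct (HD 1%nat ltac:(lia)) as [A2 B2].
  rewrite pd_var_eq in A1, B2. rewrite pd_var_neq in A2, B1 by lia.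
  destruct (right_inverse2 A B HA HB A0 B0 A1 A2 B1 B2) as (K & L & HK & HL & K0 & L0 & EA & EB).
  (* With [K, L] a right inverse of [A, B], both [X, Y] and [K, L] equal
     [(X, Y) o (A, B) o (K, L)]. *)
  assert (EK : near 2 (fun p => X p = K p /\ Y p = L p)).
  { pose proof (near_comp2 2 K L HK HL K0 L0 _ (near_and _ _ _ EX EY)) as E1.
    pose proof (near_and _ _ _ EA EB) as E2.
    eapply near_imp2; [|exact E1|apply (near_and _ _ _ E2 (near_and _ _ _ (An_near_pt2 X HX) (An_near_pt2 Y HY)))].
    simpl. intros p [C1 C2] [[C3 C4] [C5 C6]].
    rewrite C3, C4 in C1, C2. rewrite C5, C6. auto. }
  exists A, B. split; auto. split; auto. split.
  - eapply near_imp2; [|exact EK|exact EA]. intros p [-> ->]. auto.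
  - eapply near_imp2; [|exact EK|exact EB]. intros p [-> ->]. auto.
Qed.

(** ** From maps of the plane to pairs of germs and back *)

Definition jac (X Y : pt -> R) : pt -> R :=
  fun p => pd 0 X p * pd 1 Y p - pd 1 X p * pd 0 Y p.

Definition comp1 (psi : R * R -> R * R) : pt -> R := lift (fun q => fst (psi q)).
Definition comp2 (psi : R * R -> R * R) : pt -> R := lift (fun q => snd (psi q)).

Lemma lift_comp (F : R * R -> R) psi p :
  lift (fun q => F (psi q)) p = lift F (pt2 (comp1 psi p) (comp2 psi p)).
Proof. unfold lift, comp1, comp2, lift. simpl. now rewrite <- surjective_pairing. Qed.

Lemma lift_pullback2 psi w p :
  lift (pullback2 psi w) p
  = lift w (pt2 (comp1 psi p) (comp2 psi p)) * jac (comp1 psi) (comp2 psi) p.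
Proof. rewrite <- lift_comp. reflexivity. Qed.

Lemma analytic_map_germ_An psi : analytic_map_germ psi <->
  (An 2 (comp1 psi) /\ An 2 (comp2 psi) /\
   zero_at_origin (comp1 psi) /\ zero_at_origin (comp2 psi)).
Proof.
  unfold analytic_map_germ. rewrite !analytic2_An. unfold zero_at_origin, comp1, comp2.
  split.
  - intros (H0 & H1 & H2). repeat split; auto; unfold lift; now rewrite H0.
  - intros (H1 & H2 & H3 & H4). repeat split; auto. unfold lift in H3, H4.
    rewrite (surjective_pairing (psi (0, 0))). now rewrite H3, H4.
Qed.

Lemma germ_eq2_map (psi phi : R * R -> R * R) :
  germ_eq2 psi phi <->
  near 2 (fun p => comp1 psi p = comp1 phi p /\ comp2 psi p = comp2 phi p).
Proof.
  unfold germ_eq2. rewrite locally2_near. split; apply near_imp; intros p; unfold lift, comp1, comp2, lift.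
  - now intros ->.
  - intros [H1 H2]. rewrite (surjective_pairing (psi _)), H1, H2. now rewrite <- surjective_pairing.
Qed.

Definition map_of (X Y : pt -> R) : R * R -> R * R := fun q => (unlift X q, unlift Y q).

Lemma map_of_germ X Y : An 2 X -> An 2 Y -> zero_at_origin X -> zero_at_origin Y ->
  analytic_map_germ (map_of X Y) /\ comp1 (map_of X Y) ~=[2] X /\ comp2 (map_of X Y) ~=[2] Y.
Proof.
  intros HX HY X0 Y0. pose proof (An_unlift X HX) as EX. pose proof (An_unlift Y HY) as EY.
  split; [|split; auto].
  apply analytic_map_germ_An. split; [|split; [|split]].
  - apply An_ext with X; auto. now apply near_sym.
  - apply An_ext with Y; auto. now apply near_sym.
  - unfold zero_at_origin. etransitivity; [apply (near_origin _ _ EX)|exact X0].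
  - unfold zero_at_origin. etransitivity; [apply (near_origin _ _ EY)|exact Y0].
Qed.

Lemma comp1_comp psi phi p :
  comp1 (fun q => psi (phi q)) p = comp1 psi (pt2 (comp1 phi p) (comp2 phi p)).
Proof. unfold comp1 at 1. rewrite (lift_comp (fun q => fst (psi q)) phi). reflexivity. Qed.

Lemma comp2_comp psi phi p :
  comp2 (fun q => psi (phi q)) p = comp2 psi (pt2 (comp1 phi p) (comp2 phi p)).
Proof. unfold comp2 at 1. rewrite (lift_comp (fun q => snd (psi q)) phi). reflexivity. Qed.

Lemma diffeo_germ_comp psi phi : diffeo_germ psi -> diffeo_germ phi ->
  diffeo_germ (fun q => psi (phi q)).
Proof.
  assert (HC : forall psi phi, analytic_map_germ psi -> analytic_map_germ phi ->
    analytic_map_germ (fun q => psi (phi q))).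
  { clear. intros psi phi H1 H2. apply analytic_map_germ_An in H1, H2.
    destruct H1 as (A & B & A0 & B0), H2 as (C & D & C0 & D0).
    apply analytic_map_germ_An. split; [|split; [|split]].
    - apply An_ext with (fun p => comp1 psi (pt2 (comp1 phi p) (comp2 phi p))).
      + now apply An_comp2.
      + apply near_all. intros. symmetry. apply comp1_comp.
    - apply An_ext with (fun p => comp2 psi (pt2 (comp1 phi p) (comp2 phi p))).
      + now apply An_comp2.
      + apply near_all. intros. symmetry. apply comp2_comp.
    - unfold zero_at_origin in *. rewrite comp1_comp, C0, D0, pt2_0. auto.
    - unfold zero_at_origin in *. rewrite comp2_comp, C0, D0, pt2_0. auto. }
  assert (HI : forall psi psi' phi phi',
    analytic_map_germ phi -> analytic_map_germ psi -> analytic_map_germ psi' ->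
    germ_eq2 (fun q => psi (psi' q)) (fun q => q) -> germ_eq2 (fun q => phi (phi' q)) (fun q => q) ->
    analytic_map_germ phi' ->
    germ_eq2 (fun q => phi (psi (psi' (phi' q)))) (fun q => q)).
  { clear. intros psi psi' phi phi' H1 H2 H3 E1 E2 H4. unfold germ_eq2 in *.
    apply locally2_near in E1, E2. apply locally2_near.
    apply analytic_map_germ_An in H4. destruct H4 as (C & D & C0 & D0).
    pose proof (near_comp2 2 _ _ C D C0 D0 _ E1) as E1'.
    eapply near_imp2; [|exact E1'|exact E2].
    unfold lift, comp1, comp2, lift. intros p. simpl. rewrite <- surjective_pairing.
    now intros ->. }
  intros (H1 & psi' & H2 & L1 & R1) (H3 & phi' & H4 & L2 & R2).
  split; [now apply HC|].
  exists (fun q => phi' (psi' q)). split; [now apply HC|]. split.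
  - apply (HI psi' psi phi' phi); auto.
  - apply (HI phi phi' psi psi'); auto.
Qed.

Lemma jac_near X Y X' Y' : X ~=[2] X' -> Y ~=[2] Y' -> jac X Y ~=[2] jac X' Y'.
Proof.
  intros HX HY.
  eapply near_imp2; [|apply (near_and _ _ _ (pd_near 2 0 _ _ ltac:(lia) HX) (pd_near 2 1 _ _ ltac:(lia) HX))
    |apply (near_and _ _ _ (pd_near 2 0 _ _ ltac:(lia) HY) (pd_near 2 1 _ _ ltac:(lia) HY))].
  intros p [A B] [C D]. unfold jac. now rewrite A, B, C, D.
Qed.

Lemma jac_An X Y : An 2 X -> An 2 Y -> An 2 (jac X Y).
Proof. intros. apply An_minus; apply An_mul; apply An_pd; auto. Qed.

Lemma jac_comp X Y A B : An 2 X -> An 2 Y -> An 2 A -> An 2 B ->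
  zero_at_origin A -> zero_at_origin B ->
  near 2 (fun p => jac (fun p => X (pt2 (A p) (B p))) (fun p => Y (pt2 (A p) (B p))) p
    = jac X Y (pt2 (A p) (B p)) * jac A B p).
Proof.
  intros HX HY HA HB A0 B0.
  eapply near_imp2; [|apply (near_and _ _ _ (chain2 2 A B HA HB A0 B0 X 0 HX ltac:(lia))
      (chain2 2 A B HA HB A0 B0 X 1 HX ltac:(lia)))
    |apply (near_and _ _ _ (chain2 2 A B HA HB A0 B0 Y 0 HY ltac:(lia))
      (chain2 2 A B HA HB A0 B0 Y 1 HY ltac:(lia)))].
  intros p [E1 E2] [E3 E4]. unfold jac at 1. rewrite E1, E2, E3, E4. unfold jac. ring.
Qed.

Lemma jac_diffeo_neq_0 psi : diffeo_germ psi -> jac (comp1 psi) (comp2 psi) (fun _ => 0) <> 0.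
Proof.
  intros (H1 & phi & H2 & L & _). apply analytic_map_germ_An in H1, H2.
  destruct H1 as (A & B & A0 & B0), H2 as (C & D & C0 & D0).
  apply germ_eq2_map in L.
  pose proof (near_origin _ _ (jac_comp _ _ _ _ C D A B A0 B0)) as E. cbv beta in E.
  assert (L1 : (fun p => comp1 phi (pt2 (comp1 psi p) (comp2 psi p))) ~=[2] (fun p => p 0%nat)).
  { eapply near_imp; [|exact L]. intros p [Q _]. rewrite <- comp1_comp, Q. reflexivity. }
  assert (L2 : (fun p => comp2 phi (pt2 (comp1 psi p) (comp2 psi p))) ~=[2] (fun p => p 1%nat)).
  { eapply near_imp; [|exact L]. intros p [_ Q]. rewrite <- comp2_comp, Q. reflexivity. }
  pose proof (near_origin _ _ (jac_near _ _ _ _ L1 L2)) as E'. cbv beta in E'. rewrite E' in E.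
  unfold jac at 1 in E. rewrite !pd_var_eq, !pd_var_neq in E by lia.
  intros Z. rewrite Z in E. lra.
Qed.

Lemma equivalent_pairs_trans P Q T :
  equivalent_pairs P Q -> equivalent_pairs Q T -> equivalent_pairs P T.
Proof.
  intros (psi & Hpsi & E1 & E2) (phi & Hphi & E3 & E4).
  exists (fun q => psi (phi q)). split; [now apply diffeo_germ_comp|].
  destruct Hpsi as (H1 & _), Hphi as (H2 & _). apply analytic_map_germ_An in H1, H2.
  destruct H1 as (A & B & A0 & B0), H2 as (C & D & C0 & D0).
  apply germ_eq2_near in E1, E2, E3, E4.
  split; apply germ_eq2_near.
  - pose proof (near_comp2 2 _ _ C D C0 D0 _ E1) as E.
    eapply near_imp2; [|exact E|exact E3]. intros p Q1 Q2. rewrite <- Q2.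
    rewrite (lift_comp (fst Q)). rewrite <- Q1.
    rewrite (lift_comp (fun q => fst P (psi q)) phi). reflexivity.
  - pose proof (near_comp2 2 _ _ C D C0 D0 _ E2) as E.
    pose proof (jac_comp _ _ _ _ A B C D C0 D0) as J.
    eapply near_imp2; [|exact (near_and _ _ _ E E4)|exact J]. intros p [Q1 Q2] QJ.
    rewrite <- Q2, !lift_pullback2, <- Q1, lift_pullback2.
    rewrite (comp1_comp psi phi p), (comp2_comp psi phi p).
    replace (jac (comp1 (fun q => psi (phi q))) (comp2 (fun q => psi (phi q))) p) with
      (jac (fun p => comp1 psi (pt2 (comp1 phi p) (comp2 phi p)))
        (fun p => comp2 psi (pt2 (comp1 phi p) (comp2 phi p))) p).
    + rewrite QJ. ring.
    + f_equal; apply functional_extensionality; intros q; symmetry;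
        [apply comp1_comp|apply comp2_comp].
Qed.

(** Tangency to the identity provides the inverse that makes [(X, Y)] a
    diffeomorphism germ. *)
Lemma equivalent_pairs_of_germs H K w v X Y :
  An 2 X -> An 2 Y -> zero_at_origin X -> zero_at_origin Y ->
  pd 0 X (fun _ => 0) = 1 -> pd 1 X (fun _ => 0) = 0 ->
  pd 0 Y (fun _ => 0) = 0 -> pd 1 Y (fun _ => 0) = 1 ->
  near 2 (fun p => lift H (pt2 (X p) (Y p)) = lift K p) ->
  near 2 (fun p => lift w (pt2 (X p) (Y p)) * jac X Y p = lift v p) ->
  equivalent_pairs (H, w) (K, v).
Proof.
  intros HX HY X0 Y0 X1 X2 Y1 Y2 EH Ew.
  destruct (inverse2 X Y HX HY X0 Y0 X1 X2 Y1 Y2)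
    as (A & B & (HA & HB & A0 & B0) & (EX & EY) & (EA & EB)).
  destruct (map_of_germ X Y HX HY X0 Y0) as (Hpsi & CX & CY).
  destruct (map_of_germ A B HA HB A0 B0) as (Hphi & CA & CB).
  assert (HI : forall X Y A B, An 2 X -> An 2 Y -> An 2 A -> An 2 B ->
    zero_at_origin A -> zero_at_origin B ->
    comp1 (map_of X Y) ~=[2] X -> comp2 (map_of X Y) ~=[2] Y ->
    comp1 (map_of A B) ~=[2] A -> comp2 (map_of A B) ~=[2] B ->
    near 2 (fun p => X (pt2 (A p) (B p)) = p 0%nat) ->
    near 2 (fun p => Y (pt2 (A p) (B p)) = p 1%nat) ->
    germ_eq2 (fun q => map_of X Y (map_of A B q)) (fun q => q)).
  { clear. intros X Y A B HX HY HA HB A0 B0 CX CY CA CB EX EY.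
    apply germ_eq2_map.
    pose proof (near_comp2 2 A B HA HB A0 B0 _ (near_and _ _ _ CX CY)) as E1.
    eapply near_imp2; [|exact E1|apply (near_and _ _ _ (near_and _ _ _ CA CB) (near_and _ _ _ EX EY))].
    simpl. intros p [Q1 Q2] [[Q3 Q4] [Q5 Q6]].
    rewrite (comp1_comp (map_of X Y) (map_of A B)), (comp2_comp (map_of X Y) (map_of A B)).
    rewrite Q3, Q4, Q1, Q2, Q5, Q6. split; reflexivity. }
  exists (map_of X Y). split; [|split].
  - split; auto. exists (map_of A B). split; [exact Hphi|]. split; auto.
  - apply germ_eq2_near. eapply near_imp2; [|exact EH|apply (near_and _ _ _ CX CY)].
    simpl. intros p Q [Q1 Q2]. rewrite lift_comp, Q1, Q2. exact Q.
  - apply germ_eq2_near.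
    eapply near_imp2; [|exact Ew|apply (near_and _ _ _ (near_and _ _ _ CX CY) (jac_near _ _ _ _ CX CY))].
    simpl. intros p Q [[Q1 Q2] Q3]. rewrite lift_pullback2, Q1, Q2, Q3. exact Q.
Qed.

(** * Existence of the normal form *)

(** The difference is constant in the last variable.  With the time as last
    variable this proves conservation laws of flows. *)
Lemma near_eq_of_last d F G : An (S d) F -> An (S d) G ->
  near (S d) (fun p => p d = 0 -> F p = G p) -> pd d F ~=[S d] pd d G -> F ~=[S d] G.
Proof.
  intros HF HG H0 HD.
  pose proof (An_derive (S d) d F ltac:(lia) HF) as DF.
  pose proof (An_derive (S d) d G ltac:(lia) HG) as DG.
  destruct (near_and _ _ _ (near_and _ _ _ H0 HD) (near_and _ _ _ DF DG)) as (r & Hr & H).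
  exists r. split; auto. intros p Hp.
  pose proof (dom_last _ _ _ Hp) as Hpd.
  assert (Hu : forall t, Rabs t <= Rabs (p d) -> dom (S d) r (upd p d t)).
  { intros t Ht. apply dom_upd; auto. lra. }
  set (K := fun t => F (upd p d t) - G (upd p d t)).
  assert (HK : forall t, Rabs t <= Rabs (p d) -> is_derive K t 0).
  { intros t Ht. destruct (H _ (Hu t Ht)) as [[_ E] [D1 D2]].
    rewrite upd_eq in D1, D2. replace 0 with (pd d F (upd p d t) - pd d G (upd p d t)) by lra.
    apply (is_derive_minus (fun t => F (upd p d t)) (fun t => G (upd p d t))).
    - eapply is_derive_ext; [|exact D1]. intros s. simpl. now rewrite upd_upd.
    - eapply is_derive_ext; [|exact D2]. intros s. simpl. now rewrite upd_upd. }
  assert (Hm : forall t, Rmin 0 (p d) <= t <= Rmax 0 (p d) -> Rabs t <= Rabs (p d)).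
  { intros t. unfold Rmin, Rmax. destruct (Rle_dec 0 (p d)); intros [A B];
      unfold Rabs; destruct (Rcase_abs t), (Rcase_abs (p d)); lra. }
  destruct (MVT_gen K 0 (p d) (fun _ => 0)) as (c & _ & Hc).
  - intros t Ht. apply HK, Hm. lra.
  - intros t Ht. apply derivable_continuous_pt. exists 0. apply is_derive_Reals, HK, Hm, Ht.
  - assert (K0 : K 0 = 0).
    { unfold K. destruct (H (upd p d 0)) as [[Q _] _].
      - apply Hu. rewrite Rabs_R0. apply Rabs_pos.
      - rewrite Q; [ring|]. apply upd_eq. }
    unfold K in Hc at 1. rewrite upd_id in Hc. rewrite K0 in Hc. lra.
Qed.

Lemma pd_on_hyperplane d i F G : (i < d)%nat ->
  near (S d) (fun p => p d = 0 -> F p = G p) ->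
  near (S d) (fun p => p d = 0 -> pd i F p = pd i G p).
Proof.
  intros Hi H. eapply near_imp; [|apply (near_open _ _ H)].
  intros p Hp Hd. apply Derive_ext_loc.
  eapply filter_imp; [|apply (Hp i); lia]. intros t Ht. apply Ht.
  rewrite upd_neq by lia. exact Hd.
Qed.

Lemma pd_model d k eps i A B : (i < d)%nat -> An d A -> An d B ->
  pd i (fun p => B p ^ 2 + eps * A p ^ k)
  ~=[d] (fun p => 2 * B p * pd i B p + eps * INR k * A p ^ (k - 1) * pd i A p).
Proof.
  intros Hi HA HB.
  pose proof (pd_plus d i Hi (fun p => B p ^ 2) (fun p => eps * A p ^ k)
    (An_pow _ _ _ HB) (An_scal _ _ _ (An_pow _ _ _ HA))) as E1.
  pose proof (pd_scal d i Hi eps _ (An_pow d _ k HA)) as E2.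
  pose proof (pd_pow d i Hi k A HA) as E3. pose proof (pd_pow d i Hi 2 B HB) as E4.
  eapply near_imp2; [|exact (near_and _ _ _ E1 E2)|exact (near_and _ _ _ E3 E4)].
  cbv beta. intros p [-> ->] [-> ->]. replace (k - 1)%nat with (pred k) by lia. simpl. ring.
Qed.

Section Moser.
Context (k : nat) (hk : (2 <= k)%nat) (eps : R).

(** The flow [(X, Y)] of the Hamiltonian field of [H] for the standard area
    form, the time being the third coordinate, preserves [H] and the area:
    both hold at time [0], and the time derivatives agree.  Invariance of [H]
    and of the area together imply that the flow maps its own generating field
    to itself, which is the last part. *)
Lemma hamiltonian_flow : exists X Y, An 3 X /\ An 3 Y /\ zero_at_origin X /\ zero_at_origin Y /\
  near 3 (fun p => p 2%nat = 0 -> X p = p 0%nat) /\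
  near 3 (fun p => p 2%nat = 0 -> Y p = p 1%nat) /\
  pd 2 X ~=[3] (fun p => 2 * Y p) /\
  pd 2 Y ~=[3] (fun p => - (eps * INR k) * X p ^ (k - 1)) /\
  near 3 (fun p => Y p ^ 2 + eps * X p ^ k = p 1%nat ^ 2 + eps * p 0%nat ^ k) /\
  jac X Y ~=[3] (fun _ => 1) /\
  Vop k eps X ~=[3] pd 2 X /\ Vop k eps Y ~=[3] pd 2 Y.
Proof.
  set (Vf := family2 (fun p => 2 * p 1%nat) (fun p => - (eps * INR k) * p 0%nat ^ (k - 1))).
  destruct (An_flow 2 Vf) as (Phi & HPhi & Phi0 & EPhi).
  { intros i Hi. destruct i as [|[|i]]; simpl; try lia.
    - apply An_scal, An_var; lia.
    - apply An_scal, An_pow, An_var; lia. }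
  set (X := Phi 0%nat). set (Y := Phi 1%nat).
  assert (HX : An 3 X) by (apply HPhi; lia). assert (HY : An 3 Y) by (apply HPhi; lia).
  assert (X0 : zero_at_origin X) by (apply Phi0; lia).
  assert (Y0 : zero_at_origin Y) by (apply Phi0; lia).
  assert (EX0 : near 3 (fun p => p 2%nat = 0 -> X p = p 0%nat)).
  { eapply near_imp; [|exact EPhi]. intros p Hp. apply (Hp 0%nat). lia. }
  assert (EY0 : near 3 (fun p => p 2%nat = 0 -> Y p = p 1%nat)).
  { eapply near_imp; [|exact EPhi]. intros p Hp. apply (Hp 1%nat). lia. }
  assert (DX : pd 2 X ~=[3] (fun p => 2 * Y p)).
  { eapply near_imp; [|exact EPhi]. intros p Hp. apply (Hp 0%nat). lia. }
  assert (DY : pd 2 Y ~=[3] (fun p => - (eps * INR k) * X p ^ (k - 1))).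
  { eapply near_imp; [|exact EPhi]. intros p Hp. apply (Hp 1%nat). lia. }
  clear EPhi.
  assert (V0 : An 3 (fun p => p 0%nat)) by (apply An_var; lia).
  assert (V1 : An 3 (fun p => p 1%nat)) by (apply An_var; lia).
  set (HP := fun p => Y p ^ 2 + eps * X p ^ k).
  set (H3 := fun p : pt => p 1%nat ^ 2 + eps * p 0%nat ^ k).
  assert (HHP : An 3 HP) by (apply An_plus; [apply An_pow|apply An_scal, An_pow]; auto).
  assert (HH3 : An 3 H3) by (apply An_plus; [apply An_pow|apply An_scal, An_pow]; auto).
  assert (EH : HP ~=[3] H3).
  { apply near_eq_of_last; auto.
    - eapply near_imp2; [|exact EX0|exact EY0]. intros p A B Hp. unfold HP, H3.
      now rewrite A, B.
    - pose proof (pd_model 3 k eps 2 X Y ltac:(lia) HX HY) as E1.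
      pose proof (pd_model 3 k eps 2 _ _ ltac:(lia) V0 V1) as E2.
      eapply near_imp2; [|exact (near_and _ _ _ E1 E2)|exact (near_and _ _ _ DX DY)].
      cbv beta. unfold HP, H3. intros p [-> ->] [-> ->]. rewrite !pd_var_neq by lia. ring. }
  assert (PX : forall i, (i < 3)%nat -> An 3 (pd i X)) by (intros; now apply An_pd).
  assert (PY : forall i, (i < 3)%nat -> An 3 (pd i Y)) by (intros; now apply An_pd).
  set (J := jac X Y).
  assert (EJ : J ~=[3] (fun _ => 1)).
  { apply near_eq_of_last.
    - apply An_minus; apply An_mul; auto.
    - apply An_const.
    - pose proof (pd_on_hyperplane 2 0 X _ ltac:(lia) EX0) as A1.
      pose proof (pd_on_hyperplane 2 1 X _ ltac:(lia) EX0) as A2.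
      pose proof (pd_on_hyperplane 2 0 Y _ ltac:(lia) EY0) as A3.
      pose proof (pd_on_hyperplane 2 1 Y _ ltac:(lia) EY0) as A4.
      eapply near_imp2; [|exact (near_and _ _ _ A1 A2)|exact (near_and _ _ _ A3 A4)].
      intros p [B1 B2] [B3 B4] Hp. unfold J, jac. rewrite B1, B2, B3, B4 by auto.
      rewrite !pd_var_eq, !pd_var_neq by lia. ring.
    - assert (DXi : forall i, (i < 3)%nat -> pd 2 (pd i X) ~=[3] (fun p => 2 * pd i Y p)).
      { intros i Hi. pose proof (An_Schwarz 3 2 i X ltac:(lia) Hi HX) as S1.
        pose proof (pd_near 3 i _ _ Hi DX) as S2.
        pose proof (pd_scal 3 i Hi 2 Y HY) as S3.
        eapply near_trans; [exact S1|]. eapply near_trans; [exact S2|exact S3]. }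
      assert (DYi : forall i, (i < 3)%nat -> pd 2 (pd i Y) ~=[3]
        (fun p => - (eps * INR k) * (INR (k - 1) * X p ^ pred (k - 1) * pd i X p))).
      { intros i Hi. pose proof (An_Schwarz 3 2 i Y ltac:(lia) Hi HY) as S1.
        pose proof (pd_near 3 i _ _ Hi DY) as S2.
        pose proof (pd_scal 3 i Hi (- (eps * INR k)) _ (An_pow 3 X (k - 1) HX)) as S3.
        pose proof (pd_pow 3 i Hi (k - 1) X HX) as S4.
        eapply near_trans; [exact S1|]. eapply near_trans; [exact S2|].
        eapply near_trans; [exact S3|]. eapply near_imp; [|exact S4]. cbv beta. intros p ->. ring. }
      pose proof (pd_minus 3 2 ltac:(lia) _ _ (An_mul _ _ _ (PX 0%nat ltac:(lia)) (PY 1%nat ltac:(lia)))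
        (An_mul _ _ _ (PX 1%nat ltac:(lia)) (PY 0%nat ltac:(lia)))) as E1.
      pose proof (pd_mul 3 2 ltac:(lia) _ _ (PX 0%nat ltac:(lia)) (PY 1%nat ltac:(lia))) as E2.
      pose proof (pd_mul 3 2 ltac:(lia) _ _ (PX 1%nat ltac:(lia)) (PY 0%nat ltac:(lia))) as E3.
      eapply near_imp2; [|exact (near_and _ _ _ E1 (near_and _ _ _ E2 E3))
        |exact (near_and _ _ _ (near_and _ _ _ (DXi 0%nat ltac:(lia)) (DXi 1%nat ltac:(lia)))
          (near_and _ _ _ (DYi 0%nat ltac:(lia)) (DYi 1%nat ltac:(lia))))].
      cbv beta. intros p [Q1 [Q2 Q3]] [[Q4 Q5] [Q6 Q7]]. rewrite pd_const.
      unfold J, jac. rewrite Q1, Q2, Q3, Q4, Q5, Q6, Q7. ring. }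
  assert (VX : near 3 (fun p => 2 * p 1%nat * pd 0 X p - eps * INR k * p 0%nat ^ (k - 1) * pd 1 X p = pd 2 X p)
    /\ near 3 (fun p => 2 * p 1%nat * pd 0 Y p - eps * INR k * p 0%nat ^ (k - 1) * pd 1 Y p = pd 2 Y p)).
  { pose proof (pd_near 3 0 _ _ ltac:(lia) EH) as E0. pose proof (pd_near 3 1 _ _ ltac:(lia) EH) as E1.
    pose proof (pd_model 3 k eps 0 X Y ltac:(lia) HX HY) as F0.
    pose proof (pd_model 3 k eps 1 X Y ltac:(lia) HX HY) as F1.
    pose proof (pd_model 3 k eps 0 _ _ ltac:(lia) V0 V1) as G0.
    pose proof (pd_model 3 k eps 1 _ _ ltac:(lia) V0 V1) as G1.
    assert (E : near 3 (fun p =>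
      (2 * Y p * pd 0 Y p + eps * INR k * X p ^ (k - 1) * pd 0 X p = eps * INR k * p 0%nat ^ (k - 1)) /\
      (2 * Y p * pd 1 Y p + eps * INR k * X p ^ (k - 1) * pd 1 X p = 2 * p 1%nat) /\
      J p = 1 /\ pd 2 X p = 2 * Y p /\ pd 2 Y p = - (eps * INR k) * X p ^ (k - 1))).
    { eapply near_imp2; [|exact (near_and _ _ _ (near_and _ _ _ E0 E1) (near_and _ _ _ (near_and _ _ _ F0 F1) (near_and _ _ _ G0 G1)))
        |exact (near_and _ _ _ EJ (near_and _ _ _ DX DY))].
      cbv beta. unfold HP, H3. intros p [[Q0 Q1] [[R0 R1] [T0 T1]]] [U1 [U2 U3]].
      rewrite R0, T0 in Q0. rewrite R1, T1 in Q1.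
      rewrite pd_var_eq, pd_var_neq in Q0 by lia. rewrite pd_var_eq, pd_var_neq in Q1 by lia.
      repeat split; auto; lra. }
    split; (eapply near_imp; [|exact E]); cbv beta; intros p (Q0 & Q1 & QJ & QX & QY);
      rewrite <- Q0, <- Q1.
    - rewrite QX. transitivity (2 * Y p * J p); [unfold J, jac; ring|rewrite QJ; ring].
    - rewrite QY. transitivity (- (eps * INR k) * X p ^ (k - 1) * J p); [unfold J, jac; ring|rewrite QJ; ring]. }
  exists X, Y. repeat split; auto; apply VX.
Qed.

(** [W(p,t) = int_0^t w(X(p,s), Y(p,s)) ds] satisfies [V W = w(X, Y) - w]
    because the derivative along [V] of the integrand is its time derivative. *)
Lemma primitive_along_flow (X Y w : pt -> R) :
  An 3 X -> An 3 Y -> zero_at_origin X -> zero_at_origin Y ->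
  near 3 (fun p => p 2%nat = 0 -> X p = p 0%nat) ->
  near 3 (fun p => p 2%nat = 0 -> Y p = p 1%nat) ->
  Vop k eps X ~=[3] pd 2 X -> Vop k eps Y ~=[3] pd 2 Y ->
  An 2 w -> (forall p : pt, w p = w (pt2 (p 0%nat) (p 1%nat))) ->
  exists W, An 3 W /\ (forall p, p 2%nat = 0 -> W p = 0) /\
    pd 2 W ~=[3] (fun p => w (pt2 (X p) (Y p))) /\
    Vop k eps W ~=[3] (fun p => w (pt2 (X p) (Y p)) - w p).
Proof.
  intros HX HY X0 Y0 EX0 EY0 VX VY Hw wE. unfold Vop in VX, VY |- *.
  assert (V0 : An 3 (fun p => p 0%nat)) by (apply An_var; lia).
  assert (V1 : An 3 (fun p => p 1%nat)) by (apply An_var; lia).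
  set (wP := fun p => w (pt2 (X p) (Y p))).
  assert (HwP : An 3 wP) by (apply An_comp2; auto).
  set (W := prim 2 wP).
  destruct (An_prim 2 wP HwP) as [HW DW]. fold W in HW, DW.
  assert (W0 : forall p, p 2%nat = 0 -> W p = 0) by (intros; now apply prim_zero).
  assert (VwP : near 3 (fun p => 2 * p 1%nat * pd 0 wP p - eps * INR k * p 0%nat ^ (k - 1) * pd 1 wP p = pd 2 wP p)).
  { pose proof (chain2 3 X Y HX HY X0 Y0 w 0 Hw ltac:(lia)) as C0.
    pose proof (chain2 3 X Y HX HY X0 Y0 w 1 Hw ltac:(lia)) as C1.
    pose proof (chain2 3 X Y HX HY X0 Y0 w 2 Hw ltac:(lia)) as C2.
    eapply near_imp2; [|exact (near_and _ _ _ C0 (near_and _ _ _ C1 C2))|exact (near_and _ _ _ VX VY)].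
    cbv beta. fold wP. intros p [Q0 [Q1 Q2]] [Q3 Q4].
    rewrite Q0, Q1, Q2, <- Q3, <- Q4. ring. }
  assert (PW : forall i, (i < 3)%nat -> An 3 (pd i W)) by (intros; now apply An_pd).
  assert (w3 : An 3 w).
  { destruct Hw as (r & M & Hr & Hw). exists r, M. split; auto. apply anorm_weaken; auto. lra. }
  assert (VW : near 3 (fun p => 2 * p 1%nat * pd 0 W p - eps * INR k * p 0%nat ^ (k - 1) * pd 1 W p
    = wP p - w p)).
  { apply near_eq_of_last.
    - apply An_minus; apply An_mul; auto.
      + apply An_scal; auto.
      + apply An_scal, An_pow; auto.
    - apply An_minus; auto.
    - assert (WZ : near 3 (fun p => p 2%nat = 0 -> W p = (fun _ => 0) p)) by (apply near_all; auto).
      pose proof (pd_on_hyperplane 2 0 W _ ltac:(lia) WZ) as A0.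
      pose proof (pd_on_hyperplane 2 1 W _ ltac:(lia) WZ) as A1.
      eapply near_imp2; [|exact (near_and _ _ _ A0 A1)|exact (near_and _ _ _ EX0 EY0)].
      intros p [Q0 Q1] [Q2 Q3] Hp. rewrite Q0, Q1 by auto. rewrite !pd_const. unfold wP.
      rewrite Q2, Q3 by auto. rewrite <- wE. ring.
    - pose proof (pd_minus 3 2 ltac:(lia) wP w HwP w3) as E1.
      assert (E2 : pd 2 (fun p => 2 * p 1%nat * pd 0 W p - eps * INR k * p 0%nat ^ (k - 1) * pd 1 W p)
        ~=[3] (fun p => 2 * p 1%nat * pd 2 (pd 0 W) p - eps * INR k * p 0%nat ^ (k - 1) * pd 2 (pd 1 W) p)).
      { apply near_pd_eq.
        eapply near_imp2; [|exact (An_derive 3 2 _ ltac:(lia) (PW 0%nat ltac:(lia)))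
          |exact (An_derive 3 2 _ ltac:(lia) (PW 1%nat ltac:(lia)))].
        intros p D0 D1.
        apply (is_derive_minus (fun t => 2 * p 1%nat * pd 0 W (upd p 2 t))
          (fun t => eps * INR k * p 0%nat ^ (k - 1) * pd 1 W (upd p 2 t))).
        - apply (is_derive_scal (fun t => pd 0 W (upd p 2 t)) _ (2 * p 1%nat) _ D0).
        - apply (is_derive_scal (fun t => pd 1 W (upd p 2 t)) _ (eps * INR k * p 0%nat ^ (k - 1)) _ D1). }
      pose proof (An_Schwarz 3 2 0 W ltac:(lia) ltac:(lia) HW) as S0.
      pose proof (An_Schwarz 3 2 1 W ltac:(lia) ltac:(lia) HW) as S1.
      pose proof (pd_near 3 0 _ _ ltac:(lia) DW) as T0.
      pose proof (pd_near 3 1 _ _ ltac:(lia) DW) as T1.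
      assert (Z : forall p, pd 2 w p = 0).
      { intros p. unfold pd. rewrite (Derive_ext _ (fun _ => w p)); [apply Derive_const|].
        intros t. rewrite (wE (upd p 2 t)), (wE p). reflexivity. }
      eapply near_imp2; [|exact (near_and _ _ _ E1 (near_and _ _ _ E2 VwP))
        |exact (near_and _ _ _ (near_and _ _ _ S0 S1) (near_and _ _ _ T0 T1))].
      cbv beta. intros p [Q1 [Q2 Q3]] [[R0 R1] [U0 U1]].
      rewrite Q1, Q2, Z, R0, R1, U0, U1, Q3. ring. }
  exists W. auto.
Qed.

(** Let [Phi] be the flow of [V] and [W] the primitive of [w] along its orbits.
    For a germ [tau] put [psi(p) = Phi(p, tau(p))].  This map preserves [H], its
    Jacobian is [1 + V tau], and [V (W(p, tau(p))) = w(psi) (1 + V tau) - w].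
    Hence solving [W(p, tau(p)) = eta(p) - eta(0)] gives
    [psi^* w - w = V eta]. *)
Theorem moser (w : R * R -> R) (v : R * R -> R) (eta : pt -> R) :
  analytic2 w -> w (0, 0) <> 0 -> An 2 eta ->
  near 2 (fun p => lift w p + Vop k eps eta p = lift v p) ->
  equivalent_pairs (A_model k eps, w) (A_model k eps, v).
Proof.
  intros Hw w0 Heta Hv. apply analytic2_An in Hw.
  destruct hamiltonian_flow as (X & Y & HX & HY & X0 & Y0 & EX0 & EY0 & DX & DY & EH & EJ & VX & VY).
  destruct (primitive_along_flow X Y (lift w) HX HY X0 Y0 EX0 EY0 VX VY Hw) as (W & HW & W0 & DW & VW);
    [reflexivity|].
  set (wP := fun p => lift w (pt2 (X p) (Y p))).
  change (pd 2 W ~=[3] wP) in DW.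
  change (Vop k eps W ~=[3] (fun p => wP p - lift w p)) in VW.
  unfold Vop in VX, VY, VW.
  (* [d W / d t = w] does not vanish at the origin, so that the equation
     [W(p, tau) = eta(p) - eta(0)] for [tau] is of the fixed point form
     [tau = (eta(p) - eta(0)) / c + (tau - W(p, tau) / c)] with [c = w(0)].
     The first two unknowns are only there to carry the coordinates of [p]. *)
  set (c := lift w (fun _ => 0)).
  assert (Hc : c <> 0) by exact w0.
  assert (wP0 : wP (fun _ => 0) = c).
  { unfold wP. rewrite X0, Y0, pt2_0. reflexivity. }
  set (e0 := eta (fun _ => 0)).
  set (fam3 := fun F0 F1 F2 : pt -> R => fun i => match i with 0%nat => F0 | 1%nat => F1 | 2%nat => F2 | _ => fun _ => 0 end).
  assert (DW0 : forall j, (j < 3)%nat -> pd j W (fun _ => 0) = if Nat.eqb j 2 then c else 0).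
  { assert (WZ : near 3 (fun p => p 2%nat = 0 -> W p = (fun _ => 0) p)) by (apply near_all; auto).
    intros [|[|[|j]]] Hj; simpl; try lia.
    - rewrite (near_origin _ _ (pd_on_hyperplane 2 0 W _ ltac:(lia) WZ)) by reflexivity. apply pd_const.
    - rewrite (near_origin _ _ (pd_on_hyperplane 2 1 W _ ltac:(lia) WZ)) by reflexivity. apply pd_const.
    - rewrite (near_origin _ _ DW). exact wP0. }
  destruct (An_implicit 3 1 (fam3 (fun _ => 0) (fun _ => 0) (fun p => p 2%nat - / c * W p))
    (fam3 (fun p => p 0%nat) (fun p => p 1%nat) (fun p => / c * (eta p - e0)))) as (G & HG & G0 & EG).
  - intros [|[|[|i]]] Hi; simpl; try lia; try apply An_const.
    apply An_minus; [apply An_var; lia|apply An_scal; auto].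
  - intros [|[|[|i]]] Hi; simpl; try lia; auto. rewrite W0 by auto. ring.
  - intros [|[|[|i]]] j Hi Hj; simpl; try lia; try apply pd_const.
    pose proof (near_origin _ _ (pd_minus 3 j Hj _ _ (An_var 3 2 ltac:(lia)) (An_scal 3 (/ c) _ HW))) as E1.
    pose proof (near_origin _ _ (pd_scal 3 j Hj (/ c) _ HW)) as E2. cbv beta in E1, E2.
    rewrite E1, E2, DW0 by auto. destruct (Nat.eqb_spec j 2) as [->|Hne].
    + rewrite pd_var_eq. field. auto.
    + rewrite pd_var_neq by auto. ring.
  - intros [|[|[|i]]] Hi; simpl; try lia; try (apply An_var; lia).
    apply An_scal, An_minus; auto. apply An_const.
  - intros [|[|[|i]]] Hi; simpl; try lia; auto. unfold e0. ring.
  - set (tau := G 2%nat). assert (Htau : An 2 tau) by (apply HG; lia).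
    assert (tau0 : zero_at_origin tau) by (apply G0; lia).
    set (g := fam3 (fun p => p 0%nat) (fun p => p 1%nat) tau).
    assert (Hg : forall i, (i < 3)%nat -> An 2 (g i)).
    { intros [|[|[|i]]] Hi; simpl; try lia; auto; apply An_var; lia. }
    assert (g0 : forall i, (i < 3)%nat -> g i (fun _ => 0) = 0).
    { intros [|[|[|i]]] Hi; simpl; auto. }
    set (gp := fun p i => g i p).
    assert (EGg : near 2 (fun p => (forall i, (i < 3)%nat -> G i p = g i p) /\ W (gp p) = eta p - e0)).
    { eapply near_imp2; [|exact EG|apply (near_comp 3 2 G HG G0 _ (An_local 3 W HW))].
      intros p A B.
      assert (Ei : forall i, (i < 3)%nat -> G i p = g i p).
      { intros [|[|[|i]]] Hi; simpl; try lia; auto.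
        - specialize (A 0%nat ltac:(lia)). simpl in A. lra.
        - specialize (A 1%nat ltac:(lia)). simpl in A. lra. }
      split; auto. rewrite <- (B (gp p)) by auto.
      specialize (A 2%nat ltac:(lia)). simpl in A.
      assert (Q : / c * W (fun j => G j p) = / c * (eta p - e0)) by lra.
      apply Rmult_eq_reg_l with (/ c); auto. now apply Rinv_neq_0_compat. }
    assert (EW : (fun p => W (gp p)) ~=[2] (fun p => eta p - e0)).
    { eapply near_imp; [|exact EGg]. intros p [_ Q]. exact Q. }
    set (A := fun p => X (gp p)). set (B := fun p => Y (gp p)).
    assert (HA : An 2 A) by (apply (An_comp 3 2 g Hg g0); auto).
    assert (HB : An 2 B) by (apply (An_comp 3 2 g Hg g0); auto).
    assert (chain : forall F j, An 3 F -> (j < 2)%nat -> near 2 (fun p =>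
      pd j (fun p => F (gp p)) p = pd j F (gp p) + pd 2 F (gp p) * pd j tau p)).
    { intros F j HF Hj. eapply near_imp; [|apply (An_chain 3 2 g Hg g0 F j HF Hj)].
      intros p Q. unfold gp in *. rewrite Q. simpl psum. fold tau.
      destruct j as [|[|j]]; [| |lia]; rewrite ?pd_var_eq, ?pd_var_neq by lia; simpl; ring. }
    assert (gp0 : gp (fun _ => 0) = fun _ => 0).
    { apply functional_extensionality. intros [|[|[|i]]]; try reflexivity. exact tau0. }
    assert (A0 : zero_at_origin A) by (unfold zero_at_origin, A; rewrite gp0; exact X0).
    assert (B0 : zero_at_origin B) by (unfold zero_at_origin, B; rewrite gp0; exact Y0).
    assert (Vz : (fun _ : nat => 0) 0%nat ^ (k - 1) = 0).
    { destruct k as [|[|k']]; try lia. simpl. ring. }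
    assert (A1 : forall j, (j < 2)%nat -> pd j A (fun _ => 0) = pd j (fun p => p 0%nat) (fun _ => 0)).
    { intros j Hj. pose proof (near_origin _ _ (chain X j HX Hj)) as Q. cbv beta in Q. rewrite gp0 in Q.
      unfold A. rewrite Q, (near_origin _ _ DX), Y0.
      rewrite (near_origin _ _ (pd_on_hyperplane 2 j X _ Hj EX0)) by reflexivity. ring. }
    assert (B1 : forall j, (j < 2)%nat -> pd j B (fun _ => 0) = pd j (fun p => p 1%nat) (fun _ => 0)).
    { intros j Hj. pose proof (near_origin _ _ (chain Y j HY Hj)) as Q. cbv beta in Q. rewrite gp0 in Q.
      unfold B. rewrite Q, (near_origin _ _ DY), X0, Vz.
      rewrite (near_origin _ _ (pd_on_hyperplane 2 j Y _ Hj EY0)) by reflexivity. ring. }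
    apply equivalent_pairs_of_germs with A B; auto.
    + rewrite A1 by lia. apply pd_var_eq.
    + rewrite A1 by lia. apply pd_var_neq. lia.
    + rewrite B1 by lia. apply pd_var_neq. lia.
    + rewrite B1 by lia. apply pd_var_eq.
    + pose proof (near_comp 3 2 g Hg g0 _ EH) as E. eapply near_imp; [|exact E].
      intros p Q. exact Q.
    + pose proof (near_comp 3 2 g Hg g0 _ VX) as EVX. pose proof (near_comp 3 2 g Hg g0 _ VY) as EVY.
      pose proof (near_comp 3 2 g Hg g0 _ EJ) as EJg. pose proof (near_comp 3 2 g Hg g0 _ VW) as EVW.
      pose proof (near_comp 3 2 g Hg g0 _ DW) as EDW.
      pose proof (near_and _ _ _ (chain X 0%nat HX ltac:(lia)) (chain X 1%nat HX ltac:(lia))) as CX.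
      pose proof (near_and _ _ _ (chain Y 0%nat HY ltac:(lia)) (chain Y 1%nat HY ltac:(lia))) as CY.
      pose proof (near_and _ _ _ (chain W 0%nat HW ltac:(lia)) (chain W 1%nat HW ltac:(lia))) as CW.
      pose proof (near_and _ _ _ (pd_near 2 0 _ _ ltac:(lia) EW) (pd_near 2 1 _ _ ltac:(lia) EW)) as EW'.
      pose proof (near_and _ _ _ (pd_minus 2 0 ltac:(lia) eta _ Heta (An_const 2 e0))
        (pd_minus 2 1 ltac:(lia) eta _ Heta (An_const 2 e0))) as EE.
      eapply near_imp2; [|exact (near_and _ _ _ (near_and _ _ _ (near_and _ _ _ EVX EVY) (near_and _ _ _ EJg EVW)) (near_and _ _ _ EDW Hv))
        |exact (near_and _ _ _ (near_and _ _ _ CX CY) (near_and _ _ _ CW (near_and _ _ _ EW' EE)))].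
      cbv beta. intros p [[[Q1 Q2] [Q3 Q4]] [Q5 Q6]] [[[C1 C2] [C3 C4]] [[C5 C6] [[D1 D2] [D3 D4]]]].
      fold (gp p) in Q1, Q2, Q3, Q4, Q5.
      change (g 0%nat p) with (p 0%nat) in Q1, Q2, Q4. change (g 1%nat p) with (p 1%nat) in Q1, Q2, Q4.
      change (lift w (gp p)) with (lift w p) in Q4.
      change (lift w (pt2 (A p) (B p))) with (wP (gp p)).
      (* [Q6] becomes [v = w + V eta] with the derivatives of [eta] replaced by
         those of [W] and [tau], so that only [VW] remains to be used. *)
      rewrite D3, C5, pd_const in D1. rewrite D4, C6, pd_const in D2. rewrite Q5 in D1, D2.
      rewrite <- Q6. unfold Vop.
      replace (pd 0 eta p) with (pd 0 W (gp p) + wP (gp p) * pd 0 tau p) by lra.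
      replace (pd 1 eta p) with (pd 1 W (gp p) + wP (gp p) * pd 1 tau p) by lra.
      assert (EJac : jac A B p = 1 + (2 * p 1%nat * pd 0 tau p - eps * INR k * p 0%nat ^ (k - 1) * pd 1 tau p)).
      { unfold jac, A, B. rewrite C1, C2, C3, C4, <- Q1, <- Q2.
        transitivity (jac X Y (gp p) * (1 + (2 * p 1%nat * pd 0 tau p - eps * INR k * p 0%nat ^ (k - 1) * pd 1 tau p))).
        - unfold jac. ring.
        - rewrite Q3. ring. }
      rewrite EJac.
      replace (lift w p) with (wP (gp p) - (2 * p 1%nat * pd 0 W (gp p) - eps * INR k * p 0%nat ^ (k - 1) * pd 1 W (gp p))) by lra.
      ring.
Qed.
End Moser.

Lemma lift_normal_form k eps f p :
  lift (snd (normal_form k eps f)) p = Derive (nf_fun k f) (p 0%nat).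
Proof.
  unfold normal_form, ext_d, lift, dx, dxi. simpl.
  rewrite Derive_const, Rminus_0_r. apply Derive_ext. reflexivity.
Qed.

Lemma An_nf_term k i (h : R -> R) e : (1 <= k)%nat -> (1 <= e)%nat -> analytic1 h ->
  An e (fun p => h (p 0%nat ^ k)) /\ An e (fun p => p 0%nat ^ i * h (p 0%nat ^ k)).
Proof.
  intros hk he Hh. apply analytic1_An in Hh.
  assert (H : An e (fun p => h (p 0%nat ^ k))).
  { apply (An_comp 1 e (fun _ p => p 0%nat ^ k)) with (F := fun p => h (p 0%nat)); auto.
    - intros _ _. apply An_pow, An_var. lia.
    - intros _ _. apply pow_i. lia. }
  split; auto. apply An_mul; auto. apply An_pow, An_var. lia.
Qed.

Lemma An_nf_fun k f e : (2 <= k)%nat -> (1 <= e)%nat ->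
  (forall i, (1 <= i <= k - 1)%nat -> analytic1 (f i)) ->
  An e (fun p => nf_fun k f (p 0%nat)).
Proof.
  intros hk he Hf.
  apply An_ext with (fun p => sum_n (fun j => p 0%nat ^ S j * f (S j) (p 0%nat ^ k)) (k - 2)).
  - apply (An_sum_n e (k - 2) (fun j p => p 0%nat ^ S j * f (S j) (p 0%nat ^ k))).
    intros i Hi. apply An_nf_term; try lia. apply Hf. lia.
  - apply near_all. intros p. symmetry. now apply nf_fun_sum_n.
Qed.

Lemma Derive_nf_fun_0 k f : (2 <= k)%nat ->
  (forall i, (1 <= i <= k - 1)%nat -> analytic1 (f i)) ->
  Derive (nf_fun k f) 0 = f 1%nat 0.
Proof.
  intros hk Hf.
  transitivity (pd 0 (fun p => nf_fun k f (p 0%nat)) (fun _ => 0)); [reflexivity|].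
  transitivity (pd 0 (fun p => sum_n (fun j => p 0%nat ^ S j * f (S j) (p 0%nat ^ k)) (k - 2)) (fun _ => 0)).
  { apply pd_feq. intros q. now apply nf_fun_sum_n. }
  assert (HA : forall j, (j <= k - 2)%nat -> An 1 (fun p => f (S j) (p 0%nat ^ k)) /\
    An 1 (fun p => p 0%nat ^ S j * f (S j) (p 0%nat ^ k))).
  { intros j Hj. apply An_nf_term; try lia. apply Hf. lia. }
  pose proof (near_origin _ _ (pd_sum_n 1 0 (k - 2)
    (fun j p => p 0%nat ^ S j * f (S j) (p 0%nat ^ k)) ltac:(lia) (fun j Hj => proj2 (HA j Hj)))) as E.
  cbv beta in E. rewrite E.
  rewrite (sum_n_ext_R _ (fun j => if Nat.eqb 0 j then (fun j => f (S j) 0) j else 0)).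
  - apply (sum_n_pick (fun j => f (S j) 0) 0). lia.
  - intros j Hj.
    pose proof (near_origin _ _ (pd_mul 1 0 ltac:(lia) _ _ (An_pow 1 _ (S j) (An_var 1 0 ltac:(lia)))
      (proj1 (HA j Hj)))) as E1.
    pose proof (near_origin _ _ (pd_pow 1 0 ltac:(lia) (S j) _ (An_var 1 0 ltac:(lia)))) as E2.
    cbv beta in E1, E2. rewrite E1, E2, pd_var_eq, (pow_i (S j)), (pow_i k) by lia.
    destruct j as [|j]; simpl Nat.eqb; cbv iota.
    + simpl. ring.
    + simpl pred. rewrite pow_i by lia. ring.
Qed.

Lemma Vop_origin k eps eta : (2 <= k)%nat -> Vop k eps eta (fun _ => 0) = 0.
Proof. intros hk. unfold Vop. rewrite pow_i by lia. ring. Qed.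

(** The reduction gives [f' = w - V eta] for the form [w] in coordinates where
    [H] is [xi^2 + eps x^k]. *)
Theorem existence_normal_form (k : nat) (eps : R) (H : R * R -> R) (w : two_form) :
  (2 <= k)%nat -> eps = 1 \/ eps = -1 ->
  symplectic_germ w -> has_A_singularity k eps H ->
  exists f, nf_params k f /\ equivalent_pairs (H, w) (normal_form k eps f).
Proof.
  intros hk heps [Hw w0] (psi & Hpsi & EH).
  set (w1 := pullback2 psi w).
  pose proof Hpsi as (Hpsi' & _). apply analytic_map_germ_An in Hpsi'.
  destruct Hpsi' as (A & B & A0 & B0).
  assert (Hw1 : analytic2 w1).
  { apply analytic2_An.
    apply An_ext with (fun p => lift w (pt2 (comp1 psi p) (comp2 psi p)) * jac (comp1 psi) (comp2 psi) p).
    - apply An_mul; [|now apply jac_An]. apply An_comp2; auto. now apply analytic2_An.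
    - apply near_all. intros p. symmetry. apply lift_pullback2. }
  assert (w10 : lift w1 (fun _ => 0) <> 0).
  { unfold w1. rewrite lift_pullback2, A0, B0, pt2_0.
    apply Rmult_integral_contrapositive_currified; [exact w0|]. now apply jac_diffeo_neq_0. }
  destruct (reduction k eps w1 hk heps Hw1) as (f & eta & Hf & Heta & E).
  exists f.
  pose proof (near_origin _ _ E) as E0. cbv beta in E0.
  rewrite Vop_origin, Rplus_0_r, Derive_nf_fun_0 in E0 by auto.
  split.
  - split; auto. rewrite <- E0. exact w10.
  - apply equivalent_pairs_trans with (A_model k eps, w1).
    + exists psi. split; auto. split; [exact EH|].
      unfold germ_eq2. apply filter_forall. reflexivity.
    + apply moser with (eta := fun p => -1 * eta p); auto.
      * now apply An_scal.
      * pose proof (pd_scal 2 0 ltac:(lia) (-1) eta Heta) as D0.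
        pose proof (pd_scal 2 1 ltac:(lia) (-1) eta Heta) as D1.
        eapply near_imp2; [|exact E|exact (near_and _ _ _ D0 D1)].
        cbv beta. intros p Q [Q0 Q1].
        change (lift (ext_d (fun _ => 0, fun p => nf_fun k f (fst p))) p)
          with (lift (snd (normal_form k eps f)) p).
        rewrite lift_normal_form. unfold Vop in *. rewrite Q, Q0, Q1. ring.
Qed.

(** * Taylor coefficients in the plane *)

Definition iterpd (i n : nat) (F : pt -> R) : pt -> R := Nat.iter n (pd i) F.

Lemma iterpd_An i n F : (i < 2)%nat -> An 2 F -> An 2 (iterpd i n F).
Proof. intros Hi HF. induction n; simpl; auto. now apply An_pd. Qed.

Lemma iterpd_near i n F G : (i < 2)%nat -> F ~=[2] G -> iterpd i n F ~=[2] iterpd i n G.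
Proof. intros Hi H. induction n; simpl; auto. now apply pd_near. Qed.

Lemma iterpd_plus i n F G : (i < 2)%nat -> An 2 F -> An 2 G ->
  iterpd i n (fun p : pt => F p + G p) ~=[2] (fun p : pt => iterpd i n F p + iterpd i n G p).
Proof.
  intros Hi HF HG. induction n; simpl; [now apply near_all|].
  eapply near_trans; [apply (pd_near 2 i _ _ Hi IHn)|].
  apply pd_plus; auto; now apply iterpd_An.
Qed.

Lemma iterpd_scal i n c F : (i < 2)%nat -> An 2 F ->
  iterpd i n (fun p : pt => c * F p) ~=[2] (fun p : pt => c * iterpd i n F p).
Proof.
  intros Hi HF. induction n; simpl; [now apply near_all|].
  eapply near_trans; [apply (pd_near 2 i _ _ Hi IHn)|].
  apply pd_scal; auto; now apply iterpd_An.
Qed.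

Lemma iterpd_mul_var_neq i j n F : (i < 2)%nat -> (j < 2)%nat -> j <> i -> An 2 F ->
  iterpd i n (fun p : pt => p j * F p) ~=[2] (fun p : pt => p j * iterpd i n F p).
Proof.
  intros Hi Hj Hne HF. induction n; simpl; [now apply near_all|].
  eapply near_trans; [apply (pd_near 2 i _ _ Hi IHn)|].
  eapply near_imp; [|apply (pd_mul 2 i Hi (fun p : pt => p j) (iterpd i n F));
    [now apply An_var|now apply iterpd_An]].
  simpl. intros p ->. rewrite pd_var_neq by auto. fold (iterpd i n F). ring.
Qed.

Lemma iterpd_mul_var i n F : (i < 2)%nat -> An 2 F ->
  iterpd i n (fun p : pt => p i * F p)
  ~=[2] (fun p : pt => p i * iterpd i n F p + INR n * iterpd i (pred n) F p).
Proof.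
  intros Hi HF. induction n as [|n IH].
  - apply near_all. intros p. simpl. ring.
  - eapply near_trans; [apply (pd_near 2 i _ _ Hi IH)|].
    assert (A1 : An 2 (fun p : pt => p i * iterpd i n F p))
      by (apply An_mul; [now apply An_var|now apply iterpd_An]).
    assert (A2 : An 2 (fun p : pt => INR n * iterpd i (pred n) F p))
      by (apply An_scal; now apply iterpd_An).
    pose proof (pd_plus 2 i Hi _ _ A1 A2) as E1.
    pose proof (pd_mul 2 i Hi (fun p : pt => p i) (iterpd i n F) (An_var 2 i Hi) (iterpd_An i n F Hi HF)) as E2.
    pose proof (pd_scal 2 i Hi (INR n) _ (iterpd_An i (pred n) F Hi HF)) as E3.
    eapply near_imp2; [|exact E1|exact (near_and _ _ _ E2 E3)].
    cbv beta. intros p -> [-> ->]. rewrite pd_var_eq, S_INR. simpl pred.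
    change (pd i (iterpd i n F) p) with (iterpd i (S n) F p).
    destruct n as [|n].
    + simpl. ring.
    + simpl pred. change (pd i (iterpd i n F) p) with (iterpd i (S n) F p). ring.
Qed.

Lemma iterpd_comm i j n F : (i < 2)%nat -> (j < 2)%nat -> An 2 F ->
  iterpd i n (pd j F) ~=[2] pd j (iterpd i n F).
Proof.
  intros Hi Hj HF. induction n; simpl; [now apply near_all|].
  eapply near_trans; [apply (pd_near 2 i _ _ Hi IHn)|].
  apply An_Schwarz; auto. now apply iterpd_An.
Qed.

Lemma iterpd_pd i n F : iterpd i n (pd i F) = iterpd i (S n) F.
Proof. unfold iterpd. induction n; simpl; auto. simpl in IHn. now rewrite IHn. Qed.

Definition coeff (a b : nat) (F : pt -> R) : R :=
  iterpd 1 b (iterpd 0 a F) (fun _ => 0) / (INR (fact a) * INR (fact b)).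

Lemma coeff_near a b F G : F ~=[2] G -> coeff a b F = coeff a b G.
Proof.
  intros H. unfold coeff. f_equal.
  apply (near_origin 2). apply iterpd_near; [lia|]. apply iterpd_near; auto.
Qed.

Lemma coeff_plus a b F G : An 2 F -> An 2 G -> coeff a b (fun p : pt => F p + G p) = coeff a b F + coeff a b G.
Proof.
  intros HF HG. unfold coeff. rewrite <- Rdiv_plus_distr. f_equal.
  apply (near_origin 2 (fun p : pt => _ p = _ p + _ p)).
  eapply near_trans; [apply iterpd_near; [lia|apply iterpd_plus; auto]|].
  apply iterpd_plus; auto; apply iterpd_An; auto.
Qed.

Lemma coeff_scal a b c F : An 2 F -> coeff a b (fun p : pt => c * F p) = c * coeff a b F.
Proof.
  intros HF. unfold coeff, Rdiv. rewrite <- Rmult_assoc. f_equal.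
  apply (near_origin 2 (fun p : pt => _ p = c * _ p)).
  eapply near_trans; [apply iterpd_near; [lia|apply iterpd_scal; auto]|].
  apply iterpd_scal; auto; apply iterpd_An; auto.
Qed.

Lemma coeff_x_S a b F : An 2 F -> coeff (S a) b (fun p : pt => p 0%nat * F p) = coeff a b F.
Proof.
  intros HF. unfold coeff.
  assert (E : iterpd 1 b (iterpd 0 (S a) (fun p : pt => p 0%nat * F p)) (fun _ => 0)
    = INR (S a) * iterpd 1 b (iterpd 0 a F) (fun _ => 0)).
  { assert (H1 := iterpd_mul_var 0 (S a) F ltac:(lia) HF).
    apply (iterpd_near 1 b _ _ ltac:(lia)) in H1.
    assert (HA : An 2 (iterpd 0 (S a) F)) by (apply iterpd_An; auto).
    assert (HB : An 2 (iterpd 0 a F)) by (apply iterpd_An; auto).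
    assert (H2 := iterpd_plus 1 b (fun p : pt => p 0%nat * iterpd 0 (S a) F p)
      (fun p : pt => INR (S a) * iterpd 0 a F p) ltac:(lia)
      (An_mul _ _ _ (An_var 2 0 ltac:(lia)) HA) (An_scal _ _ _ HB)).
    assert (H3 := iterpd_mul_var_neq 1 0 b _ ltac:(lia) ltac:(lia) ltac:(lia) HA).
    assert (H4 := iterpd_scal 1 b (INR (S a)) _ ltac:(lia) HB).
    change (pred (S a)) with a in H1. cbv beta in H2.
    etransitivity; [apply (near_origin _ _ H1)|].
    etransitivity; [apply (near_origin _ _ H2)|]. cbv beta.
    rewrite (near_origin _ _ H3), (near_origin _ _ H4). ring. }
  rewrite E, fact_simpl, mult_INR. field. repeat split; try apply INR_fact_neq_0.
  apply not_0_INR. lia.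
Qed.

Lemma coeff_x_0 b F : An 2 F -> coeff 0 b (fun p : pt => p 0%nat * F p) = 0.
Proof.
  intros HF. unfold coeff. simpl iterpd.
  rewrite (near_origin _ _ (iterpd_mul_var_neq 1 0 b F ltac:(lia) ltac:(lia) ltac:(lia) HF)).
  unfold Rdiv. ring.
Qed.

Lemma coeff_xi_S a b F : An 2 F -> coeff a (S b) (fun p : pt => p 1%nat * F p) = coeff a b F.
Proof.
  intros HF. unfold coeff.
  assert (E : iterpd 1 (S b) (iterpd 0 a (fun p : pt => p 1%nat * F p)) (fun _ => 0)
    = INR (S b) * iterpd 1 b (iterpd 0 a F) (fun _ => 0)).
  { assert (H1 := iterpd_mul_var_neq 0 1 a F ltac:(lia) ltac:(lia) ltac:(lia) HF).
    apply (iterpd_near 1 (S b) _ _ ltac:(lia)) in H1.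
    assert (HA : An 2 (iterpd 0 a F)) by (apply iterpd_An; auto).
    assert (H2 := iterpd_mul_var 1 (S b) _ ltac:(lia) HA).
    rewrite (near_origin _ _ H1), (near_origin _ _ H2). simpl pred. ring. }
  rewrite E, (fact_simpl b), mult_INR. field. repeat split; try apply INR_fact_neq_0.
  apply not_0_INR. lia.
Qed.

Lemma coeff_xi_0 a F : An 2 F -> coeff a 0 (fun p : pt => p 1%nat * F p) = 0.
Proof.
  intros HF. unfold coeff. simpl iterpd at 1.
  rewrite (near_origin _ _ (iterpd_mul_var_neq 0 1 a F ltac:(lia) ltac:(lia) ltac:(lia) HF)).
  unfold Rdiv. ring.
Qed.

Lemma coeff_pd0 a b F : coeff a b (pd 0 F) = INR (S a) * coeff (S a) b F.
Proof.
  unfold coeff. rewrite iterpd_pd, (fact_simpl a), mult_INR. field.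
  repeat split; try apply INR_fact_neq_0. apply not_0_INR. lia.
Qed.

Lemma coeff_pd1 a b F : An 2 F -> coeff a b (pd 1 F) = INR (S b) * coeff a (S b) F.
Proof.
  intros HF. unfold coeff.
  assert (H1 := iterpd_comm 0 1 a F ltac:(lia) ltac:(lia) HF).
  apply (iterpd_near 1 b _ _ ltac:(lia)) in H1.
  rewrite (near_origin _ _ H1), iterpd_pd, (fact_simpl b), mult_INR. field.
  repeat split; try apply INR_fact_neq_0. apply not_0_INR. lia.
Qed.

Lemma coeff_0_0 F : coeff 0 0 F = F (fun _ => 0).
Proof. unfold coeff. simpl. field. Qed.

Lemma coeff_xpow_add n a b F : An 2 F -> coeff (n + a) b (fun p : pt => p 0%nat ^ n * F p) = coeff a b F.
Proof.
  intros HF. induction n as [|n IH].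
  - apply coeff_near, near_all. intros; simpl; ring.
  - rewrite <- IH, <- (coeff_x_S (n + a)).
    + apply coeff_near, near_all. intros; simpl; ring.
    + apply An_mul; auto. apply An_pow, An_var. lia.
Qed.

Lemma coeff_xpow_lt n a b F : An 2 F -> (a < n)%nat -> coeff a b (fun p : pt => p 0%nat ^ n * F p) = 0.
Proof.
  intros HF. revert a. induction n as [|n IH]; intros a Ha; [lia|].
  assert (HA : An 2 (fun p : pt => p 0%nat ^ n * F p)) by (apply An_mul; auto; apply An_pow, An_var; lia).
  transitivity (coeff a b (fun p : pt => p 0%nat * (p 0%nat ^ n * F p))).
  { apply coeff_near, near_all. intros; simpl; ring. }
  destruct a as [|a]; [now apply coeff_x_0|]. rewrite coeff_x_S by auto. apply IH. lia.
Qed.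

(** Membership in the [N]-th power of the maximal ideal, the order of vanishing
    being expressed by factors so that products are immediate. *)
Fixpoint ord (N : nat) (F : pt -> R) : Prop :=
  match N with
  | O => An 2 F
  | S N => exists A B, ord N A /\ ord N B /\ F ~=[2] (fun p : pt => p 0%nat * A p + p 1%nat * B p)
  end.

Lemma ord_An N F : ord N F -> An 2 F.
Proof.
  revert F. induction N as [|N IH]; intros F; simpl; auto.
  intros (A & B & HA & HB & E).
  apply An_ext with (fun p : pt => p 0%nat * A p + p 1%nat * B p); [|now apply near_sym].
  apply An_plus; apply An_mul; auto; apply An_var; lia.
Qed.

Lemma ord_mul N F G : ord N F -> An 2 G -> ord N (fun p : pt => F p * G p).
Proof.
  revert F. induction N as [|N IH]; intros F; simpl; [apply An_mul|].
  intros (A & B & HA & HB & E) HG. exists (fun p : pt => A p * G p), (fun p : pt => B p * G p).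
  split; [now apply IH|]. split; [now apply IH|].
  eapply near_imp; [|exact E]. simpl. intros p ->. ring.
Qed.

Lemma coeff_ord N a b F : ord N F -> (a + b < N)%nat -> coeff a b F = 0.
Proof.
  revert a b F. induction N as [|N IH]; intros a b F HF Hab; [lia|].
  destruct HF as (A & B & HA & HB & E).
  pose proof (ord_An _ _ HA) as AA. pose proof (ord_An _ _ HB) as AB.
  rewrite (coeff_near _ _ _ _ E), coeff_plus; try (apply An_mul; auto; apply An_var; lia).
  assert (E1 : coeff a b (fun p : pt => p 0%nat * A p) = 0).
  { destruct a as [|a]; [now apply coeff_x_0|]. rewrite coeff_x_S by auto. apply IH; auto. lia. }
  assert (E2 : coeff a b (fun p : pt => p 1%nat * B p) = 0).
  { destruct b as [|b]; [now apply coeff_xi_0|]. rewrite coeff_xi_S by auto. apply IH; auto. lia. }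
  lra.
Qed.

Lemma anorm_split_last d r F M : 0 < r -> anorm (S d) r F M ->
  exists F0 B, anorm d r F0 M /\ anorm (S d) r B (M / r) /\
    forall p, dom (S d) r p -> F p = F0 p + p d * B p.
Proof.
  intros Hr (Fn & Mn & H1 & H2 & H3).
  assert (HM0 : forall n, 0 <= Mn n) by (intros n; eapply anorm_nonneg; apply H1).
  assert (Hrn : forall n, 0 <= r ^ n) by (intros; apply pow_le; lra).
  assert (Hsum : forall N, sum_n (fun n => Mn (S n) * r ^ n) N <= M / r).
  { intros N. apply Rmult_le_reg_l with r; auto. replace (r * (M / r)) with M by (field; lra).
    rewrite <- sum_n_scal_R. specialize (H2 (S N)).
    rewrite (sum_n_first (fun n => Mn n * r ^ n)) in H2.
    rewrite (sum_n_ext_R _ (fun n => Mn (S n) * r ^ S n)) by (intros; simpl; ring).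
    assert (0 <= Mn 0%nat * r ^ 0) by (apply Rmult_le_pos; auto). lra. }
  assert (HS : forall p, dom (S d) r p ->
    is_series (fun n => Fn (S n) p * p d ^ n) (Series (fun n => Fn (S n) p * p d ^ n))).
  { intros p Hp. apply Series_correct.
    apply (dominated_ex _ (fun n => Mn (S n) * r ^ n) (M / r)); auto.
    intros n. rewrite Rabs_mult. apply Rmult_le_compat; try apply Rabs_pos.
    - eapply anorm_bound; [apply H1|now apply dom_S].
    - apply pow_le_Rabs. apply Rlt_le, dom_last, Hp. }
  exists (Fn 0%nat), (fun p : pt => Series (fun n => Fn (S n) p * p d ^ n)). split; [|split].
  - apply anorm_mono with (Mn 0%nat); auto. specialize (H2 0%nat). rewrite sum_n_O_R in H2.
    simpl in H2. lra.
  - exists (fun n => Fn (S n)), (fun n => Mn (S n)). auto.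
  - intros p Hp. pose proof (H3 p Hp) as E. pose proof (HS p Hp) as E'.
    apply (is_series_tail _ _ 0) in E. rewrite sum_n_O_R in E. simpl in E.
    pose proof (is_series_scal_R (p d) _ _ E') as E2.
    assert (Q : F p - Fn 0%nat p * 1 = p d * Series (fun n => Fn (S n) p * p d ^ n)).
    { rewrite <- (is_series_unique _ _ E), <- (is_series_unique _ _ E2). apply Series_ext.
      intros n. ring. }
    lra.
Qed.

(** Splitting off the terms without [xi], then the constant term, leaves
    multiples of [xi] and of [x]. *)
Lemma Hadamard X : An 2 X -> zero_at_origin X ->
  exists A B, An 2 A /\ An 2 B /\ X ~=[2] (fun p : pt => p 0%nat * A p + p 1%nat * B p).
Proof.
  intros (r & M & Hr & HX) X0.
  destruct (anorm_split_last 1 r X M Hr HX) as (F0 & B & H0 & HB & E).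
  destruct (anorm_split_last 0 r F0 M Hr H0) as (F00 & A & (c & _ & Hc) & HA & E').
  exists A, B. split; [|split].
  - exists r, (M / r). split; auto. apply anorm_weaken; auto. lra.
  - exists r, (M / r). auto.
  - exists r. split; auto. intros p Hp.
    assert (Hz : dom 2 r (fun _ => 0)) by now apply dom_zero.
    pose proof (E _ Hz) as Ez. rewrite (E' _ (dom_S _ _ _ Hz)), Hc in Ez.
    rewrite (E p Hp), (E' p (dom_S _ _ _ Hp)), Hc. unfold zero_at_origin in X0.
    rewrite X0 in Ez. lra.
Qed.

Lemma ord_S_mul N X F : An 2 X -> zero_at_origin X -> ord N F -> ord (S N) (fun p : pt => X p * F p).
Proof.
  intros HX X0 HF. destruct (Hadamard X HX X0) as (A & B & HA & HB & E).
  exists (fun p : pt => F p * A p), (fun p : pt => F p * B p).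
  split; [now apply ord_mul|]. split; [now apply ord_mul|].
  eapply near_imp; [|exact E]. simpl. intros p ->. ring.
Qed.

Lemma ord_pow N X F : An 2 X -> zero_at_origin X -> An 2 F -> ord N (fun p : pt => X p ^ N * F p).
Proof.
  intros HX X0 HF. induction N as [|N IH].
  - simpl. apply An_mul; auto. apply An_const.
  - pose proof (ord_S_mul N X _ HX X0 IH) as H.
    replace (fun p : pt => X p ^ S N * F p) with (fun p : pt => X p * (X p ^ N * F p)); auto.
    apply functional_extensionality. intros; simpl; ring.
Qed.

(** If [X = x A + xi B] then [X^n F = x^n A^n F] modulo [xi]. *)
Lemma coeff_pow_leading n X A B F : An 2 X -> An 2 A -> An 2 B -> An 2 F ->
  X ~=[2] (fun p : pt => p 0%nat * A p + p 1%nat * B p) ->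
  coeff n 0 (fun p : pt => X p ^ n * F p) = A (fun _ => 0) ^ n * F (fun _ => 0).
Proof.
  intros HX HA HB HF E.
  assert (V0 : An 2 (fun p : pt => p 0%nat)) by (apply An_var; lia).
  assert (V1 : An 2 (fun p : pt => p 1%nat)) by (apply An_var; lia).
  assert (HR : forall m, exists R', An 2 R' /\
    near 2 (fun p : pt => X p ^ m = p 0%nat ^ m * A p ^ m + p 1%nat * R' p)).
  { induction m as [|m (R' & HR' & IH)].
    - exists (fun _ => 0). split; [apply An_const|]. apply near_all. intros; simpl; ring.
    - exists (fun p : pt => B p * X p ^ m + p 0%nat * A p * R' p). split.
      + apply An_plus; apply An_mul; auto; [now apply An_pow|now apply An_mul].
      + eapply near_imp2; [|exact E|exact IH]. intros p E1 E2. simpl.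
        rewrite E1 at 1. rewrite Rmult_plus_distr_r. rewrite E2 at 1. ring. }
  destruct (HR n) as (R' & HR' & ER).
  assert (HAF : An 2 (fun p : pt => A p ^ n * F p)) by (apply An_mul; auto; now apply An_pow).
  assert (HRF : An 2 (fun p : pt => R' p * F p)) by now apply An_mul.
  transitivity (coeff n 0 (fun p : pt => p 0%nat ^ n * (A p ^ n * F p) + p 1%nat * (R' p * F p))).
  { apply coeff_near. eapply near_imp; [|exact ER]. intros p ->. ring. }
  rewrite coeff_plus, coeff_xi_0, Rplus_0_r by (auto; apply An_mul; auto; now apply An_pow).
  replace n with (n + 0)%nat at 1 by lia. rewrite coeff_xpow_add, coeff_0_0; auto.
Qed.

(** * The functionals detecting the normal form *)

Section Functional.
Context (k : nat) (hk : (2 <= k)%nat) (eps : R) (heps : eps = 1 \/ eps = -1).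

(** Reducing [x^(i + k (M - j)) xi^(2j)] modulo derivatives along [V] gives
    [reduction_coeff i M j * x^(i + k M)]. *)
Fixpoint reduction_coeff (i M j : nat) : R :=
  match j with
  | O => 1
  | S j => eps * INR k * INR (2 * j + 1) / (2 * INR (i + 1 + k * (M - S j))) * reduction_coeff i M j
  end.

(** The coefficient of [x^(i + k M)] in the reduction of [F] modulo
    derivatives along [V], for [i < k - 1]. *)
Definition class_coeff (i M : nat) (F : pt -> R) : R :=
  sum_n (fun j => reduction_coeff i M j * coeff (i + k * (M - j)) (2 * j) F) M.

Lemma INR_S_neq n : INR (n + 1) <> 0.
Proof. apply not_0_INR. lia. Qed.

Lemma INR_add_neq i x : INR (i + 1 + x) <> 0.
Proof. apply not_0_INR. lia. Qed.

Lemma reduction_coeff_telescope i M j : (j <= M)%nat ->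
  reduction_coeff i (S M) j * INR (i + 1 + k * M) = reduction_coeff i M j * INR (i + 1 + k * (M - j)).
Proof.
  induction j as [|j IH]; intros Hj.
  - now rewrite Nat.sub_0_r.
  - assert (N1 : INR (i + 1 + k * (M - j)) <> 0) by apply INR_add_neq.
    assert (N2 : INR (i + 1 + k * (M - S j)) <> 0) by apply INR_add_neq.
    cbn [reduction_coeff]. replace (S M - S j)%nat with (M - j)%nat by lia.
    rewrite Rmult_assoc, IH by lia. field. auto.
Qed.

Lemma class_coeff_near i M F G : F ~=[2] G -> class_coeff i M F = class_coeff i M G.
Proof.
  intros H. unfold class_coeff. apply sum_n_ext_R. intros j _. now rewrite (coeff_near _ _ _ _ H).
Qed.

Lemma class_coeff_plus i M F G : An 2 F -> An 2 G -> class_coeff i M (fun p : pt => F p + G p) = class_coeff i M F + class_coeff i M G.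
Proof.
  intros HF HG. unfold class_coeff. rewrite <- sum_n_plus_R. apply sum_n_ext_R. intros j _.
  rewrite coeff_plus by auto. ring.
Qed.

Lemma class_coeff_scal i M c F : An 2 F -> class_coeff i M (fun p : pt => c * F p) = c * class_coeff i M F.
Proof.
  intros HF. unfold class_coeff. rewrite <- sum_n_scal_R. apply sum_n_ext_R. intros j _.
  rewrite coeff_scal by auto. ring.
Qed.

Lemma class_coeff_sum_n i M N (F : nat -> pt -> R) : (forall j, (j <= N)%nat -> An 2 (F j)) ->
  class_coeff i M (fun p : pt => sum_n (fun j => F j p) N) = sum_n (fun j => class_coeff i M (F j)) N.
Proof.
  induction N as [|N IH]; intros H.
  - rewrite sum_n_O_R. apply class_coeff_near, near_all. intros; now rewrite sum_n_O_R.
  - rewrite sum_n_S_R, <- IH, <- class_coeff_plus; auto.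
    + apply class_coeff_near, near_all. intros; now rewrite sum_n_S_R.
    + apply (An_sum_n 2 N F). auto.
Qed.

Lemma class_coeff_ord i M N F : ord N F -> (i + k * M < N)%nat -> class_coeff i M F = 0.
Proof using hk.
  intros HF HN. unfold class_coeff. rewrite (sum_n_ext_R _ (fun _ => 0 * 0)).
  - rewrite sum_n_scal_R. ring.
  - intros j Hj. rewrite (coeff_ord N); auto; [ring|]. nia.
Qed.

(** Multiplication by [H] shifts the functionals, because it commutes with
    derivatives along [V]. *)
Lemma class_coeff_mul_H i M F : (i < k - 1)%nat -> An 2 F ->
  class_coeff i (S M) (fun p : pt => (p 1%nat ^ 2 + eps * p 0%nat ^ k) * F p)
  = eps * (1 + INR k / (2 * INR (i + 1 + k * M))) * class_coeff i M F.
Proof using hk.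
  intros Hi HF.
  assert (V0 : An 2 (fun p : pt => p 0%nat)) by (apply An_var; lia).
  assert (V1 : An 2 (fun p : pt => p 1%nat)) by (apply An_var; lia).
  assert (HF1 : An 2 (fun p : pt => p 1%nat * F p)) by now apply An_mul.
  assert (HF2 : An 2 (fun p : pt => p 0%nat ^ k * F p)) by (apply An_mul; auto; now apply An_pow).
  assert (Ecf : forall a b, coeff a b (fun p : pt => (p 1%nat ^ 2 + eps * p 0%nat ^ k) * F p)
    = coeff a b (fun p : pt => p 1%nat * (p 1%nat * F p)) + eps * coeff a b (fun p : pt => p 0%nat ^ k * F p)).
  { intros a b. rewrite <- coeff_scal, <- coeff_plus; auto.
    - apply coeff_near, near_all. intros; simpl; ring.
    - now apply An_mul.
    - now apply An_scal. }
  unfold class_coeff.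
  rewrite (sum_n_ext_R _ (fun j =>
    reduction_coeff i (S M) j * coeff (i + k * (S M - j)) (2 * j) (fun p : pt => p 1%nat * (p 1%nat * F p))
    + eps * (reduction_coeff i (S M) j * coeff (i + k * (S M - j)) (2 * j) (fun p : pt => p 0%nat ^ k * F p)))).
  2:{ intros j _. rewrite Ecf. ring. }
  rewrite sum_n_plus_R, sum_n_scal_R, sum_n_first, sum_n_S_R.
  rewrite Nat.mul_0_r, coeff_xi_0, Rmult_0_r, Rplus_0_l by auto.
  rewrite Nat.sub_diag, Nat.mul_0_r, Nat.add_0_r, (coeff_xpow_lt k i), Rmult_0_r, Rplus_0_r by (auto; lia).
  rewrite <- !sum_n_scal_R, <- sum_n_plus_R. apply sum_n_ext_R. intros j Hj.
  replace (2 * S j)%nat with (S (S (2 * j))) by lia. rewrite !coeff_xi_S by auto.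
  replace (S M - S j)%nat with (M - j)%nat by lia.
  replace (i + k * (S M - j))%nat with (k + (i + k * (M - j)))%nat by nia.
  rewrite coeff_xpow_add by auto.
  cbn [reduction_coeff]. replace (S M - S j)%nat with (M - j)%nat by lia.
  pose proof (reduction_coeff_telescope i M j Hj) as T.
  assert (N1 : INR (i + 1 + k * (M - j)) <> 0) by apply INR_add_neq.
  assert (N2 : INR (i + 1 + k * M) <> 0) by apply INR_add_neq.
  assert (EM : INR (i + 1 + k * M) = INR (i + 1 + k * (M - j)) + INR k * INR j).
  { rewrite <- mult_INR, <- plus_INR. f_equal. nia. }
  assert (Eg : reduction_coeff i (S M) j = reduction_coeff i M j * INR (i + 1 + k * (M - j)) / INR (i + 1 + k * M)).
  { rewrite <- T. field. auto. }
  rewrite Eg, plus_INR, mult_INR.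
  rewrite EM in *. simpl (INR 1). simpl (INR 2). field. auto.
Qed.

(** For [alpha = A dx + B dxi] the left hand side involves [dH /\ alpha].  Modulo
    derivatives along [V] it depends on [d alpha] only, since [dH /\ d eta] is
    such a derivative up to sign.  On monomials the dependence is a shift. *)
Lemma class_coeff_wedge_dH i M A B : (i < k - 1)%nat -> An 2 A -> An 2 B ->
  class_coeff i (S M) (fun p : pt => eps * INR k * p 0%nat ^ (k - 1) * B p - 2 * p 1%nat * A p)
  = eps * INR k / INR (i + 1 + k * M) * class_coeff i M (fun p : pt => pd 0 B p - pd 1 A p).
Proof using hk.
  intros Hi HA HB.
  assert (V0 : An 2 (fun p : pt => p 0%nat)) by (apply An_var; lia).
  assert (V1 : An 2 (fun p : pt => p 1%nat)) by (apply An_var; lia).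
  assert (HA1 : An 2 (fun p : pt => p 1%nat * A p)) by now apply An_mul.
  assert (HB1 : An 2 (fun p : pt => p 0%nat ^ (k - 1) * B p)) by (apply An_mul; auto; now apply An_pow).
  assert (PB : An 2 (pd 0 B)) by (apply An_pd; auto).
  assert (PA : An 2 (pd 1 A)) by (apply An_pd; auto).
  assert (Ecf : forall a b, coeff a b (fun p : pt => eps * INR k * p 0%nat ^ (k - 1) * B p - 2 * p 1%nat * A p)
    = eps * INR k * coeff a b (fun p : pt => p 0%nat ^ (k - 1) * B p) + -2 * coeff a b (fun p : pt => p 1%nat * A p)).
  { intros a b. rewrite <- !coeff_scal, <- coeff_plus; auto; try now apply An_scal.
    apply coeff_near, near_all. intros; simpl; ring. }
  assert (Ecf' : forall a b, coeff a b (fun p : pt => pd 0 B p - pd 1 A p)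
    = INR (S a) * coeff (S a) b B - INR (S b) * coeff a (S b) A).
  { intros a b. rewrite <- coeff_pd0, <- coeff_pd1 by auto.
    transitivity (coeff a b (pd 0 B) + -1 * coeff a b (pd 1 A)); [|ring].
    rewrite <- coeff_scal, <- coeff_plus; auto; try now apply An_scal.
    apply coeff_near, near_all. intros; simpl; ring. }
  unfold class_coeff.
  rewrite (sum_n_ext_R _ (fun j =>
    -2 * (reduction_coeff i (S M) j * coeff (i + k * (S M - j)) (2 * j) (fun p : pt => p 1%nat * A p))
    + eps * INR k * (reduction_coeff i (S M) j * coeff (i + k * (S M - j)) (2 * j) (fun p : pt => p 0%nat ^ (k - 1) * B p)))).
  2:{ intros j _. rewrite Ecf. ring. }
  rewrite sum_n_plus_R, !sum_n_scal_R, sum_n_first, (sum_n_S_R (fun j => reduction_coeff i (S M) j * coeff _ _ (fun p : pt => p 0%nat ^ _ * _))).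
  rewrite Nat.mul_0_r, coeff_xi_0, Rmult_0_r, Rplus_0_l by auto.
  rewrite Nat.sub_diag, Nat.mul_0_r, Nat.add_0_r, (coeff_xpow_lt (k - 1) i), Rmult_0_r, Rplus_0_r by (auto; lia).
  rewrite <- !sum_n_scal_R, <- sum_n_plus_R. apply sum_n_ext_R. intros j Hj. rewrite Ecf'.
  replace (2 * S j)%nat with (S (S (2 * j))) by lia. rewrite !coeff_xi_S by auto.
  replace (S M - S j)%nat with (M - j)%nat by lia.
  replace (i + k * (S M - j))%nat with (k - 1 + S (i + k * (M - j)))%nat by nia.
  rewrite coeff_xpow_add by auto.
  cbn [reduction_coeff]. replace (S M - S j)%nat with (M - j)%nat by lia.
  pose proof (reduction_coeff_telescope i M j Hj) as T.
  assert (N1 : INR (i + 1 + k * (M - j)) <> 0) by apply INR_add_neq.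
  assert (N2 : INR (i + 1 + k * M) <> 0) by apply INR_add_neq.
  assert (Eg : reduction_coeff i (S M) j = reduction_coeff i M j * INR (i + 1 + k * (M - j)) / INR (i + 1 + k * M)).
  { rewrite <- T. field. auto. }
  rewrite Eg. replace (S (i + k * (M - j))) with (i + 1 + k * (M - j))%nat by lia.
  replace (S (2 * j)) with (2 * j + 1)%nat by lia. field. auto.
Qed.

(** [V eta] is [- dH /\ d eta], and [d (d eta) = 0]. *)
Lemma class_coeff_Vop i M eta : (i < k - 1)%nat -> An 2 eta -> class_coeff i M (Vop k eps eta) = 0.
Proof using hk.
  intros Hi He.
  assert (P0 : An 2 (pd 0 eta)) by (apply An_pd; auto).
  assert (P1' : An 2 (pd 1 eta)) by (apply An_pd; auto).
  assert (V0 : An 2 (fun p : pt => p 0%nat)) by (apply An_var; lia).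
  assert (V1 : An 2 (fun p : pt => p 1%nat)) by (apply An_var; lia).
  assert (HG : An 2 (fun p : pt => eps * INR k * p 0%nat ^ (k - 1) * pd 1 eta p - 2 * p 1%nat * pd 0 eta p)).
  { apply An_minus; apply An_mul; auto; [apply An_scal, An_pow|apply An_scal]; auto. }
  transitivity (-1 * class_coeff i M (fun p : pt => eps * INR k * p 0%nat ^ (k - 1) * pd 1 eta p - 2 * p 1%nat * pd 0 eta p)).
  { rewrite <- class_coeff_scal by auto. apply class_coeff_near, near_all. intros p. unfold Vop. ring. }
  destruct M as [|M].
  - unfold class_coeff. rewrite sum_n_O_R.
    assert (E : coeff (i + k * (0 - 0)) (2 * 0)
      (fun p : pt => eps * INR k * p 0%nat ^ (k - 1) * pd 1 eta p - 2 * p 1%nat * pd 0 eta p) = 0).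
    { transitivity (eps * INR k * coeff i 0 (fun p : pt => p 0%nat ^ (k - 1) * pd 1 eta p)
        + -2 * coeff i 0 (fun p : pt => p 1%nat * pd 0 eta p)).
      - rewrite <- !coeff_scal, <- coeff_plus; try apply An_scal; try apply An_mul; auto; try now apply An_pow.
        rewrite Nat.mul_0_r, Nat.add_0_r. apply coeff_near, near_all. intros; simpl; ring.
      - rewrite coeff_xi_0, coeff_xpow_lt by (auto; lia). ring. }
    rewrite E. ring.
  - rewrite class_coeff_wedge_dH by auto.
    rewrite (class_coeff_near i M _ (fun _ => 0 * 0)).
    + rewrite (class_coeff_scal i M 0 (fun _ => 0)) by apply An_const. ring.
    + eapply near_imp; [|apply (An_Schwarz 2 0 1 eta ltac:(lia) ltac:(lia) He)].
      intros p ->. ring.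
Qed.

(** ** Maps preserving [H] *)

Context (X Y : pt -> R).
Hypotheses (HX : An 2 X) (HY : An 2 Y) (X0 : zero_at_origin X) (Y0 : zero_at_origin Y).
Hypothesis EH : near 2 (fun p : pt => Y p ^ 2 + eps * X p ^ k = p 1%nat ^ 2 + eps * p 0%nat ^ k).

Lemma preserve_dH : near 2 (fun p =>
  2 * Y p * pd 0 Y p + eps * INR k * X p ^ (k - 1) * pd 0 X p = eps * INR k * p 0%nat ^ (k - 1) /\
  2 * Y p * pd 1 Y p + eps * INR k * X p ^ (k - 1) * pd 1 X p = 2 * p 1%nat).
Proof using hk HX HY EH.
  assert (V0 : An 2 (fun p : pt => p 0%nat)) by (apply An_var; lia).
  assert (V1 : An 2 (fun p : pt => p 1%nat)) by (apply An_var; lia).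
  pose proof (pd_near 2 0 _ _ ltac:(lia) EH) as E0. pose proof (pd_near 2 1 _ _ ltac:(lia) EH) as E1.
  pose proof (pd_model 2 k eps 0 X Y ltac:(lia) HX HY) as F0.
  pose proof (pd_model 2 k eps 1 X Y ltac:(lia) HX HY) as F1.
  pose proof (pd_model 2 k eps 0 _ _ ltac:(lia) V0 V1) as G0.
  pose proof (pd_model 2 k eps 1 _ _ ltac:(lia) V0 V1) as G1.
  eapply near_imp2; [|exact (near_and _ _ _ E0 E1)|exact (near_and _ _ _ (near_and _ _ _ F0 F1) (near_and _ _ _ G0 G1))].
  cbv beta. intros p [Q0 Q1] [[R0 R1] [T0 T1]].
  rewrite R0, T0 in Q0. rewrite R1, T1 in Q1.
  rewrite pd_var_eq, pd_var_neq in Q0 by lia. rewrite pd_var_eq, pd_var_neq in Q1 by lia.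
  split; lra.
Qed.

(** The matrix, in the basis of the classes of powers of [x], of the pull-back
    of densities by a map [(X, Y)] that preserves [H]. *)
Definition transition (n i M : nat) : R := class_coeff i M (fun p : pt => X p ^ n * jac X Y p).

Lemma XnJ_An n : An 2 (fun p : pt => X p ^ n * jac X Y p).
Proof using HX HY. apply An_mul; [now apply An_pow|now apply jac_An]. Qed.

(** [H X^n J] is the pull-back of [H x^n], because the map preserves [H]. *)
Lemma transition_H n i M : (i < k - 1)%nat ->
  eps * (1 + INR k / (2 * INR (i + 1 + k * M))) * transition n i M
  = eps * (1 + INR k / (2 * INR (n + 1))) * transition (n + k) i (S M).
Proof using hk HX HY EH.
  intros Hi. unfold transition. rewrite <- class_coeff_mul_H by (auto; apply XnJ_An).
  assert (N1 : INR (n + 1) <> 0) by apply INR_S_neq.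
  set (eta := fun p => X p ^ (n + 1) * Y p).
  assert (He : An 2 eta) by (apply An_mul; auto; now apply An_pow).
  assert (EV : Vop k eps eta ~=[2] (fun p =>
    (2 * INR (n + 1) * X p ^ n * Y p ^ 2 - eps * INR k * X p ^ (n + k)) * jac X Y p)).
  { pose proof (pd_mul 2 0 ltac:(lia) _ _ (An_pow 2 X (n + 1) HX) HY) as D0.
    pose proof (pd_mul 2 1 ltac:(lia) _ _ (An_pow 2 X (n + 1) HX) HY) as D1.
    pose proof (pd_pow 2 0 ltac:(lia) (n + 1) X HX) as D2.
    pose proof (pd_pow 2 1 ltac:(lia) (n + 1) X HX) as D3.
    eapply near_imp2; [|exact preserve_dH|exact (near_and _ _ _ (near_and _ _ _ D0 D1) (near_and _ _ _ D2 D3))].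
    cbv beta. intros p [Q0 Q1] [[C0 C1] [C2 C3]].
    unfold Vop, eta. rewrite C0, C1, C2, C3, <- Q0, <- Q1. unfold jac.
    replace (pred (n + 1)) with n by lia.
    replace (X p ^ (n + k)) with (X p ^ (k - 1) * X p ^ (n + 1)) by (rewrite <- pow_add; f_equal; lia).
    ring. }
  rewrite (class_coeff_near i (S M) _ (fun p : pt => / (2 * INR (n + 1)) * Vop k eps eta p
    + eps * (1 + INR k / (2 * INR (n + 1))) * (X p ^ (n + k) * jac X Y p))).
  - assert (HV : An 2 (Vop k eps eta)).
    { apply An_minus; apply An_mul; try (apply An_pd; auto).
      - apply An_scal, An_var; lia.
      - apply An_scal, An_pow, An_var; lia. }
    rewrite (class_coeff_plus i (S M) (fun p : pt => / (2 * INR (n + 1)) * Vop k eps eta p)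
      (fun p : pt => eps * (1 + INR k / (2 * INR (n + 1))) * (X p ^ (n + k) * jac X Y p)));
      [|now apply An_scal|apply An_scal, XnJ_An].
    rewrite !class_coeff_scal by (auto; apply XnJ_An). rewrite class_coeff_Vop by auto. ring.
  - eapply near_imp2; [|exact EH|exact EV]. intros p Q1 ->. rewrite <- Q1.
    rewrite pow_add. field. auto.
Qed.

(** The pull-back of [dH /\ (x^(n+1) dxi)] is [dH /\ (X^(n+1) dY)]. *)
Lemma transition_D n i M : (i < k - 1)%nat ->
  eps * INR k / INR (i + 1 + k * M) * transition n i M
  = eps * INR k / INR (n + 1) * transition (n + k) i (S M).
Proof using hk HX HY EH.
  intros Hi. unfold transition.
  assert (N1 : INR (n + 1) <> 0) by apply INR_S_neq.
  assert (PY : forall i, (i < 2)%nat -> An 2 (pd i Y)) by (intros; now apply An_pd).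
  set (Z := fun p => / INR (n + 1) * X p ^ (n + 1)).
  assert (HZ : An 2 Z) by (apply An_scal; now apply An_pow).
  rewrite (class_coeff_near i M _ (fun p : pt => pd 0 (fun p : pt => Z p * pd 1 Y p) p - pd 1 (fun p : pt => Z p * pd 0 Y p) p)).
  - rewrite <- class_coeff_wedge_dH; auto; try (apply An_mul; auto).
    rewrite <- class_coeff_scal by apply XnJ_An. apply class_coeff_near.
    eapply near_imp; [|exact preserve_dH]. intros p [Q0 Q1]. rewrite <- Q0, <- Q1. unfold Z, jac.
    replace (X p ^ (n + k)) with (X p ^ (k - 1) * X p ^ (n + 1)) by (rewrite <- pow_add; f_equal; lia).
    field. auto.
  - pose proof (pd_mul 2 0 ltac:(lia) _ _ HZ (PY 1%nat ltac:(lia))) as D0.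
    pose proof (pd_mul 2 1 ltac:(lia) _ _ HZ (PY 0%nat ltac:(lia))) as D1.
    pose proof (pd_scal 2 0 ltac:(lia) (/ INR (n + 1)) _ (An_pow 2 X (n + 1) HX)) as D2.
    pose proof (pd_scal 2 1 ltac:(lia) (/ INR (n + 1)) _ (An_pow 2 X (n + 1) HX)) as D3.
    pose proof (pd_pow 2 0 ltac:(lia) (n + 1) X HX) as D4.
    pose proof (pd_pow 2 1 ltac:(lia) (n + 1) X HX) as D5.
    pose proof (An_Schwarz 2 0 1 Y ltac:(lia) ltac:(lia) HY) as S.
    eapply near_imp2; [|exact (near_and _ _ _ (near_and _ _ _ D0 D1) S)
      |exact (near_and _ _ _ (near_and _ _ _ D2 D3) (near_and _ _ _ D4 D5))].
    cbv beta. intros p [[C0 C1] C] [[C2 C3] [C4 C5]].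
    rewrite C0, C1, C. unfold Z. rewrite C2, C3, C4, C5. unfold jac.
    replace (pred (n + 1)) with n by lia. field. auto.
Qed.

(** Both [H] and the wedge with [dH] act on classes of monomials by shifts, with
    factors whose quotient [(n + 1) / k + 1 / 2] separates the exponents [n].
    So a map preserving [H] acts diagonally. *)
Lemma transition_offdiag n i M : (i < k - 1)%nat -> n <> (i + k * M)%nat -> transition n i M = 0.
Proof using hk heps HX HY EH.
  intros Hi Hn. pose proof (transition_H n i M Hi) as E1. pose proof (transition_D n i M Hi) as E2.
  assert (He : eps <> 0) by (destruct heps; lra).
  assert (Hk : INR k <> 0) by (apply not_0_INR; lia).
  set (a := INR (i + 1 + k * M)) in *. set (b := INR (n + 1)) in *.
  assert (Ha : a <> 0) by apply INR_add_neq.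
  assert (Hb : b <> 0) by apply INR_S_neq.
  assert (Hab : a <> b) by (intros E; apply INR_eq in E; lia).
  assert (E3 : transition (n + k) i (S M) = b / a * transition n i M).
  { apply Rmult_eq_reg_l with (eps * INR k / b).
    - rewrite <- E2. field. auto.
    - unfold Rdiv. apply Rmult_integral_contrapositive_currified; [|now apply Rinv_neq_0_compat].
      now apply Rmult_integral_contrapositive_currified. }
  rewrite E3 in E1.
  assert (E4 : eps * (a - b) * transition n i M = 0).
  { replace (eps * (a - b) * transition n i M) with
      (a * (eps * (1 + INR k / (2 * a)) * transition n i M - eps * (1 + INR k / (2 * b)) * (b / a * transition n i M)))
      by (field; auto).
    rewrite E1. ring. }
  apply Rmult_integral in E4. destruct E4 as [E4|E4]; auto.
  apply Rmult_integral in E4. destruct E4; lra.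
Qed.

(** The operation of [transition_D] lowers [M] to [0], where the entry is the
    coefficient of [x^i] in [X^i J]. *)
Lemma transition_diag i M A B : (i < k - 1)%nat -> An 2 A -> An 2 B ->
  X ~=[2] (fun p : pt => p 0%nat * A p + p 1%nat * B p) ->
  transition (i + k * M) i M = A (fun _ => 0) ^ i * jac X Y (fun _ => 0).
Proof using hk heps HX HY EH.
  intros Hi HA HB E.
  induction M as [|M IH].
  - unfold transition, class_coeff. rewrite sum_n_O_R. cbn [reduction_coeff]. rewrite Rmult_1_l.
    replace (i + k * (0 - 0))%nat with i by lia. replace (i + k * 0)%nat with i by lia.
    replace (2 * 0)%nat with 0%nat by lia. apply (coeff_pow_leading i X A B); auto. now apply jac_An.
  - rewrite <- IH. pose proof (transition_D (i + k * M) i M Hi) as E2.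
    replace (i + k * S M)%nat with (i + k * M + k)%nat by lia.
    replace (i + k * M + 1)%nat with (i + 1 + k * M)%nat in E2 by lia.
    symmetry. apply Rmult_eq_reg_l in E2; auto.
    assert (He : eps <> 0) by (destruct heps; lra).
    assert (Hk : INR k <> 0) by (apply not_0_INR; lia).
    assert (Ha : INR (i + 1 + k * M) <> 0) by apply INR_add_neq.
    unfold Rdiv. apply Rmult_integral_contrapositive_currified; [|now apply Rinv_neq_0_compat].
    now apply Rmult_integral_contrapositive_currified.
Qed.
End Functional.

(** * Uniqueness of the normal form *)

Lemma analytic1_split (h : R -> R) (a : nat -> R) M :
  locally 0 (fun t => is_pseries a t (h t)) ->
  exists h', analytic1 h' /\
    locally 0 (fun t => h t = sum_n (fun m => a m * t ^ m) M + t ^ S M * h' t).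
Proof.
  intros H. exists (PSeries (fun n => a (S M + n)%nat)).
  assert (E : locally 0 (fun t =>
    is_pseries (fun n => a (S M + n)%nat) t (PSeries (fun n => a (S M + n)%nat) t) /\
    h t = sum_n (fun m => a m * t ^ m) M + t ^ S M * PSeries (fun n => a (S M + n)%nat) t)).
  { eapply filter_imp; [|exact H]. intros t Ht. apply is_pseries_R in Ht.
    pose proof (is_series_tail _ _ M Ht) as T.
    assert (HS : ex_series (fun n => a (S M + n)%nat * t ^ n)).
    { destruct (Req_dec t 0) as [->|Hne].
      - exists (a (S M + 0)%nat). apply is_series_delta with 0%nat.
        + intros [|n] Hn; [lia|]. simpl; ring.
        + simpl; ring.
      - eexists. eapply is_series_ext_R; [|exact (is_series_scal_R (/ t ^ S M) _ _ T)].
        intros n. cbv beta. rewrite pow_add. field. apply pow_nonzero; auto. }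
    assert (HP : is_series (fun n => a (S M + n)%nat * t ^ n) (PSeries (fun n => a (S M + n)%nat) t))
      by (unfold PSeries; now apply Series_correct).
    split; [now apply is_pseries_R|].
    pose proof (is_series_scal_R (t ^ S M) _ _ HP) as T2.
    assert (Q : h t - sum_n (fun m => a m * t ^ m) M = t ^ S M * PSeries (fun n => a (S M + n)%nat) t).
    { rewrite <- (is_series_unique _ _ T), <- (is_series_unique _ _ T2). apply Series_ext.
      intros n. rewrite pow_add. ring. }
    rewrite <- Q. ring. }
  split.
  - exists (fun n => a (S M + n)%nat). eapply filter_imp; [|exact E]. now intros t [Q _].
  - eapply filter_imp; [|exact E]. now intros t [_ Q].
Qed.

Section Coefficients.
Context (k : nat) (hk : (2 <= k)%nat) (eps : R) (heps : eps = 1 \/ eps = -1).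
Context (f : nat -> R -> R) (a : nat -> nat -> R).
Hypothesis Ha : forall j, (j <= k - 2)%nat -> locally 0 (fun t => is_pseries (a j) t (f (S j) t)).

(** A finite expansion suffices: [class_coeff_ord] ignores the remainder, and
    no infinite sum has to be exchanged with the functionals. *)
Lemma nf_expansion M : exists Q, An 1 Q /\
  near 1 (fun q => Derive (nf_fun k f) (q 0%nat)
    = sum_n (fun j => sum_n (fun m => a j m * INR (S (j + k * m)) * q 0%nat ^ (j + k * m)) M) (k - 2)
      + q 0%nat ^ (k * S M - 1) * Q q).
Proof using hk Ha.
  assert (Hsp : exists h : nat -> R -> R, forall j, (j <= k - 2)%nat -> analytic1 (h j) /\
    locally 0 (fun t => f (S j) t = sum_n (fun m => a j m * t ^ m) M + t ^ S M * h j t)).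
  { apply (functional_choice (fun j hj => (j <= k - 2)%nat -> analytic1 hj /\
      locally 0 (fun t => f (S j) t = sum_n (fun m => a j m * t ^ m) M + t ^ S M * hj t))).
    intros j. destruct (le_lt_dec j (k - 2)) as [Hj|Hj].
    - destruct (analytic1_split _ _ M (Ha j Hj)) as (h & Hh). exists h. auto.
    - exists (fun _ => 0). intros; lia. }
  destruct Hsp as [h Hh].
  assert (V : An 1 (fun q : pt => q 0%nat)) by (apply An_var; lia).
  set (Q0 := fun q : pt => sum_n (fun j => q 0%nat ^ S j * h j (q 0%nat ^ k)) (k - 2)).
  assert (HQ0 : An 1 Q0).
  { apply (An_sum_n 1 (k - 2) (fun j (q : pt) => q 0%nat ^ S j * h j (q 0%nat ^ k))).
    intros j Hj. apply An_nf_term; try lia. now apply Hh. }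
  set (N := (k * S M)%nat).
  set (P := fun q : pt => sum_n (fun j => sum_n (fun m => a j m * q 0%nat ^ S (j + k * m)) M) (k - 2)).
  assert (Hmono : forall j m, An 1 (fun q : pt => a j m * q 0%nat ^ S (j + k * m))).
  { intros. apply An_scal, An_pow. exact V. }
  assert (HPj : forall j, An 1 (fun q : pt => sum_n (fun m => a j m * q 0%nat ^ S (j + k * m)) M)).
  { intros j. apply (An_sum_n 1 M (fun m (q : pt) => a j m * q 0%nat ^ S (j + k * m))). auto. }
  assert (HP : An 1 P).
  { apply (An_sum_n 1 (k - 2) (fun j (q : pt) => sum_n (fun m => a j m * q 0%nat ^ S (j + k * m)) M)). auto. }
  assert (EN : (fun q : pt => nf_fun k f (q 0%nat)) ~=[1] (fun q : pt => P q + q 0%nat ^ N * Q0 q)).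
  { assert (H1 : near 1 (fun q => forall j, (j < S (k - 2))%nat ->
      f (S j) (q 0%nat ^ k) = sum_n (fun m => a j m * (q 0%nat ^ k) ^ m) M + (q 0%nat ^ k) ^ S M * h j (q 0%nat ^ k))).
    { apply near_forall. intros j Hj. destruct (Hh j ltac:(lia)) as [_ E].
      apply locally1_near in E.
      apply (near_comp 1 1 (fun _ (q : pt) => q 0%nat ^ k)
        (fun _ _ => An_pow 1 _ k V) (fun _ _ => pow_i k ltac:(lia)) _ E). }
    eapply near_imp; [|exact H1]. intros q Hq. rewrite nf_fun_sum_n by auto.
    unfold P, Q0. rewrite <- sum_n_scal_R, <- sum_n_plus_R. apply sum_n_ext_R. intros j Hj.
    rewrite Hq by lia. rewrite Rmult_plus_distr_l, <- sum_n_scal_R. f_equal.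
    - apply sum_n_ext_R. intros m _. rewrite <- pow_mult. simpl. rewrite pow_add. ring.
    - rewrite <- pow_mult. unfold N. ring. }
  exists (fun q => INR N * Q0 q + q 0%nat * pd 0 Q0 q). split.
  - apply An_plus; [now apply An_scal|]. apply An_mul; auto. apply An_pd; auto.
  - assert (HN : An 1 (fun q : pt => q 0%nat ^ N * Q0 q)) by (apply An_mul; auto; now apply An_pow).
    pose proof (pd_near 1 0 _ _ ltac:(lia) EN) as D0.
    pose proof (pd_plus 1 0 ltac:(lia) _ _ HP HN) as D1.
    pose proof (pd_mul 1 0 ltac:(lia) _ _ (An_pow 1 _ N V) HQ0) as D2.
    pose proof (pd_pow 1 0 ltac:(lia) N _ V) as D3.
    pose proof (pd_sum_n 1 0 (k - 2) (fun j (q : pt) => sum_n (fun m => a j m * q 0%nat ^ S (j + k * m)) M)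
      ltac:(lia) (fun j _ => HPj j)) as D4.
    assert (D5 : near 1 (fun q : pt => forall j, (j < S (k - 2))%nat ->
      pd 0 (fun q : pt => sum_n (fun m => a j m * q 0%nat ^ S (j + k * m)) M) q
      = sum_n (fun m => a j m * INR (S (j + k * m)) * q 0%nat ^ (j + k * m)) M)).
    { apply near_forall. intros j Hj.
      pose proof (pd_sum_n 1 0 M (fun m (q : pt) => a j m * q 0%nat ^ S (j + k * m)) ltac:(lia)
        (fun m _ => Hmono j m)) as F1.
      assert (F2 : near 1 (fun q : pt => forall m, (m < S M)%nat ->
        pd 0 (fun q : pt => a j m * q 0%nat ^ S (j + k * m)) q
        = a j m * INR (S (j + k * m)) * q 0%nat ^ (j + k * m))).
      { apply near_forall. intros m _.
        pose proof (pd_scal 1 0 ltac:(lia) (a j m) _ (An_pow 1 _ (S (j + k * m)) V)) as G1.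
        pose proof (pd_pow 1 0 ltac:(lia) (S (j + k * m)) _ V) as G2.
        eapply near_imp2; [|exact G1|exact G2]. cbv beta. intros q -> ->.
        rewrite pd_var_eq. simpl pred. ring. }
      eapply near_imp2; [|exact F1|exact F2]. intros q -> Hq. apply sum_n_ext_R.
      intros m Hm. apply Hq. lia. }
    eapply near_imp2; [|exact (near_and _ _ _ D0 (near_and _ _ _ D1 D2))
      |exact (near_and _ _ _ D3 (near_and _ _ _ D4 D5))].
    cbv beta. intros q [C0 [C1 C2]] [C3 [C4 C5]].
    change (Derive (nf_fun k f) (q 0%nat)) with (pd 0 (fun q : pt => nf_fun k f (q 0%nat)) q).
    rewrite C0, C1, C2, C3, pd_var_eq. unfold P. rewrite C4. f_equal.
    + apply sum_n_ext_R. intros j Hj. apply C5. lia.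
    + assert (EP : q 0%nat ^ N = q 0%nat * q 0%nat ^ (N - 1)).
      { change (q 0%nat ^ N = q 0%nat ^ S (N - 1)). f_equal. unfold N. lia. }
      rewrite EP. replace (pred N) with (N - 1)%nat by lia. ring.
Qed.

Context (X Y : pt -> R).
Hypotheses (HX : An 2 X) (HY : An 2 Y) (X0 : zero_at_origin X) (Y0 : zero_at_origin Y).
Hypothesis EH : near 2 (fun p => Y p ^ 2 + eps * X p ^ k = p 1%nat ^ 2 + eps * p 0%nat ^ k).

(** The functionals see each Taylor coefficient of the normal form separately,
    as the pull-back is diagonal. *)
Lemma class_coeff_nf i M A B : (i < k - 1)%nat -> An 2 A -> An 2 B ->
  X ~=[2] (fun p => p 0%nat * A p + p 1%nat * B p) ->
  class_coeff k eps i M (fun p => Derive (nf_fun k f) (X p) * jac X Y p)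
  = INR (S (i + k * M)) * a i M * (A (fun _ => 0) ^ i * jac X Y (fun _ => 0)).
Proof using hk heps Ha HX HY X0 EH.
  intros Hi HA HB E.
  destruct (nf_expansion M) as (Q & HQ & EQ).
  assert (HJ : An 2 (jac X Y)) by now apply jac_An.
  pose proof (near_comp 1 2 (fun _ => X) (fun _ _ => HX) (fun _ _ => X0) _ EQ) as EQ2.
  set (QX := fun p : pt => Q (fun _ => X p)).
  assert (HQX : An 2 QX) by (apply (An_comp 1 2 (fun _ => X) (fun _ _ => HX) (fun _ _ => X0)); auto).
  assert (HXn : forall n, An 2 (fun p => X p ^ n * jac X Y p)) by (intros; now apply XnJ_An).
  set (T := fun j m (p : pt) => a j m * INR (S (j + k * m)) * (X p ^ (j + k * m) * jac X Y p)).
  assert (HT : forall j m, An 2 (T j m)) by (intros; apply An_scal; auto).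
  set (Tj := fun j (p : pt) => sum_n (fun m => T j m p) M).
  assert (HTj : forall j, An 2 (Tj j)) by (intros; apply (An_sum_n 2 M (T j)); auto).
  set (S0 := fun p : pt => sum_n (fun j => Tj j p) (k - 2)).
  assert (HS0 : An 2 S0) by (apply (An_sum_n 2 (k - 2) Tj); auto).
  assert (HRem : ord (k * S M - 1) (fun p => X p ^ (k * S M - 1) * (QX p * jac X Y p))).
  { apply ord_pow; auto. now apply An_mul. }
  rewrite (class_coeff_near k eps i M _ (fun p => S0 p + X p ^ (k * S M - 1) * (QX p * jac X Y p))).
  2:{ eapply near_imp; [|exact EQ2]. cbv beta. intros p ->. fold (QX p).
      rewrite Rmult_plus_distr_r. f_equal; [|ring].
      rewrite Rmult_comm, <- sum_n_scal_R. apply sum_n_ext_R. intros j _.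
      rewrite <- sum_n_scal_R. apply sum_n_ext_R. intros m _. unfold T. ring. }
  rewrite (class_coeff_plus k eps i M S0) by (auto; eapply ord_An; exact HRem).
  rewrite (class_coeff_ord k hk eps i M _ _ HRem) by (rewrite Nat.mul_succ_r; lia).
  unfold S0. rewrite (class_coeff_sum_n k eps i M (k - 2) Tj) by auto.
  rewrite (sum_n_ext_R _ (fun j => if Nat.eqb i j then (fun _ =>
    INR (S (i + k * M)) * a i M * (A (fun _ => 0) ^ i * jac X Y (fun _ => 0))) j else 0)).
  - rewrite (sum_n_pick (fun _ => INR (S (i + k * M)) * a i M * (A (fun _ => 0) ^ i * jac X Y (fun _ => 0)))) by lia.
    ring.
  - intros j Hj. unfold Tj. rewrite (class_coeff_sum_n k eps i M M (T j)) by auto.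
    rewrite (sum_n_ext_R _ (fun m => if Nat.eqb M m then (fun _ => if Nat.eqb i j then
      INR (S (i + k * M)) * a i M * (A (fun _ => 0) ^ i * jac X Y (fun _ => 0)) else 0) m else 0)).
    + now rewrite (sum_n_pick (fun _ => if Nat.eqb i j then _ else 0)) by lia.
    + intros m Hm. unfold T. rewrite class_coeff_scal by auto. fold (transition k eps X Y (j + k * m) i M).
      destruct (Nat.eqb_spec M m) as [<-|Hne]; [destruct (Nat.eqb_spec i j) as [<-|Hne]|].
      * rewrite (transition_diag k hk eps heps X Y HX HY EH i M A B) by auto. ring.
      * rewrite (transition_offdiag k hk eps heps X Y HX HY EH) by (auto; lia). ring.
      * rewrite (transition_offdiag k hk eps heps X Y HX HY EH); auto; [ring|]. nia.
Qed.
End Coefficients.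

(** [F] vanishes off the origin, and is continuous. *)
Lemma An1_cancel m F : An 1 F -> near 1 (fun q => q 0%nat ^ m * F q = 0) -> F (fun _ => 0) = 0.
Proof.
  intros (r & M & Hr & HF) (s & Hs & H).
  destruct (anorm_split_last 0 r F M Hr HF) as (F0 & B & (c & _ & Hc) & HB & E).
  pose proof (anorm_nonneg _ _ _ _ HB) as HM.
  set (K := M / r) in *. clearbody K.
  assert (E0 : F (fun _ => 0) = c) by (rewrite E, Hc by (now apply dom_zero); ring).
  rewrite E0. destruct (Req_dec c 0) as [|Hne]; auto. exfalso.
  assert (Hc0 : 0 < Rabs c) by now apply Rabs_pos_lt.
  set (t := Rmin (Rmin r s) (Rabs c / (K + 1)) / 2).
  assert (Ht : 0 < t).
  { unfold t. apply Rdiv_lt_0_compat; [|lra]. repeat apply Rmin_pos; auto.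
    apply Rdiv_lt_0_compat; lra. }
  assert (Ht1 : t < r /\ t < s /\ t < Rabs c / (K + 1)).
  { unfold t in *. pose proof (Rmin_l (Rmin r s) (Rabs c / (K + 1))).
    pose proof (Rmin_r (Rmin r s) (Rabs c / (K + 1))).
    pose proof (Rmin_l r s). pose proof (Rmin_r r s). lra. }
  assert (Hd : forall u, t < u -> dom 1 u (fun _ => t)).
  { intros u Hu i _. rewrite Rabs_pos_eq; lra. }
  pose proof (H _ (Hd s ltac:(lra))) as Z. simpl in Z. cbv beta in Z.
  apply Rmult_integral in Z. destruct Z as [Z|Z]; [apply pow_nonzero in Z; lra|].
  rewrite E, Hc in Z by (apply Hd; lra).
  pose proof (anorm_bound _ _ _ _ _ HB (Hd r ltac:(lra))) as Bd.
  assert (Q : Rabs c <= t * K).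
  { replace c with (- (t * B (fun _ => t))) by lra. rewrite Rabs_Ropp, Rabs_mult, (Rabs_pos_eq t) by lra.
    apply Rmult_le_compat_l; lra. }
  destruct Ht1 as (_ & _ & Ht3).
  apply (Rmult_lt_compat_r (K + 1)) in Ht3; [|lra].
  replace (Rabs c / (K + 1) * (K + 1)) with (Rabs c) in Ht3 by (field; lra).
  nra.
Qed.

Lemma Rabs_pow_eq_1 x k : (1 <= k)%nat -> x ^ k = 1 -> x = 1 \/ (x = -1 /\ Nat.Even k).
Proof.
  intros hk H.
  assert (Ha : Rabs x ^ k = 1) by (rewrite RPow_abs, H; apply Rabs_R1).
  assert (H1 : Rabs x = 1).
  { pose proof (Rabs_pos x). destruct (Rtotal_order (Rabs x) 1) as [L|[L|L]]; auto; exfalso.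
    - assert (Rabs x ^ k < 1); [|lra].
      destruct k as [|k']; [lia|]. simpl.
      assert (Rabs x ^ k' <= 1) by (rewrite <- (pow1 k'); apply pow_incr; lra).
      assert (0 <= Rabs x ^ k') by now apply pow_le. nra.
    - assert (1 < Rabs x ^ k); [|lra]. apply Rlt_pow_R1; auto. }
  destruct (Rcase_abs x) as [L|L].
  - rewrite Rabs_left in H1 by lra. right. split; [lra|].
    destruct (Nat.Even_or_Odd k) as [Q|[q Q]]; auto. exfalso.
    rewrite Q, Nat.add_1_r in H. replace x with (-1) in H by lra. rewrite pow_1_odd in H. lra.
  - rewrite Rabs_right in H1 by lra. auto.
Qed.

Lemma pd_origin_Hadamard (Z A B : pt -> R) : An 2 A -> An 2 B ->
  Z ~=[2] (fun p => p 0%nat * A p + p 1%nat * B p) -> pd 0 Z (fun _ => 0) = A (fun _ => 0) /\ pd 1 Z (fun _ => 0) = B (fun _ => 0).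
Proof.
  intros HA0 HB0 EZ.
  assert (V0 : An 2 (fun p : pt => p 0%nat)) by (apply An_var; lia).
  assert (V1 : An 2 (fun p : pt => p 1%nat)) by (apply An_var; lia).
  assert (G : forall i, (i < 2)%nat -> pd i Z (fun _ => 0) = pd i (fun p : pt => p 0%nat) (fun _ => 0) * A (fun _ => 0)
    + pd i (fun p : pt => p 1%nat) (fun _ => 0) * B (fun _ => 0)).
  { intros i Hi.
    pose proof (near_origin _ _ (pd_near 2 i _ _ Hi EZ)) as E1.
    pose proof (near_origin _ _ (pd_plus 2 i Hi _ _ (An_mul _ _ _ V0 HA0) (An_mul _ _ _ V1 HB0))) as E2.
    pose proof (near_origin _ _ (pd_mul 2 i Hi _ _ V0 HA0)) as E3.
    pose proof (near_origin _ _ (pd_mul 2 i Hi _ _ V1 HB0)) as E4.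
    cbv beta in E1, E2, E3, E4.     etransitivity; [exact E1|]. etransitivity; [exact E2|]. rewrite E3, E4. ring. }
  split; rewrite G by lia; rewrite pd_var_eq, pd_var_neq by lia; ring.
Qed.

(** The values of [A], [B], [C], [E] at the origin are the entries of the linear
    part of a map [(X, Y)] that preserves [H]. *)
Section Jets.
Context (k : nat) (hk : (2 <= k)%nat) (eps : R).
Context (X Y A B C E : pt -> R).
Hypotheses (HA : An 2 A) (HB : An 2 B) (HC : An 2 C) (HE : An 2 E).
Hypothesis EX : X ~=[2] (fun p => p 0%nat * A p + p 1%nat * B p).
Hypothesis EY : Y ~=[2] (fun p => p 0%nat * C p + p 1%nat * E p).
Hypothesis EH : near 2 (fun p => Y p ^ 2 + eps * X p ^ k = p 1%nat ^ 2 + eps * p 0%nat ^ k).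

Let o : pt := fun _ => 0.

Lemma jets_jac : jac X Y o = A o * E o - B o * C o.
Proof using HA HB HC HE EX EY.
  destruct (pd_origin_Hadamard X A B HA HB EX) as [Q0 Q1]. destruct (pd_origin_Hadamard Y C E HC HE EY) as [Q2 Q3].
  unfold jac, o. now rewrite Q0, Q1, Q2, Q3.
Qed.

(** Restrict [H(X, Y) = H] to the line spanned by [(a, b)], divide by the square
    of the parameter and let it tend to [0]. *)
Lemma jets_line a b :
  (a * C o + b * E o) ^ 2 + eps * 0 ^ (k - 2) * (a * A o + b * B o) ^ k
  = b ^ 2 + eps * 0 ^ (k - 2) * a ^ k.
Proof using hk HA HB HC HE EX EY EH.
  assert (V : An 1 (fun q : pt => q 0%nat)) by (apply An_var; lia).
  assert (Va : An 1 (fun q : pt => a * q 0%nat)) by now apply An_scal.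
  assert (Vb : An 1 (fun q : pt => b * q 0%nat)) by now apply An_scal.
  assert (Z : forall c, zero_at_origin (fun q : pt => c * q 0%nat)) by (intros; unfold zero_at_origin; ring).
  set (L := fun q : pt => pt2 (a * q 0%nat) (b * q 0%nat)).
  assert (HL : forall F, An 2 F -> An 1 (fun q => F (L q))).
  { intros F HF. apply (An_comp2 1 _ _ Va Vb (Z a) (Z b) F HF). }
  pose proof (near_comp2 1 _ _ Va Vb (Z a) (Z b) _ (near_and _ _ _ EH (near_and _ _ _ EX EY))) as N.
  set (F := fun q : pt => (a * C (L q) + b * E (L q)) ^ 2
    + eps * q 0%nat ^ (k - 2) * (a * A (L q) + b * B (L q)) ^ k
    - b ^ 2 - eps * q 0%nat ^ (k - 2) * a ^ k).
  assert (Lo : L o = o) by (unfold L, o; rewrite !Rmult_0_r; apply pt2_0).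
  assert (HF : An 1 F).
  { apply An_minus; [apply An_minus; [apply An_plus|apply An_const]|].
    - apply An_pow, An_plus; apply An_scal; auto.
    - apply An_mul; [apply An_scal, An_pow; auto|]. apply An_pow, An_plus; apply An_scal; auto.
    - apply An_mul; [apply An_scal, An_pow; auto|apply An_const]. }
  assert (F0 : F o = 0).
  { apply (An1_cancel 2); auto. eapply near_imp; [|exact N]. fold L.
    intros q [N1 [N2 N3]]. unfold F. fold (L q) in N1, N2, N3. rewrite N2, N3 in N1.
    change (L q 0%nat) with (a * q 0%nat) in N1. change (L q 1%nat) with (b * q 0%nat) in N1.
    replace (a * q 0%nat * C (L q) + b * q 0%nat * E (L q))
      with (q 0%nat * (a * C (L q) + b * E (L q))) in N1 by ring.
    replace (a * q 0%nat * A (L q) + b * q 0%nat * B (L q))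
      with (q 0%nat * (a * A (L q) + b * B (L q))) in N1 by ring.
    rewrite !Rpow_mult_distr in N1.
    replace (q 0%nat ^ k) with (q 0%nat ^ 2 * q 0%nat ^ (k - 2)) in N1 by (rewrite <- pow_add; f_equal; lia).
    lra. }
  unfold F in F0. rewrite Lo in F0. unfold o at 3 6 in F0. fold o in F0. lra.
Qed.
End Jets.

(** For [k = 2] the linear part preserves a nondegenerate quadratic form, so
    its determinant squares to [1].  For [k >= 3] the axis [xi = 0] is mapped to a
    curve tangent to it to order [k - 1], because [dH/dxi] vanishes on it;
    comparing the terms in [x^k] of [H] on this curve gives [A(0)^k = 1]. *)
Lemma preserve_H_jets (k : nat) (eps : R) (X Y A B C E : pt -> R) :
  (2 <= k)%nat -> eps = 1 \/ eps = -1 ->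
  An 2 X -> An 2 Y -> An 2 A -> An 2 B -> An 2 C -> An 2 E ->
  X ~=[2] (fun p => p 0%nat * A p + p 1%nat * B p) ->
  Y ~=[2] (fun p => p 0%nat * C p + p 1%nat * E p) ->
  near 2 (fun p => Y p ^ 2 + eps * X p ^ k = p 1%nat ^ 2 + eps * p 0%nat ^ k) ->
  0 < jac X Y (fun _ => 0) ->
  jac X Y (fun _ => 0) = 1 /\
  (k = 2%nat \/ A (fun _ => 0) = 1 \/ (A (fun _ => 0) = -1 /\ Nat.Even k)).
Proof.
  intros hk heps HX HY HA HB HC HE EX EY EH HJ.
  pose proof (jets_jac X Y A B C E HA HB HC HE EX EY) as EJ.
  pose proof (jets_line k hk eps X Y A B C E HA HB HC HE EX EY EH) as HL.
  rewrite EJ in HJ |- *.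
  pose proof (HL 1 0) as L10. pose proof (HL 0 1) as L01. pose proof (HL 1 1) as L11.
  assert (Hsq : forall x, 0 < x -> x ^ 2 = 1 -> x = 1) by (intros; nra).
  assert (He2 : eps * eps = 1) by now apply eps_sqr.
  pose (z := fun _ : nat => 0). fold z in L10, L01, L11, HJ |- *.
  destruct (Nat.eq_dec k 2) as [->|Hk2].
  - split; [|auto]. apply Hsq; auto. simpl in L10, L01, L11.
    apply Rmult_eq_reg_l with eps; [|destruct heps; lra].
    assert (S1 : C z * C z + eps * (A z * A z) = eps) by lra.
    assert (S2 : E z * E z + eps * (B z * B z) = 1) by lra.
    assert (S3 : C z * E z + eps * (A z * B z) = 0) by lra.
    transitivity ((C z * C z + eps * (A z * A z)) * (E z * E z + eps * (B z * B z))
      - (C z * E z + eps * (A z * B z)) ^ 2 + (1 - eps * eps) * 0).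
    + transitivity ((C z * C z + eps * (A z * A z)) * (E z * E z + eps * (B z * B z))
        - (C z * E z + eps * (A z * B z)) ^ 2); [ring|ring].
    + rewrite S1, S2, S3. ring.
  - rewrite pow_i in L10, L01 by lia.
    assert (C0 : C z = 0) by nra. assert (E0 : E z ^ 2 = 1) by lra.
    assert (Ak : A z ^ k = 1).
    { assert (V : An 1 (fun q : pt => q 0%nat)) by (apply An_var; lia).
      assert (Vz : An 1 (fun _ : pt => 0)) by apply An_const.
      assert (Z1 : zero_at_origin (fun q : pt => q 0%nat)) by reflexivity.
      assert (Z2 : zero_at_origin (fun _ : pt => 0)) by reflexivity.
      set (L := fun q : pt => pt2 (q 0%nat) 0).
      assert (HLL : forall F, An 2 F -> An 1 (fun q => F (L q))).
      { intros F HF. apply (An_comp2 1 _ _ V Vz Z1 Z2 F HF). }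
      pose proof (preserve_dH k hk eps X Y HX HY EH) as DH.
      pose proof (near_comp2 1 _ _ V Vz Z1 Z2 _ (near_and _ _ _ (near_and _ _ _ EH DH) (near_and _ _ _ EX EY))) as N.
      assert (PX : An 2 (pd 1 X)) by (apply An_pd; auto).
      assert (PY : An 2 (pd 1 Y)) by (apply An_pd; auto).
      set (F := fun q : pt => eps * (1 - A (L q) ^ k) * pd 1 Y (L q) ^ 2
        - (INR k / 2) ^ 2 * q 0%nat ^ (k - 2) * (A (L q) ^ (k - 1) * pd 1 X (L q)) ^ 2).
      assert (HF : An 1 F).
      { apply An_minus; apply An_mul.
        - apply An_scal, An_minus; [apply An_const|apply An_pow; auto].
        - apply An_pow; auto.
        - apply An_scal, An_pow; auto.
        - apply An_pow, An_mul; auto. apply An_pow; auto. }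
      assert (F0 : F z = 0).
      { apply (An1_cancel k); auto. eapply near_imp; [|exact N].
        intros q [[N1 [_ N4]] [N2 N3]]. fold (L q) in N1, N2, N3, N4.
        change (L q 0%nat) with (q 0%nat) in *. change (L q 1%nat) with 0 in *.
        rewrite Rmult_0_l, Rplus_0_r in N2, N3. rewrite N2, N3 in N1, N4.
        rewrite !Rpow_mult_distr in N1, N4.
        assert (Hpk : q 0%nat ^ k * q 0%nat ^ (k - 2) = (q 0%nat ^ (k - 1)) ^ 2).
        { rewrite <- pow_mult, <- pow_add. f_equal. lia. }
        assert (T1 : q 0%nat ^ k * (eps * (1 - A (L q) ^ k)) = (q 0%nat * C (L q)) ^ 2).
        { rewrite Rpow_mult_distr. rewrite (pow_i 2) in N1 by lia.
          transitivity (eps * q 0%nat ^ k - eps * (q 0%nat ^ k * A (L q) ^ k)); [ring|].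
          rewrite <- (Rpow_mult_distr (q 0%nat) (A (L q)) k). rewrite ?Rpow_mult_distr in *. lra. }
        assert (T2 : q 0%nat * C (L q) * pd 1 Y (L q)
          = - (eps * INR k / 2) * (q 0%nat ^ (k - 1) * (A (L q) ^ (k - 1) * pd 1 X (L q)))).
        { set (u := q 0%nat * C (L q) * pd 1 Y (L q)).
          set (v := q 0%nat ^ (k - 1) * (A (L q) ^ (k - 1) * pd 1 X (L q))).
          assert (N5 : 2 * u + eps * INR k * v = 0).
          { transitivity (2 * 0); [rewrite <- N4; unfold u, v; ring|ring]. }
          clearbody u v. lra. }
        unfold F.
        transitivity ((q 0%nat ^ k * (eps * (1 - A (L q) ^ k))) * pd 1 Y (L q) ^ 2
          - (INR k / 2) ^ 2 * (q 0%nat ^ k * q 0%nat ^ (k - 2)) * (A (L q) ^ (k - 1) * pd 1 X (L q)) ^ 2);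
          [ring|].
        rewrite T1, Hpk, <- Rpow_mult_distr, T2.
        transitivity ((eps * eps - 1) * ((INR k / 2) ^ 2 * (q 0%nat ^ (k - 1)) ^ 2 * (A (L q) ^ (k - 1) * pd 1 X (L q)) ^ 2));
          [field|rewrite He2; ring]. }
      assert (Lz : L z = z) by (apply pt2_0).
      unfold F in F0. rewrite Lz in F0. change (z 0%nat) with 0 in F0. rewrite pow_i in F0 by lia.
      destruct (pd_origin_Hadamard Y C E HC HE EY) as [_ QE]. fold z in QE. rewrite QE, E0 in F0.
      assert (eps * (1 - A z ^ k) = 0) by lra.
      apply Rmult_integral in H. destruct heps, H; lra. }
    rewrite C0, Rmult_0_r, Rminus_0_r in HJ |- *.
    destruct (Rabs_pow_eq_1 (A z) k ltac:(lia) Ak) as [Q|[Q Q']].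
    + split; [|auto]. apply Hsq; auto. rewrite Q, Rmult_1_l. exact E0.
    + split; [|auto]. apply Hsq; auto. rewrite Q.
      transitivity (E z ^ 2); [ring|exact E0].
Qed.

Lemma locally_at_0 (P : R -> Prop) : locally 0 P -> P 0.
Proof. apply locally_singleton. Qed.

(** An equivalence multiplies [f_i] by [A^(i-1) J], with [A] the derivative of
    its first component along [x] at the origin, and [J] the Jacobian there.
    The orientation hypothesis, through [f_1], says that [J > 0]. *)
Theorem normal_forms_equivalent_only (k : nat) (eps : R) (f g : nat -> R -> R) :
  (2 <= k)%nat -> eps = 1 \/ eps = -1 ->
  nf_params k f -> nf_params k g -> same_orientation f g ->
  equivalent_pairs (normal_form k eps f) (normal_form k eps g) ->
  coincide k f g \/ (Nat.Even k /\ coincide k f (flip_even g)).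
Proof.
  intros hk heps [Hf f0] [Hg g0] Ho (psi & Hpsi & E1 & E2).
  destruct Hpsi as (Hpsi & _). apply analytic_map_germ_An in Hpsi.
  destruct Hpsi as (HX & HY & X0 & Y0).
  set (X := comp1 psi) in *. set (Y := comp2 psi) in *.
  apply germ_eq2_near in E1, E2.
  assert (EH : near 2 (fun p => Y p ^ 2 + eps * X p ^ k = p 1%nat ^ 2 + eps * p 0%nat ^ k)).
  { eapply near_imp; [|exact E1]. intros p Q.
    change (lift (fun q => A_model k eps (psi q)) p = lift (A_model k eps) p) in Q.
    rewrite (lift_comp (A_model k eps) psi p) in Q. exact Q. }
  assert (EW : near 2 (fun p => Derive (nf_fun k f) (X p) * jac X Y p = Derive (nf_fun k g) (p 0%nat))).
  { eapply near_imp; [|exact E2]. intros p Q.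
    change (lift (pullback2 psi (snd (normal_form k eps f))) p
      = lift (snd (normal_form k eps g)) p) in Q.
    rewrite lift_pullback2, !lift_normal_form in Q. exact Q. }
  assert (Hcoef : forall h : nat -> R -> R, (forall i, (1 <= i <= k - 1)%nat -> analytic1 (h i)) ->
    exists a : nat -> nat -> R, forall j, (j <= k - 2)%nat ->
      locally 0 (fun t => is_pseries (a j) t (h (S j) t))).
  { intros h Hh. apply (functional_choice (fun j aj => (j <= k - 2)%nat ->
      locally 0 (fun t => is_pseries aj t (h (S j) t)))).
    intros j. destruct (le_lt_dec j (k - 2)) as [Hj|Hj].
    - destruct (Hh (S j)) as [b Hb]; [lia|]. exists b. auto.
    - exists (fun _ => 0). intros; lia. }
  destruct (Hcoef f Hf) as [a Ha]. destruct (Hcoef g Hg) as [b Hb].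
  destruct (Hadamard X HX X0) as (A & B & HA & HB & EX).
  destruct (Hadamard Y HY Y0) as (C & E & HC & HE & EY).
  set (o := fun _ : nat => 0).
  assert (V0 : An 2 (fun p : pt => p 0%nat)) by (apply An_var; lia).
  assert (V1 : An 2 (fun p : pt => p 1%nat)) by (apply An_var; lia).
  set (lam := fun i => A o ^ i * jac X Y o).
  assert (Hab : forall i M, (i < k - 1)%nat -> b i M = lam i * a i M).
  { intros i M Hi.
    pose proof (class_coeff_nf k hk eps heps f a Ha X Y HX HY X0 EH i M A B Hi HA HB EX) as Q1.
    assert (J1 : forall p, jac (fun p : pt => p 0%nat) (fun p : pt => p 1%nat) p = 1).
    { intros p. unfold jac. rewrite !pd_var_eq, !pd_var_neq by lia. ring. }
    assert (EId : (fun p : pt => p 0%nat) ~=[2] (fun p => p 0%nat * 1 + p 1%nat * 0))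
      by (apply near_all; intros; ring).
    pose proof (class_coeff_nf k hk eps heps g b Hb (fun p => p 0%nat) (fun p => p 1%nat) V0 V1 eq_refl
      (near_all _ _ (fun _ => eq_refl)) i M (fun _ => 1) (fun _ => 0) Hi (An_const 2 1) (An_const 2 0)
      EId) as Q2.
    rewrite J1, pow1, !Rmult_1_r in Q2.
    rewrite (class_coeff_near k eps i M _ _ EW) in Q1.
    rewrite (class_coeff_near k eps i M _ (fun p => Derive (nf_fun k g) (p 0%nat))) in Q2.
    2:{ apply near_all. intros p. rewrite J1. ring. }
    rewrite Q2 in Q1. fold o in Q1. fold (lam i) in Q1.
    apply Rmult_eq_reg_l with (INR (S (i + k * M))); [|apply not_0_INR; lia].
    rewrite Q1. ring. }
  assert (Hfg : forall i, (i < k - 1)%nat -> locally 0 (fun t => g (S i) t = lam i * f (S i) t)).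
  { intros i Hi. specialize (Ha i ltac:(lia)). specialize (Hb i ltac:(lia)).
    eapply filter_imp; [|exact (filter_and _ _ Ha Hb)]. intros t [S1 S2].
    apply is_pseries_R in S1, S2.
    apply (is_series_scal_R (lam i)) in S1.
    rewrite <- (is_series_unique _ _ S1), <- (is_series_unique _ _ S2).
    apply Series_ext. intros n. rewrite Hab by auto. ring. }
  assert (HJ : 0 < jac X Y o).
  { pose proof (locally_at_0 _ (Hfg 0%nat ltac:(lia))) as Q. unfold lam in Q. simpl in Q.
    unfold same_orientation in Ho. rewrite Q in Ho.
    destruct (Rle_lt_dec (jac X Y o) 0) as [L|L]; auto. exfalso. nra. }
  destruct (preserve_H_jets k eps X Y A B C E hk heps HX HY HA HB HC HE EX EY EH HJ) as [J1 HA1].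
  fold o in J1, HA1.
  assert (Hlam : forall i, lam i = A o ^ i) by (intros; unfold lam; rewrite J1; ring).
  destruct HA1 as [->|[HA1|[HA1 Hev]]].
  - left. intros i Hi. assert (i = 1%nat) by lia. subst i.
    unfold germ_eq1. eapply filter_imp; [|apply (Hfg 0%nat); lia]. cbv beta. intros t ->. rewrite Hlam. simpl. ring.
  - left. intros i Hi. destruct i as [|i]; [lia|].
    unfold germ_eq1. eapply filter_imp; [|apply (Hfg i); lia]. cbv beta. intros t ->. rewrite Hlam, HA1, pow1. ring.
  - right. split; auto. intros i Hi. destruct i as [|i]; [lia|].
    unfold germ_eq1. eapply filter_imp; [|apply (Hfg i); lia]. cbv beta. intros t Q. unfold flip_even. rewrite Q, Hlam, HA1.
    destruct (Nat.even (S i)) eqn:Ev.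
    + apply Nat.even_spec in Ev. destruct Ev as [n Hn].
      replace i with (S (2 * (n - 1)))%nat by lia. rewrite pow_1_odd. ring.
    + assert (Od : Nat.Odd (S i)) by (apply Nat.odd_spec; unfold Nat.odd; now rewrite Ev).
      destruct Od as [n Hn]. replace i with (2 * n)%nat by lia. rewrite pow_1_even. ring.
Qed.

(** ** Equivalences between normal forms *)

Lemma coincide_equivalent (k : nat) (eps : R) (f g : nat -> R -> R) :
  (2 <= k)%nat -> coincide k f g ->
  equivalent_pairs (normal_form k eps f) (normal_form k eps g).
Proof.
  intros hk Hc.
  assert (E : near 1 (fun q => nf_fun k f (q 0%nat) = nf_fun k g (q 0%nat))).
  { assert (H : near 1 (fun q => forall j, (j < S (k - 2))%nat ->
      f (S j) (q 0%nat ^ k) = g (S j) (q 0%nat ^ k))).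
    { apply near_forall. intros j Hj.
      assert (Ej := Hc (S j) ltac:(lia)). unfold germ_eq1 in Ej. apply locally1_near in Ej.
      apply (near_comp 1 1 (fun _ (q : pt) => q 0%nat ^ k)
        (fun _ _ => An_pow 1 _ k (An_var 1 0 ltac:(lia))) (fun _ _ => pow_i k ltac:(lia)) _ Ej). }
    eapply near_imp; [|exact H]. intros q Hq. rewrite !nf_fun_sum_n by auto.
    apply sum_n_ext_R. intros j Hj. rewrite Hq by lia. reflexivity. }
  pose proof (pd_near 1 0 _ _ ltac:(lia) E) as D.
  assert (D2 : near 2 (fun p : pt => Derive (nf_fun k f) (p 0%nat) = Derive (nf_fun k g) (p 0%nat))).
  { exact (near_comp 1 2 (fun _ (p : pt) => p 0%nat) (fun _ _ => An_var 2 0 ltac:(lia))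
      (fun _ _ => eq_refl) _ D). }
  apply equivalent_pairs_of_germs with (fun p : pt => p 0%nat) (fun p : pt => p 1%nat);
    try reflexivity; try (apply An_var; lia);
    rewrite ?pd_var_eq, ?pd_var_neq by lia; try reflexivity.
  - now apply near_all.
  - eapply near_imp; [|exact D2]. intros p Q.
    change (lift (ext_d (fun _ => 0, fun p => nf_fun k f (fst p))) (pt2 (p 0%nat) (p 1%nat)))
      with (lift (snd (normal_form k eps f)) (pt2 (p 0%nat) (p 1%nat))).
    change (lift (ext_d (fun _ => 0, fun p => nf_fun k g (fst p))) p)
      with (lift (snd (normal_form k eps g)) p).
    rewrite !lift_normal_form. unfold jac. rewrite !pd_var_eq, !pd_var_neq by lia.
    simpl pt2. rewrite Q. ring.
Qed.

(** The map [- id] preserves [H] for even [k], and replaces [f(x)] by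
    [- f(- x)]: the terms of odd degree stay and those of even degree change
    their sign. *)
Lemma flip_equivalent (k : nat) (eps : R) (g : nat -> R -> R) :
  (2 <= k)%nat -> Nat.Even k -> nf_params k g ->
  equivalent_pairs (normal_form k eps (flip_even g)) (normal_form k eps g).
Proof.
  intros hk [l Hl] [Hg _].
  assert (Hpow : forall x, (- x) ^ k = x ^ k).
  { intros x. rewrite Hl, !pow_mult. f_equal. ring. }
  assert (Hsym : forall x, nf_fun k (flip_even g) x = - nf_fun k g (- x)).
  { intros x. rewrite !nf_fun_sum_n by auto. rewrite Hpow.
    replace (- sum_n (fun j => (- x) ^ S j * g (S j) (x ^ k)) (k - 2))
      with (-1 * sum_n (fun j => (- x) ^ S j * g (S j) (x ^ k)) (k - 2)) by ring.
    rewrite <- sum_n_scal_R. apply sum_n_ext_R. intros j _. unfold flip_even.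
    replace (- x) with (-1 * x) by ring. rewrite Rpow_mult_distr.
    destruct (Nat.even (S j)) eqn:Ev.
    - apply Nat.even_spec in Ev. destruct Ev as [n Hn]. rewrite Hn, pow_1_even. ring.
    - assert (Od : Nat.Odd (S j)) by (apply Nat.odd_spec; unfold Nat.odd; now rewrite Ev).
      destruct Od as [n Hn]. rewrite Hn, Nat.add_1_r, pow_1_odd. ring. }
  set (sg := fun q : R * R => (- fst q, - snd q)).
  assert (Hsg : analytic_map_germ sg).
  { apply analytic_map_germ_An. split; [|split; [|split]].
    - apply (An_opp 2 (fun p : pt => p 0%nat)), An_var; lia.
    - apply (An_opp 2 (fun p : pt => p 1%nat)), An_var; lia.
    - unfold zero_at_origin, comp1, lift, sg. simpl. ring.
    - unfold zero_at_origin, comp2, lift, sg. simpl. ring. }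
  assert (Hinv : germ_eq2 (fun q => sg (sg q)) (fun q => q)).
  { unfold germ_eq2. apply filter_forall. intros [x y]. unfold sg. simpl. f_equal; ring. }
  exists sg. split; [|split].
  - split; auto. exists sg. auto.
  - unfold germ_eq2. apply filter_forall. intros [x y]. unfold normal_form, A_model, sg. simpl fst. simpl snd.
    rewrite Hpow. ring.
  - apply germ_eq2_near.
    assert (HA : An 2 (fun p => nf_fun k g (p 0%nat))) by (apply An_nf_fun; auto).
    pose proof (An_derive 2 0 _ ltac:(lia) HA) as D.
    eapply near_imp; [|exact D]. intros p Dp.
    rewrite lift_pullback2, !lift_normal_form. simpl pt2.
    change (comp1 sg p) with (- p 0%nat).
    assert (Ej : jac (comp1 sg) (comp2 sg) p = 1).
    { unfold jac.
      assert (G : forall i, pd i (comp1 sg) p = - pd i (fun p : pt => p 0%nat) p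
        /\ pd i (comp2 sg) p = - pd i (fun p : pt => p 1%nat) p).
      { intros i. split; unfold pd; rewrite <- Derive_opp; reflexivity. }
      destruct (G 0%nat) as [G1 G2], (G 1%nat) as [G3 G4]. rewrite G1, G2, G3, G4.
      rewrite !pd_var_eq, !pd_var_neq by lia. ring. }
    rewrite Ej, Rmult_1_r.
    change (is_derive (nf_fun k g) (p 0%nat) (Derive (nf_fun k g) (p 0%nat))) in Dp.
    apply is_derive_unique.
    apply is_derive_ext with (fun y => - nf_fun k g (- y)); [intros y; symmetry; apply Hsym|].
    assert (Dm : is_derive (fun y : R => - y) (- p 0%nat) (-1)) by (auto_derive; auto; ring).
    assert (Dp' : is_derive (nf_fun k g) (- - p 0%nat) (Derive (nf_fun k g) (p 0%nat)))
      by (rewrite Ropp_involutive; exact Dp).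
    pose proof (is_derive_opp _ _ _ (is_derive_comp _ _ _ _ _ Dp' Dm)) as R1.
    unfold opp, scal in R1; simpl in R1. unfold mult in R1; simpl in R1.
    replace (Derive (nf_fun k g) (p 0%nat)) with (- (-1 * Derive (nf_fun k g) (p 0%nat))) by ring.
    exact R1.
Qed.

(** ** Minimality *)

Lemma taylor_coeff_pseries (h : R -> R) (a : nat -> R) m :
  locally 0 (fun t => is_pseries a t (h t)) -> taylor_coeff h m = a m.
Proof.
  intros H. unfold taylor_coeff.
  assert (HP : locally 0 (fun t => PSeries a t = h t)).
  { eapply filter_imp; [|exact H]. intros t Ht. now apply is_pseries_unique. }
  assert (HCV : Rbar_lt 0 (CV_radius a)).
  { apply locally_Rabs_iff in H. destruct H as (e & He & H).
    apply CV_radius_pos_of_series with e; auto. intros t Ht. eexists. apply is_pseries_R, H.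
    now rewrite Rminus_0_r. }
  rewrite <- (Derive_n_ext_loc _ _ m 0 HP), Derive_n_coef by auto.
  field. apply INR_fact_neq_0.
Qed.

Lemma is_pseries_const_pow (c d : R) m t :
  is_pseries (fun n => (if Nat.eqb n 0 then c else 0) + (if Nat.eqb n m then d else 0)) t (c + d * t ^ m).
Proof.
  apply is_pseries_R.
  assert (S1 : is_series (fun n => (if Nat.eqb n 0 then c else 0) * t ^ n) c).
  { apply is_series_delta with 0%nat.
    - intros [|n] Hn; [lia|]. simpl; ring.
    - simpl; ring. }
  assert (S2 : is_series (fun n => (if Nat.eqb n m then d else 0) * t ^ n) (d * t ^ m)).
  { apply is_series_delta with m.
    - intros n Hn. destruct (Nat.eqb_spec n m); [congruence|ring].
    - now rewrite Nat.eqb_refl. }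
  eapply is_series_ext_R; [|exact (is_series_plus_R _ _ _ _ S1 S2)]. intros n. cbv beta. ring.
Qed.

(** If the coefficient [m] of [f_i] were left out, the normal forms of [x] and
    of [x + x^(i + k m)] would not be separated. *)
Lemma coefficients_minimal (k : nat) (eps : R) (S : nat -> nat -> Prop) :
  (forall f g, nf_params k f -> nf_params k g -> same_orientation f g ->
     equivalent_pairs (normal_form k eps f) (normal_form k eps g) -> coincide k f g) ->
  complete_coeffs k eps S ->
  forall i m : nat, (1 <= i <= k - 1)%nat -> S i m.
Proof.
  intros Hu HS i m Hi. apply NNPP. intros HN.
  set (c := fun j : nat => if Nat.eqb j 1 then 1 else 0).
  set (d := fun j : nat => if Nat.eqb j i then 1 else 0).
  set (f := fun j (t : R) => c j + 0 * t ^ m). set (g := fun j t => c j + d j * t ^ m).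
  assert (Han : forall (e : R) j, analytic1 (fun t => c j + e * t ^ m)).
  { intros e j. eexists. apply filter_forall. intros t. apply is_pseries_const_pow. }
  assert (Hg1 : 1 <= g 1%nat 0).
  { unfold g, c, d. simpl (Nat.eqb 1 1). cbv iota.
    assert (0 <= 0 ^ m) by (apply pow_le; lra).
    destruct (Nat.eqb 1 i); lra. }
  assert (Hf1 : f 1%nat 0 = 1) by (unfold f, c; simpl; ring).
  assert (Hf : nf_params k f) by (split; [intros; apply Han|lra]).
  assert (Hg : nf_params k g) by (split; [intros; apply Han|lra]).
  assert (Ho : same_orientation f g) by (unfold same_orientation; rewrite Hf1; lra).
  assert (Eq : equivalent_pairs (normal_form k eps f) (normal_form k eps g)).
  { apply HS; auto. intros j n Hj Hjn.
    rewrite (taylor_coeff_pseries (f j) _ n (filter_forall _ (is_pseries_const_pow (c j) 0 m))).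
    rewrite (taylor_coeff_pseries (g j) _ n (filter_forall _ (is_pseries_const_pow (c j) (d j) m))).
    unfold d. destruct (Nat.eqb_spec n m) as [->|]; auto.
    destruct (Nat.eqb_spec j i) as [->|]; auto. contradiction. }
  pose proof (Hu f g Hf Hg Ho Eq i Hi) as Hco. unfold germ_eq1 in Hco.
  apply locally_Rabs_iff in Hco. destruct Hco as (e & He & Hco).
  specialize (Hco (e / 2)). rewrite Rminus_0_r, Rabs_pos_eq in Hco by lra.
  specialize (Hco ltac:(lra)). unfold f, g, d in Hco. rewrite Nat.eqb_refl in Hco.
  assert (0 < (e / 2) ^ m) by (apply pow_lt; lra). lra.
Qed.

Theorem theorem3p1 (k : nat) (hk : (2 <= k)%nat)
    (eps : R) (heps : eps = 1 \/ eps = -1) :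
  (forall (H : R * R -> R) (w : two_form),
     analytic2 H -> symplectic_germ w -> has_A_singularity k eps H ->
     exists f : nat -> R -> R,
       nf_params k f /\ equivalent_pairs (H, w) (normal_form k eps f)) /\
  (Nat.Odd k ->
     (forall f g : nat -> R -> R,
        nf_params k f -> nf_params k g -> same_orientation f g ->
        (equivalent_pairs (normal_form k eps f) (normal_form k eps g) <->
         coincide k f g)) /\
     (forall S : nat -> nat -> Prop,
        complete_coeffs k eps S ->
        forall i m : nat, (1 <= i <= k - 1)%nat -> S i m)) /\
  (Nat.Even k ->
     forall f g : nat -> R -> R,
       nf_params k f -> nf_params k g -> same_orientation f g ->
       (equivalent_pairs (normal_form k eps f) (normal_form k eps g) <->
        (coincide k f g \/ coincide k f (flip_even g)))).
Proof.
  split; [|split].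
  - intros H w _ Hw HH. now apply existence_normal_form.
  - intros Hodd.
    assert (Honly : forall f g, nf_params k f -> nf_params k g -> same_orientation f g ->
      equivalent_pairs (normal_form k eps f) (normal_form k eps g) -> coincide k f g).
    { intros f g Hf Hg Ho He.
      destruct (normal_forms_equivalent_only k eps f g hk heps Hf Hg Ho He) as [Q|[Q _]]; auto.
      exfalso. exact (Nat.Even_Odd_False k Q Hodd). }
    split.
    + intros f g Hf Hg Ho. split; [now apply Honly|now apply coincide_equivalent].
    + intros S HS. exact (coefficients_minimal k eps S Honly HS).
  - intros Heven f g Hf Hg Ho. split.
    + intros He.
      destruct (normal_forms_equivalent_only k eps f g hk heps Hf Hg Ho He) as [Q|[_ Q]]; auto.
    + intros [Q|Q]; [now apply coincide_equivalent|].
      apply equivalent_pairs_trans with (normal_form k eps (flip_even g)).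
      * now apply coincide_equivalent.
      * now apply flip_equivalent.
Qed.
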